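(* Let $q\colon\mathbb{C}^+\to\mathbb{C}$ be a quasi-Herglotz function written as $q=h_1-h_2$ with $h_1,h_2$ Herglotz functions. (i) Suppose at least one of $h_1,h_2$ admits, at $z=0$, an asymptotic expansion of some order $M\geq -1$. Then, for an integer $N_0\geq 1$ with $2N_0-1\leq M$, the limit $$\lim_{\varepsilon\to 0^+}\lim_{y\to 0^+}\int_{\varepsilon<|x|<1/\varepsilon} x^{-2N_0}\,\Im\{q(x+\mathrm{i}y)\}\,\mathrm{d}x$$ exists as a finite number if and only if $q$ admits, at $z=0$, an asymptotic expansion of order $2N_0-1$. (ii) Suppose at least one of $h_1,h_2$ admits, at $z=\infty$, an asymptotic expansion of some order $K\geq -1$. Then, for an integer $N_\infty\geq 0$ with $2N_\infty+1\leq K$, the limit $$\lim_{\varepsilon\to 0^+}\lim_{y\to 0^+}\int_{\varepsilon<|x|<1/\varepsilon} x^{2N_\infty}\,\Im\{q(x+\mathrm{i}y)\}\,\mathrm{d}x$$ exists as a finite number if and only if $q$ admits, at $z=\infty$, an asymptotic expansion of order $2N_\infty+1$. Furthermore, the identities $$\lim_{\varepsilon\to 0^+}\lim_{y\to 0^+}\frac{1}{\pi}\int_{\varepsilon<|x|<1/\varepsilon} x^{k}\,\Im\{q(x+\mathrm{i}y)\}\,\mathrm{d}x=\begin{cases} a_{-k-1}, & -2N_0\leq k\leq -3,\\ a_{-k-1}-b_{-k-1}, & -2\leq k\leq 0,\\ -b_{-k-1}, & 1\leq k\leq 2N_\infty\end{cases}$$ hold: for $k=-2N_0,-2N_0+1,\dots,-2$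 if there exists an integer $N_0$ as in (i) (i.e. $q$ admits an expansion at $0$ of order $2N_0-1$ under the hypothesis of (i)); for $k=0,1,\dots,2N_\infty$ if there exists an integer $N_\infty$ as in (ii); and for $k=-1$ if there exist integers $N_0$ and $N_\infty$ as in (i) and (ii) respectively. Here $a_{-1},a_0,\dots,a_{2N_0-1}$ are the coefficients of the expansion of $q$ at $z=0$ and $b_{1},b_0,b_{-1},\dots,b_{-(2N_\infty+1)}$ are the coefficients of the expansion of $q$ at $z=\infty$.
   Context: $\mathbb{C}^+=\{z\in\mathbb{C}:\Im z>0\}$. A Herglotz function is an analytic function $h\colon\mathbb{C}^+\to\mathbb{C}$ with $\Im h(z)\geq 0$ for all $z\in\mathbb{C}^+$. A quasi-Herglotz function is an analytic $q\colon\mathbb{C}^+\to\mathbb{C}$ such that $q=h_1-h_2$ on $\mathbb{C}^+$ for some Herglotz functions $h_1,h_2$. For $\theta\in(0,\pi/2]$, a Stoltz domain is $\{z\in\mathbb{C}^+:\theta<\operatorname{Arg}(z)<\pi-\theta\}$; $z\hat\to 0$ (resp. $z\hat\to\infty$) means $|z|\to 0$ (resp. $|z|\to\infty$) within any Stoltz domain. A function $f$ (Herglotz or quasi-Herglotz) admits at $z=0$ an asymptotic expansion of order $M\geq -1$ if there are real numbers $a_{-1},a_0,\dots,a_M$ with $f(z)=\frac{a_{-1}}{z}+a_0+a_1z+\dots+a_Mz^M+o(z^M)$ as $z\hat\to 0$. It admits at $z=\infty$ an asymptotic expansion of order $K\geq -1$ if there are real numbers $b_1,b_0,b_{-1},\dots,b_{-K}$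 with $f(z)=b_1z+b_0+\frac{b_{-1}}{z}+\dots+\frac{b_{-K}}{z^K}+o(z^{-K})$ as $z\hat\to\infty$. *)

(* Defs.v *)
From Stdlib Require Import Reals ZArith.
From Coquelicot Require Import Coquelicot.

Open Scope R_scope.

Definition upper (z : C) : Prop := 0 < Im z.

Definition analytic_upper (f : C -> C) : Prop :=
  forall z : C, upper z -> ex_derive (K := C_AbsRing) (V := C_NormedModule) f z.

Definition Herglotz (h : C -> C) : Prop :=
  analytic_upper h /\ forall z : C, upper z -> 0 <= Im (h z).

Definition Arg_upper (z : C) : R := acos (Re z / Cmod z).

Definition stoltz (theta : R) (z : C) : Prop :=
  upper z /\ theta < Arg_upper z /\ Arg_upper z < PI - theta.

Definition Cpowz (z : C) (j : Z) : C :=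
  match j with
  | Z0 => RtoC 1
  | Zpos p => Cpow z (Pos.to_nat p)
  | Zneg p => Cinv (Cpow z (Pos.to_nat p))
  end.

Definition laurent_sum (c : Z -> R) (lo hi : Z) (z : C) : C :=
  sum_n (fun n : nat => Cmult (RtoC (c (lo + Z.of_nat n)%Z)) (Cpowz z (lo + Z.of_nat n)%Z))
        (Z.to_nat (hi - lo)).

Definition asym_exp_0 (f : C -> C) (M : Z) (a : Z -> R) : Prop :=
  forall theta : R, 0 < theta <= PI / 2 ->
  forall eps : R, 0 < eps -> exists delta : R, 0 < delta /\
    forall z : C, stoltz theta z -> Cmod z < delta ->
      Cmod (Cminus (f z) (laurent_sum a (-1) M z)) <= eps * Cmod (Cpowz z M).

Definition asym_exp_inf (f : C -> C) (K : Z) (b : Z -> R) : Prop :=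
  forall theta : R, 0 < theta <= PI / 2 ->
  forall eps : R, 0 < eps -> exists Rad : R, 0 < Rad /\
    forall z : C, stoltz theta z -> Rad < Cmod z ->
      Cmod (Cminus (f z) (laurent_sum b (- K) 1 z)) <= eps * Cmod (Cpowz z (- K)).

Definition trunc_moment (q : C -> C) (k : Z) (eps y : R) : R :=
  RInt (fun x => powerRZ x k * Im (q (Cplus (RtoC x) (Cmult Ci (RtoC y))))) (- / eps) (- eps)
  + RInt (fun x => powerRZ x k * Im (q (Cplus (RtoC x) (Cmult Ci (RtoC y))))) eps (/ eps).

Definition iter_lim (F : R -> R -> R) (L : R) : Prop :=
  exists G : R -> R,
    (exists delta : R, 0 < delta /\ forall eps : R, 0 < eps < delta ->
        filterlim (fun y => F eps y) (at_right 0) (locally (G eps)))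
    /\ filterlim G (at_right 0) (locally L).

(* Main.v *)
From mathcomp.classical Require filter.
From Stdlib Require Import Reals ZArith Lra Lia Psatz.
From Stdlib Require Classical_Prop ClassicalEpsilon FunctionalExtensionality.
From Coquelicot Require Import Coquelicot.
Require Import Defs.
Open Scope R_scope.

(** A Herglotz function is represented as h(z) = g + J(k_z), where k_z = (1 + t z)/(t - z) and J is a
    positive functional on the bounded functions of the boundary circle.  J is obtained from the
    Schwarz formula in the disc (hence from Goursat's theorem) by ultrafilter limits, first of
    Riemann sums and then of the radius.

    Let mu be the measure of h.  If t^-2 is mu-integrable off 0, then z h(z) = -al + z (a_0 + z (a_1' + z g(z))) with g the Herglotz function
    of t^-2 mu, and z g(z) tends in Stoltz domains to minus the point mass of g at 0.  By induction h
    has an expansion of order 2N-1 at 0 iff the moment of order -2N is finite, and the coefficients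
    are the moments.  Infinity is reduced to the origin by z |-> -1/z.

    Stieltjes inversion squeezes the inner limit of the integral over e < x < 1/e between pi times
    the moments of mu with cutoffs comparable to e.  Hence for q = h1 - h2, if the limit is finite and
    one of the h_i has a finite moment, so has the other. *)

(** [J] is only finitely additive, so it respects uniform limits and nothing more: monotone and
    dominated convergence are not at hand. This shapes the estimates. Limits are taken of numbers
    such as [J (u e)], which are monotone in [e], and a passage to the limit under [J] rests on a
    bound uniform over the circle, often an arithmetic-geometric mean inequality. [J] may also carry
    mass infinitely close to a point without charging the point, so a point mass is a limit of [J]
    on functions shrinking to the point, not a value on an indicator. In return [J] accepts every
    bounded function. The coordinates t = s/c treat 0 and infinity alike: the linear term of the
    classical representation is the mass of [J] near c = 0, and z -> -1/z becomes a quarter turn.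
    Sharp cutoffs at e are not evaluated exactly, since the inner limit sees only half of a mass
    sitting at an end point; an enclosure between comparable cutoffs has the same limit as e tends
    to 0. *)

(** * Ultrafilters and limits along them *)

Record ultrafilter {T : Type} (U : (T -> Prop) -> Prop) : Prop := {
  uf_true : U (fun _ => True);
  uf_and : forall A B : T -> Prop, U A -> U B -> U (fun t => A t /\ B t);
  uf_imp : forall A B : T -> Prop, (forall t, A t -> B t) -> U A -> U B;
  uf_nonempty : ~ U (fun _ => False);
  uf_em : forall A : T -> Prop, U A \/ U (fun t => ~ A t) }.

Lemma ultrafilter_extends {T : Type} (F : (T -> Prop) -> Prop) :
  ProperFilter F -> exists U, ultrafilter U /\ forall A, F A -> U A.
Proof.
intros PF.
destruct (@mathcomp.classical.filter.ultraFilterLemma T F) as [U [HU HF]].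
{ constructor.
  - intros H. destruct (filter_ex _ H) as [x Hx]; exact Hx.
  - constructor.
    + apply filter_true.
    + intros A B; apply filter_and.
    + intros A B HAB; apply filter_imp; exact HAB. }
exists U; split; [|exact HF].
pose proof (@mathcomp.classical.filter.ultra_proper _ _ HU) as HP.
pose proof (@mathcomp.classical.filter.filter_filter _ _ HP) as HFl.
constructor.
- exact (@mathcomp.classical.filter.filterT _ _ HFl).
- intros A B; exact (@mathcomp.classical.filter.filterI _ _ HFl A B).
- intros A B HAB; exact (@mathcomp.classical.filter.filterS _ _ HFl A B HAB).
- exact (@mathcomp.classical.filter.filter_not_empty _ _ HP).
- intros A; exact (@mathcomp.classical.filter.in_ultra_setVsetC _ _ A HU).
Qed.

(** A total function. It is a genuine limit only for [u] bounded along [U]; an infinite supremum is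
    sent to 0 by [real]. *)
Definition ulim {T : Type} (U : (T -> Prop) -> Prop) (u : T -> R) : R :=
  real (Lub_Rbar (fun x => U (fun t => x <= u t))).

Lemma uf_ex {T} (U : (T -> Prop) -> Prop) A : ultrafilter U -> U A -> exists t, A t.
Proof.
intros HU HA. destruct (Classical_Prop.classic (exists t, A t)) as [H|H]; [exact H|].
exfalso; apply (uf_nonempty _ HU). revert HA; apply (uf_imp _ HU).
intros t Ht; apply H; now exists t.
Qed.

(** By [uf_em] each one-sided inequality either holds on a set of [U] or fails on one, and failure
    would contradict the choice of the supremum. *)
Lemma ulim_spec {T} (U : (T -> Prop) -> Prop) (u : T -> R) M :
  ultrafilter U -> U (fun t => Rabs (u t) <= M) ->
  forall eps, 0 < eps -> U (fun t => Rabs (u t - ulim U u) < eps).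
Proof.
intros HU HM eps He.
set (E := fun x => U (fun t => x <= u t)).
assert (HE : forall x, E x -> x <= M).
{ intros x Hx. destruct (uf_ex U _ HU (uf_and _ HU _ _ Hx HM)) as [t [H1 H2]].
  apply Rabs_le_between in H2; lra. }
assert (HE' : E (- M)).
{ revert HM; apply (uf_imp _ HU). intros t Ht; apply Rabs_le_between in Ht; lra. }
pose proof (Lub_Rbar_correct E) as [Hub Hlub].
assert (Hfin : is_finite (Lub_Rbar E)).
{ apply is_finite_correct.
  destruct (Lub_Rbar E) as [l| |] eqn:El.
  - now exists l.
  - exfalso. apply (Hlub (Finite M)). intros x Hx; apply HE; exact Hx.
  - exfalso. apply (Hub _ HE'). }
change (ulim U u) with (real (Lub_Rbar E)).
set (l := real (Lub_Rbar E)) in *.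
assert (Hl : Lub_Rbar E = Finite l) by (symmetry; exact Hfin).
rewrite Hl in Hub, Hlub.
assert (H1 : U (fun t => ~ (l + eps / 2 <= u t))).
{ destruct (uf_em _ HU (fun t => l + eps / 2 <= u t)) as [H|H]; [|exact H].
  exfalso. specialize (Hub _ H). simpl in Hub; lra. }
assert (H2 : U (fun t => l - eps / 2 <= u t)).
{ destruct (uf_em _ HU (fun t => l - eps / 2 <= u t)) as [H|H]; [exact H|].
  exfalso. assert (Hx : Rbar_le (Finite l) (Finite (l - eps / 2))).
  { apply Hlub. intros x Hx. simpl.
    destruct (uf_ex U _ HU (uf_and _ HU _ _ Hx H)) as [t [A B]]. simpl in *; lra. }
  simpl in Hx; lra. }
generalize (uf_and _ HU _ _ H1 H2); apply (uf_imp _ HU).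
intros t [A B]. apply Rabs_def1; lra.
Qed.

Lemma ulim_unique {T} (U : (T -> Prop) -> Prop) (u : T -> R) l :
  ultrafilter U -> (forall eps, 0 < eps -> U (fun t => Rabs (u t - l) < eps)) -> ulim U u = l.
Proof.
intros HU H.
assert (HM : U (fun t => Rabs (u t) <= Rabs l + 1)).
{ generalize (H 1 Rlt_0_1); apply (uf_imp _ HU). intros t Ht.
  pose proof (Rabs_triang (u t - l) l). replace (u t - l + l) with (u t) in H0 by ring. lra. }
apply Rminus_diag_uniq. apply Rabs_eq_0.
apply Rle_antisym; [|apply Rabs_pos].
apply Rnot_lt_le; intros Hlt.
set (d := Rabs (ulim U u - l)) in *.
pose proof (ulim_spec U u _ HU HM (d / 2) ltac:(lra)) as H1.
pose proof (H (d / 2) ltac:(lra)) as H2.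
destruct (uf_ex U _ HU (uf_and _ HU _ _ H1 H2)) as [t [A B]].
assert (d <= Rabs (u t - l) + Rabs (u t - ulim U u)).
{ unfold d. replace (ulim U u - l) with ((u t - l) + - (u t - ulim U u)) by ring.
  rewrite <- (Rabs_Ropp (u t - ulim U u)). apply Rabs_triang. }
lra.
Qed.

Lemma Rabs_sq x : Rabs x * Rabs x = x * x.
Proof. rewrite <- Rabs_mult, Rabs_pos_eq; nra. Qed.

(** * Positive functionals on the circle *)

Definition circ (c s : R) : Prop := c * c + s * s = 1.

Definition bdd (f : R -> R -> R) : Prop :=
  exists B, forall c s, circ c s -> Rabs (f c s) <= B.

(* A positive functional on all bounded functions, i.e. a finitely additive measure on the circle:
   no regularity of the test functions is ever needed, so sharp cutoffs are allowed. *)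
Record posfun (J : (R -> R -> R) -> R) : Prop := {
  pf_add : forall f g, bdd f -> bdd g -> J (fun c s => f c s + g c s) = J f + J g;
  pf_scal : forall a f, bdd f -> J (fun c s => a * f c s) = a * J f;
  pf_mono : forall f g, bdd f -> bdd g ->
    (forall c s, circ c s -> f c s <= g c s) -> J f <= J g }.

Lemma circ_le1 c s : circ c s -> Rabs c <= 1 /\ Rabs s <= 1.
Proof. unfold circ; intros H; split; apply Rabs_le; nra. Qed.

Lemma bdd_const a : bdd (fun _ _ => a).
Proof. exists (Rabs a); intros; lra. Qed.

Lemma bdd_c : bdd (fun c _ => c).
Proof. exists 1; intros c s H; apply (circ_le1 c s H). Qed.

Lemma bdd_s : bdd (fun _ s => s).
Proof. exists 1; intros c s H; apply (circ_le1 c s H). Qed.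

Lemma bdd_plus f g : bdd f -> bdd g -> bdd (fun c s => f c s + g c s).
Proof.
intros [A HA] [B HB]; exists (A + B); intros c s H.
eapply Rle_trans; [apply Rabs_triang|]. specialize (HA c s H); specialize (HB c s H); lra.
Qed.

Lemma bdd_opp f : bdd f -> bdd (fun c s => - f c s).
Proof. intros [A HA]; exists A; intros c s H. rewrite Rabs_Ropp; auto. Qed.

Lemma bdd_minus f g : bdd f -> bdd g -> bdd (fun c s => f c s - g c s).
Proof. intros; apply bdd_plus; [|apply bdd_opp]; auto. Qed.

Lemma bdd_mult f g : bdd f -> bdd g -> bdd (fun c s => f c s * g c s).
Proof.
intros [A HA] [B HB]; exists (A * B); intros c s H. rewrite Rabs_mult.
apply Rmult_le_compat; auto using Rabs_pos.
Qed.

Lemma bdd_abs f : bdd f -> bdd (fun c s => Rabs (f c s)).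
Proof. intros [A HA]; exists A; intros c s H. rewrite Rabs_Rabsolu; auto. Qed.

Lemma bdd_pow f n : bdd f -> bdd (fun c s => f c s ^ n).
Proof.
intros Hf; induction n; simpl; [apply bdd_const|]. apply bdd_mult; auto.
Qed.

Lemma bdd_inv f k : 0 < k -> (forall c s, circ c s -> k <= Rabs (f c s)) ->
  bdd (fun c s => / f c s).
Proof.
intros Hk H; exists (/ k); intros c s Hc. rewrite Rabs_inv.
apply Rinv_le_contravar; auto.
Qed.

Lemma bdd_div f g k : bdd f -> 0 < k -> (forall c s, circ c s -> k <= g c s) ->
  bdd (fun c s => f c s / g c s).
Proof.
intros Hf Hk H. apply bdd_mult; [exact Hf|]. apply (bdd_inv g k Hk).
intros c s Hc; eapply Rle_trans; [apply (H c s Hc)|apply Rle_abs].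
Qed.

Lemma bdd_ext f g : (forall c s, circ c s -> f c s = g c s) -> bdd f -> bdd g.
Proof. intros E [B HB]; exists B; intros c s H; rewrite <- E; auto. Qed.

Create HintDb bdd.
#[export] Hint Resolve bdd_const bdd_c bdd_s bdd_plus bdd_opp bdd_minus bdd_mult bdd_abs bdd_pow : bdd.

Section Posfun.
Context {J : (R -> R -> R) -> R} (HJ : posfun J).

Lemma pf_ext f g : bdd f -> bdd g -> (forall c s, circ c s -> f c s = g c s) -> J f = J g.
Proof.
intros Hf Hg H; apply Rle_antisym; apply (pf_mono _ HJ); auto; intros; rewrite H; auto; lra.
Qed.

Lemma pf_opp f : bdd f -> J (fun c s => - f c s) = - J f.
Proof.
intros Hf. rewrite (pf_ext _ (fun c s => (-1) * f c s)); auto with bdd.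
- rewrite (pf_scal _ HJ); auto; ring.
- intros; ring.
Qed.

Lemma pf_minus f g : bdd f -> bdd g -> J (fun c s => f c s - g c s) = J f - J g.
Proof.
intros Hf Hg. unfold Rminus. rewrite (pf_add _ HJ); auto with bdd. rewrite pf_opp; auto.
Qed.

Lemma pf_const a : J (fun _ _ => a) = a * J (fun _ _ => 1).
Proof.
rewrite <- (pf_scal _ HJ); auto with bdd.
apply pf_ext; auto with bdd. intros; ring.
Qed.

Lemma pf_0 : J (fun _ _ => 0) = 0.
Proof. rewrite pf_const; ring. Qed.

Lemma pf_pos f : bdd f -> (forall c s, circ c s -> 0 <= f c s) -> 0 <= J f.
Proof. intros Hf H. rewrite <- pf_0. apply (pf_mono _ HJ); auto with bdd. Qed.

Lemma pf_1 : 0 <= J (fun _ _ => 1).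
Proof. apply pf_pos; auto with bdd. intros; lra. Qed.

Lemma pf_abs_le f g : bdd f -> bdd g -> (forall c s, circ c s -> Rabs (f c s) <= g c s) ->
  Rabs (J f) <= J g.
Proof.
intros Hf Hg H. apply Rabs_le; split.
- rewrite <- pf_opp; auto. apply (pf_mono _ HJ); auto with bdd.
  intros c s Hc; specialize (H c s Hc); apply Rabs_le_between in H; lra.
- apply (pf_mono _ HJ); auto.
  intros c s Hc; specialize (H c s Hc); apply Rabs_le_between in H; lra.
Qed.

Lemma pf_bound f B : bdd f -> (forall c s, circ c s -> Rabs (f c s) <= B) ->
  Rabs (J f) <= B * J (fun _ _ => 1).
Proof. intros Hf H. rewrite <- pf_const. apply pf_abs_le; auto with bdd. Qed.

Lemma pf_le_const f B : bdd f -> (forall c s, circ c s -> f c s <= B) ->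
  J f <= B * J (fun _ _ => 1).
Proof. intros Hf H. rewrite <- pf_const. apply (pf_mono _ HJ); auto with bdd. Qed.

Lemma pf_weight w : bdd w -> (forall c s, circ c s -> 0 <= w c s) ->
  posfun (fun f => J (fun c s => w c s * f c s)).
Proof.
intros Hw Hp; constructor.
- intros f g Hf Hg. rewrite <- (pf_add _ HJ); auto with bdd.
  apply pf_ext; auto 6 with bdd. intros; ring.
- intros a f Hf. rewrite <- (pf_scal _ HJ); auto with bdd.
  apply pf_ext; auto 6 with bdd. intros; ring.
- intros f g Hf Hg H. apply (pf_mono _ HJ); auto with bdd.
  intros c s Hc; apply Rmult_le_compat_l; auto.
Qed.

Lemma pf_comp (p q : R -> R -> R) : (forall c s, circ c s -> circ (p c s) (q c s)) ->
  posfun (fun f => J (fun c s => f (p c s) (q c s))).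
Proof.
intros H.
assert (B : forall f, bdd f -> bdd (fun c s => f (p c s) (q c s))).
{ intros f [B HB]; exists B; auto. }
constructor; intros.
- apply (pf_add _ HJ (fun c s => f (p c s) (q c s)) (fun c s => g (p c s) (q c s))); auto.
- apply (pf_scal _ HJ a (fun c s => f (p c s) (q c s))); auto.
- apply (pf_mono _ HJ); auto.
Qed.

End Posfun.

(** Weak compactness of functionals of bounded mass: the mass bound makes [Jinv t f] bounded along
    [U], so the limit is genuine and inherits linearity and monotonicity. *)
Lemma ulim_posfun {T} (U : (T -> Prop) -> Prop) (Jinv : T -> (R -> R -> R) -> R) M :
  ultrafilter U -> U (fun t => posfun (Jinv t) /\ Jinv t (fun _ _ => 1) <= M) ->
  posfun (fun f => ulim U (fun t => Jinv t f)) /\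
  forall f, bdd f -> forall eps, 0 < eps ->
    U (fun t => Rabs (Jinv t f - ulim U (fun t => Jinv t f)) < eps).
Proof.
intros HU HP.
assert (HS : forall f, bdd f -> forall eps, 0 < eps ->
    U (fun t => Rabs (Jinv t f - ulim U (fun t => Jinv t f)) < eps)).
{ intros f [B HB] eps He. apply (ulim_spec U _ (Rmax B 0 * Rmax M 0) HU); auto.
  generalize HP; apply (uf_imp _ HU). intros t [P1 P2].
  eapply Rle_trans; [apply (pf_bound P1 f (Rmax B 0))|].
  - now exists B.
  - intros c s Hc; eapply Rle_trans; [apply HB; auto|apply Rmax_l].
  - apply Rmult_le_compat_l; [apply Rmax_r|]. eapply Rle_trans; [apply P2|apply Rmax_l]. }
split; [|exact HS].
constructor.
- intros f g Hf Hg. apply ulim_unique; auto. intros eps He.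
  generalize (uf_and _ HU _ _ HP (uf_and _ HU _ _ (HS f Hf (eps/2) ltac:(lra)) (HS g Hg (eps/2) ltac:(lra)))).
  apply (uf_imp _ HU). intros t [[P1 _] [A B]].
  rewrite (pf_add _ P1); auto.
  match goal with |- Rabs (?a + ?b - (?c + ?d)) < _ =>
    replace (a + b - (c + d)) with ((a - c) + (b - d)) by ring end.
  eapply Rle_lt_trans; [apply Rabs_triang|]. lra.
- intros a f Hf. apply ulim_unique; auto. intros eps He.
  assert (Ha : 0 < Rabs a + 1) by (pose proof (Rabs_pos a); lra).
  generalize (uf_and _ HU _ _ HP (HS f Hf (eps/(Rabs a + 1)) ltac:(apply Rdiv_lt_0_compat; lra))).
  apply (uf_imp _ HU). intros t [[P1 _] A].
  rewrite (pf_scal _ P1); auto. rewrite <- Rmult_minus_distr_l, Rabs_mult.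
  apply (Rmult_lt_compat_r (Rabs a + 1)) in A; [|lra].
  unfold Rdiv in A; rewrite Rmult_assoc, Rinv_l, Rmult_1_r in A by lra.
  eapply Rle_lt_trans; [|apply A].
  pose proof (Rabs_pos (Jinv t f - ulim U (fun t0 : T => Jinv t0 f))). nra.
- intros f g Hf Hg H. apply Rnot_lt_le; intros Hlt.
  set (lf := ulim U (fun t => Jinv t f)) in *. set (lg := ulim U (fun t => Jinv t g)) in *.
  destruct (uf_ex U _ HU (uf_and _ HU _ _ HP (uf_and _ HU _ _
    (HS f Hf ((lf-lg)/2) ltac:(lra)) (HS g Hg ((lf-lg)/2) ltac:(lra))))) as [t [[P1 _] [A B]]].
  fold lf in A; fold lg in B. pose proof (pf_mono _ P1 f g Hf Hg H).
  apply Rabs_def2 in A; apply Rabs_def2 in B. lra.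
Qed.

(** * Complex differentiability and Cauchy's theorem in a disc *)

Lemma C_ext (z w : C) : Re z = Re w -> Im z = Im w -> z = w.
Proof. destruct z, w; simpl; intros -> ->; reflexivity. Qed.

Lemma Re_plus (z w : C) : Re (z + w)%C = Re z + Re w. Proof. reflexivity. Qed.
Lemma Im_plus (z w : C) : Im (z + w)%C = Im z + Im w. Proof. reflexivity. Qed.
Lemma Re_mult (z w : C) : Re (z * w)%C = Re z * Re w - Im z * Im w. Proof. reflexivity. Qed.
Lemma Re_minus (z w : C) : Re (z - w)%C = Re z - Re w. Proof. reflexivity. Qed.
Lemma Im_minus (z w : C) : Im (z - w)%C = Im z - Im w. Proof. reflexivity. Qed.

Lemma im_le_Cmod (z : C) : Rabs (Im z) <= Cmod z.
Proof. eapply Rle_trans; [apply Rmax_r|apply (Rmax_Cmod z)]. Qed.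

Lemma Cmod_le_Re_Im (z : C) : Cmod z <= Rabs (Re z) + Rabs (Im z).
Proof.
pose proof (Rabs_pos (Re z)); pose proof (Rabs_pos (Im z)).
apply Rsqr_incr_0_var; [|lra]. unfold Rsqr.
pose proof (Cmod2_alt z) as E. simpl in E. rewrite !Rmult_1_r in E. rewrite E.
assert (A : Re z * Re z = Rabs (Re z) * Rabs (Re z)) by (rewrite Rabs_sq; ring).
assert (B : Im z * Im z = Rabs (Im z) * Rabs (Im z)) by (rewrite Rabs_sq; ring).
nra.
Qed.

Lemma Cmod_minus_sym (z w : C) : Cmod (z - w) = Cmod (w - z).
Proof. rewrite <- Cmod_opp. f_equal; ring. Qed.

Lemma Cmod_minus_le (z w : C) : Cmod (z - w) <= Cmod z + Cmod w.
Proof. unfold Cminus. rewrite <- (Cmod_opp w). apply Cmod_triangle. Qed.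

Lemma Cmod_split (u z w : C) : Cmod (u - w) <= Cmod (u - z) + Cmod (z - w).
Proof. replace (u - w)%C with ((u - z) + (z - w))%C by ring. apply Cmod_triangle. Qed.

Lemma Cmod_le_minus (z w : C) : Cmod z <= Cmod w + Cmod (z - w).
Proof. replace z with (w + (z - w))%C at 1 by ring. apply Cmod_triangle. Qed.

Lemma Cmod_ge_minus (z w : C) : Cmod w - Cmod (z - w) <= Cmod z.
Proof. pose proof (Cmod_le_minus w z). rewrite Cmod_minus_sym in H. lra. Qed.

Definition Cc (f : C -> C) (z : C) : Prop :=
  forall eps, 0 < eps -> exists d, 0 < d /\ forall w, Cmod (w - z) < d -> Cmod (f w - f z) < eps.

Lemma Cc_const k z : Cc (fun _ => k) z.
Proof.
intros e He; exists 1; split; [lra|]; intros w _.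
replace (k - k)%C with (RtoC 0) by ring. rewrite Cmod_0; lra.
Qed.

Lemma Cc_id z : Cc (fun w => w) z.
Proof. intros e He; exists e; split; auto. Qed.

Lemma Cc_plus f g z : Cc f z -> Cc g z -> Cc (fun w => f w + g w)%C z.
Proof.
intros Hf Hg e He.
destruct (Hf (e/2) ltac:(lra)) as [d1 [H1 K1]].
destruct (Hg (e/2) ltac:(lra)) as [d2 [H2 K2]].
exists (Rmin d1 d2); split; [now apply Rmin_pos|].
intros w Hw. pose proof (Rmin_l d1 d2); pose proof (Rmin_r d1 d2).
replace (f w + g w - (f z + g z))%C with ((f w - f z) + (g w - g z))%C by ring.
eapply Rle_lt_trans; [apply Cmod_triangle|].
specialize (K1 w ltac:(lra)); specialize (K2 w ltac:(lra)); lra.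
Qed.

Lemma Cc_mult f g z : Cc f z -> Cc g z -> Cc (fun w => f w * g w)%C z.
Proof.
intros Hf Hg e He.
set (M := Cmod (f z) + Cmod (g z) + 1).
assert (HM : 1 <= M) by (unfold M; pose proof (Cmod_ge_0 (f z)); pose proof (Cmod_ge_0 (g z)); lra).
set (e' := Rmin 1 (e / (2 * M))).
assert (He' : 0 < e') by (apply Rmin_pos; [lra|apply Rdiv_lt_0_compat; lra]).
destruct (Hf e' He') as [d1 [H1 K1]].
destruct (Hg e' He') as [d2 [H2 K2]].
exists (Rmin d1 d2); split; [now apply Rmin_pos|].
intros w Hw. pose proof (Rmin_l d1 d2); pose proof (Rmin_r d1 d2).
specialize (K1 w ltac:(lra)); specialize (K2 w ltac:(lra)).
replace (f w * g w - f z * g z)%C with ((f w - f z) * g w + f z * (g w - g z))%C by ring.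
eapply Rle_lt_trans; [apply Cmod_triangle|]. rewrite !Cmod_mult.
assert (Cmod (g w) <= M).
{ pose proof (Cmod_le_minus (g w) (g z)). assert (e' <= 1) by apply Rmin_l.
  unfold M. pose proof (Cmod_ge_0 (f z)). lra. }
assert (E : e' * (2 * M) <= e).
{ assert (e' <= e / (2 * M)) by apply Rmin_r.
  apply (Rmult_le_compat_r (2 * M)) in H4; [|lra]. unfold Rdiv in H4.
  rewrite Rmult_assoc, Rinv_l, Rmult_1_r in H4; lra. }
assert (Cmod (f z) <= M) by (unfold M; pose proof (Cmod_ge_0 (g z)); lra).
pose proof (Cmod_ge_0 (f w - f z)); pose proof (Cmod_ge_0 (g w - g z)).
pose proof (Cmod_ge_0 (f z)); pose proof (Cmod_ge_0 (g w)).
assert (Cmod (f w - f z) * Cmod (g w) <= Cmod (f w - f z) * M) by (apply Rmult_le_compat_l; lra).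
assert (Cmod (f z) * Cmod (g w - g z) <= M * Cmod (g w - g z)) by (apply Rmult_le_compat_r; lra).
pose proof (Rmult_lt_compat_l M _ _ ltac:(lra) K1).
pose proof (Rmult_lt_compat_l M _ _ ltac:(lra) K2). lra.
Qed.

Lemma Cc_comp f g z : Cc g z -> Cc f (g z) -> Cc (fun w => f (g w)) z.
Proof.
intros Hg Hf e He. destruct (Hf e He) as [d1 [H1 K1]].
destruct (Hg d1 H1) as [d2 [H2 K2]]. exists d2; split; auto.
Qed.

Lemma Cc_inv (z : C) : z <> 0 -> Cc (fun w => / w)%C z.
Proof.
intros Hz e He. assert (Hm : 0 < Cmod z) by now apply Cmod_gt_0.
exists (Rmin (Cmod z / 2) (e * (Cmod z * Cmod z) / 2)); split.
{ apply Rmin_pos; [lra|]. apply Rdiv_lt_0_compat; [|lra]. repeat apply Rmult_lt_0_compat; auto. }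
intros w Hw.
assert (Hw1 : Cmod (w - z) < Cmod z / 2) by (eapply Rlt_le_trans; [apply Hw|apply Rmin_l]).
assert (Hw2 : Cmod (w - z) < e * (Cmod z * Cmod z) / 2) by (eapply Rlt_le_trans; [apply Hw|apply Rmin_r]).
pose proof (Cmod_ge_minus w z) as Hge.
assert (Hw0 : w <> 0) by (apply Cmod_gt_0; lra).
replace (/ w - / z)%C with (- ((w - z) / (w * z)))%C by (field; auto).
rewrite Cmod_opp, Cmod_div, Cmod_mult by now apply Cmult_neq_0.
apply (Rmult_lt_reg_r (Cmod w * Cmod z)); [nra|].
unfold Rdiv. rewrite Rmult_assoc, Rinv_l, Rmult_1_r by (apply Rgt_not_eq; nra). pose proof (Cmod_ge_0 (w - z)); nra.
Qed.

Lemma Cc_ext_loc f g z d : 0 < d -> (forall w, Cmod (w - z) < d -> f w = g w) -> Cc f z -> Cc g z.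
Proof.
intros Hd E Hf e He. destruct (Hf e He) as [d' [H1 K]].
exists (Rmin d d'); split; [now apply Rmin_pos|]. intros w Hw.
rewrite <- E, <- E; [apply K| |].
- eapply Rlt_le_trans; [apply Hw|apply Rmin_r].
- replace (z - z)%C with (RtoC 0) by ring. now rewrite Cmod_0.
- eapply Rlt_le_trans; [apply Hw|apply Rmin_l].
Qed.

(* Caratheodory's form of the derivative: the difference quotient extends continuously. *)
Definition Cd (f : C -> C) (z l : C) : Prop :=
  exists phi d, Cc phi z /\ phi z = l /\ 0 < d /\
    forall w, Cmod (w - z) < d -> f w = (f z + (w - z) * phi w)%C.

Lemma Cd_cont f z l : Cd f z l -> Cc f z.
Proof.
intros [phi [d [Hp [_ [Hd E]]]]].
apply (Cc_ext_loc (fun w => f z + (w - z) * phi w)%C f z d Hd).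
- intros w Hw; symmetry; auto.
- apply Cc_plus; [apply Cc_const|]. apply Cc_mult; [|exact Hp].
  apply Cc_plus; [apply Cc_id|apply Cc_const].
Qed.

Lemma Cd_const k z : Cd (fun _ => k) z 0.
Proof.
exists (fun _ => RtoC 0), 1; repeat split; [apply Cc_const|lra|]. intros; ring.
Qed.

Lemma Cd_affine p q z : Cd (fun w => p + q * w)%C z q.
Proof.
exists (fun _ => q), 1; repeat split; [apply Cc_const|lra|]. intros; ring.
Qed.

Lemma Cd_mult f g z l m : Cd f z l -> Cd g z m -> Cd (fun w => f w * g w)%C z (l * g z + f z * m)%C.
Proof.
intros Hf Hg. pose proof (Cd_cont _ _ _ Hg) as Cg.
destruct Hf as [phi [d1 [H1 [E1 [D1 K1]]]]]. destruct Hg as [psi [d2 [H2 [E2 [D2 K2]]]]].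
exists (fun w => phi w * g w + f z * psi w)%C, (Rmin d1 d2); repeat split.
- apply Cc_plus; apply Cc_mult; auto using Cc_const.
- now rewrite E1, E2.
- now apply Rmin_pos.
- intros w Hw. rewrite (K1 w) by (eapply Rlt_le_trans; [apply Hw|apply Rmin_l]).
  rewrite (K2 w) by (eapply Rlt_le_trans; [apply Hw|apply Rmin_r]). ring.
Qed.

Lemma Cd_comp f g z l m : Cd f (g z) l -> Cd g z m -> Cd (fun w => f (g w)) z (m * l)%C.
Proof.
intros Hf Hg. pose proof (Cd_cont _ _ _ Hg) as Cg.
destruct Hf as [phi [d1 [H1 [E1 [D1 K1]]]]]. destruct Hg as [psi [d2 [H2 [E2 [D2 K2]]]]].
destruct (Cg d1 D1) as [d3 [D3 K3]].
exists (fun w => psi w * phi (g w))%C, (Rmin d2 d3); repeat split.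
- apply Cc_mult; [exact H2|apply Cc_comp; auto].
- now rewrite E1, E2.
- now apply Rmin_pos.
- intros w Hw.
  assert (Hw2 : Cmod (w - z) < d2) by (eapply Rlt_le_trans; [apply Hw|apply Rmin_l]).
  rewrite K1 by (apply K3; eapply Rlt_le_trans; [apply Hw|apply Rmin_r]).
  replace (g w - g z)%C with ((w - z) * psi w)%C by (rewrite (K2 w Hw2); ring). ring.
Qed.

Lemma Cd_inv (z : C) : z <> 0 -> Cd (fun w => / w)%C z (- / (z * z))%C.
Proof.
intros Hz. assert (Hm : 0 < Cmod z) by now apply Cmod_gt_0.
exists (fun w => - (/ z * / w))%C, (Cmod z / 2); repeat split; [|field; auto|lra|].
- apply (Cc_ext_loc (fun w => (- / z) * / w)%C _ z 1 Rlt_0_1); [intros; ring|].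
  apply Cc_mult; [apply Cc_const|now apply Cc_inv].
- intros w Hw. pose proof (Cmod_ge_minus w z).
  assert (w <> 0) by (apply Cmod_gt_0; lra). field; auto.
Qed.

Lemma Cd_eps f z l : Cd f z l -> forall eps, 0 < eps -> exists d, 0 < d /\
  forall w, Cmod (w - z) < d -> Cmod (f w - f z - l * (w - z)) <= eps * Cmod (w - z).
Proof.
intros [phi [d [H1 [H2 [H3 H4]]]]] e He. destruct (H1 e He) as [d' [H5 H6]].
exists (Rmin d d'); split; [now apply Rmin_pos|]. intros w Hw.
rewrite (H4 w) by (eapply Rlt_le_trans; [apply Hw|apply Rmin_l]).
replace (f z + (w - z) * phi w - f z - l * (w - z))%C with ((phi w - phi z) * (w - z))%C
  by (rewrite H2; ring).
rewrite Cmod_mult. apply Rmult_le_compat_r; [apply Cmod_ge_0|].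
apply Rlt_le, H6. eapply Rlt_le_trans; [apply Hw|apply Rmin_r].
Qed.

Lemma eps_Cd f z l : (forall eps, 0 < eps -> exists d, 0 < d /\
  forall w, Cmod (w - z) < d -> Cmod (f w - f z - l * (w - z)) <= eps * Cmod (w - z)) -> Cd f z l.
Proof.
intros H.
exists (fun w => if Req_dec_T (Cmod (w - z)) 0 then l else ((f w - f z) / (w - z))%C), 1.
assert (Z0 : Cmod (z - z) = 0) by (replace (z - z)%C with (RtoC 0) by ring; apply Cmod_0).
repeat split; [| |lra|].
- intros e He. destruct (H (e/2) ltac:(lra)) as [d [Hd K]]. exists d; split; auto.
  intros w Hw. destruct (Req_dec_T (Cmod (z - z)) 0) as [_|N]; [|lra].
  destruct (Req_dec_T (Cmod (w - z)) 0) as [E|N].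
  + replace (l - l)%C with (RtoC 0) by ring. rewrite Cmod_0; lra.
  + pose proof (Cmod_ge_0 (w - z)). assert (W : (w - z)%C <> 0) by (apply Cmod_gt_0; lra).
    replace ((f w - f z) / (w - z) - l)%C with ((f w - f z - l * (w - z)) / (w - z))%C
      by (field; auto).
    rewrite Cmod_div by auto. specialize (K w Hw).
    apply (Rmult_lt_reg_r (Cmod (w - z))); [lra|].
    unfold Rdiv; rewrite Rmult_assoc, Rinv_l, Rmult_1_r by lra. nra.
- destruct (Req_dec_T (Cmod (z - z)) 0); [reflexivity|lra].
- intros w _. destruct (Req_dec_T (Cmod (w - z)) 0) as [E|N].
  + apply Cmod_eq_0 in E. assert (w = z) by (apply Ceq_minus; exact E). subst; ring.
  + assert (W : (w - z)%C <> 0) by (apply Cmod_gt_0; pose proof (Cmod_ge_0 (w - z)); lra).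
    field; auto.
Qed.

Lemma ex_derive_Cd (f : C -> C) z :
  ex_derive (K := C_AbsRing) (V := C_NormedModule) f z -> exists l, Cd f z l.
Proof.
intros [l [_ Hl]]. exists l. apply eps_Cd. intros e He.
assert (LF : is_filter_lim (locally (T := AbsRing_UniformSpace C_AbsRing) z) z) by (intros P HP; exact HP).
specialize (Hl z LF (mkposreal e He)). destruct Hl as [d Hd].
exists d; split; [apply cond_pos|]. intros w Hw.
specialize (Hd w). simpl in Hd.
assert (B : ball (M := AbsRing_UniformSpace C_AbsRing) z d w) by exact Hw.
specialize (Hd B).
replace (f w - f z - l * (w - z))%C with
  (minus (minus (f w) (f z)) (scal (minus w z) l) : C)
  by (unfold minus, plus, opp, scal; simpl; unfold mult; simpl; ring).
exact Hd.
Qed.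

(** * Complex integrals over intervals and along segments *)

Definition is_CI (g : R -> C) (a b : R) (v : C) : Prop :=
  is_RInt (fun t => Re (g t)) a b (Re v) /\ is_RInt (fun t => Im (g t)) a b (Im v).

Definition CI (g : R -> C) (a b : R) : C :=
  (RInt (fun t => Re (g t)) a b, RInt (fun t => Im (g t)) a b).

Definition pcont (g : R -> C) (t : R) : Prop :=
  continuous (fun t => Re (g t)) t /\ continuous (fun t => Im (g t)) t.

Lemma CI_correct g a b : (forall t, Rmin a b <= t <= Rmax a b -> pcont g t) -> is_CI g a b (CI g a b).
Proof.
intros H; split; apply (RInt_correct (V := R_CompleteNormedModule));
  apply (ex_RInt_continuous (V := R_CompleteNormedModule)); intros t Ht; apply H; auto.
Qed.

Lemma is_CI_unique g a b v : is_CI g a b v -> CI g a b = v.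
Proof.
intros [H1 H2]. apply C_ext; simpl; apply is_RInt_unique; assumption.
Qed.

Lemma is_CI_ext g h a b v : (forall t, Rmin a b <= t <= Rmax a b -> g t = h t) ->
  is_CI g a b v -> is_CI h a b v.
Proof.
intros E [H1 H2]; split; (eapply is_RInt_ext; [|eassumption]); intros t Ht; simpl;
  rewrite E; auto; lra.
Qed.

Lemma is_CI_plus g h a b v w : is_CI g a b v -> is_CI h a b w ->
  is_CI (fun t => g t + h t)%C a b (v + w)%C.
Proof. intros [H1 H2] [K1 K2]; split; apply (is_RInt_plus (V := R_NormedModule)); auto. Qed.

Lemma is_CI_scal k g a b v : is_CI g a b v -> is_CI (fun t => k * g t)%C a b (k * v)%C.
Proof.
intros [H1 H2]; split.
- apply (is_RInt_minus (V := R_NormedModule)); apply (is_RInt_scal (V := R_NormedModule)); auto.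
- apply (is_RInt_plus (V := R_NormedModule)); apply (is_RInt_scal (V := R_NormedModule)); auto.
Qed.

Lemma is_CI_minus g h a b v w : is_CI g a b v -> is_CI h a b w ->
  is_CI (fun t => g t - h t)%C a b (v - w)%C.
Proof. intros [H1 H2] [K1 K2]; split; apply (is_RInt_minus (V := R_NormedModule)); auto. Qed.

Lemma is_CI_conj g a b v : is_CI g a b v -> is_CI (fun t => Cconj (g t)) a b (Cconj v).
Proof. intros [H1 H2]; split; [exact H1|]. apply (is_RInt_opp (V := R_NormedModule)), H2. Qed.

Lemma is_CI_Chasles g a b c v w : is_CI g a b v -> is_CI g b c w -> is_CI g a c (v + w)%C.
Proof. intros [H1 H2] [K1 K2]; split; eapply (is_RInt_Chasles (V := R_NormedModule)); eauto. Qed.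

Lemma is_CI_swap g a b v : is_CI g a b v -> is_CI g b a (- v)%C.
Proof. intros [H1 H2]; split; apply (is_RInt_swap (V := R_NormedModule)); auto. Qed.

Lemma is_CI_comp_lin g u w a b v : is_CI g (u * a + w) (u * b + w) v ->
  is_CI (fun t => RtoC u * g (u * t + w)%R)%C a b v.
Proof.
intros [H1 H2]; split.
- eapply is_RInt_ext; [|apply (is_RInt_comp_lin (V := R_NormedModule)), H1].
  intros t _. rewrite re_scal_l. reflexivity.
- eapply is_RInt_ext; [|apply (is_RInt_comp_lin (V := R_NormedModule)), H2].
  intros t _. rewrite im_scal_l. reflexivity.
Qed.

(** The factor 2 is the price of estimating the real and imaginary parts separately; only the order
    of magnitude matters later. *)
Lemma is_CI_bound g a b v M : a <= b -> is_CI g a b v ->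
  (forall t, a <= t <= b -> Cmod (g t) <= M) -> Cmod v <= 2 * (M * (b - a)).
Proof.
intros Hab [H1 H2] HM. eapply Rle_trans; [apply Cmod_le_Re_Im|].
assert (A : Rabs (Re v) <= (b - a) * M).
{ apply (norm_RInt_le_const (V := R_NormedModule) (fun t => Re (g t)) a b); auto.
  intros t Ht. eapply Rle_trans; [apply re_le_Cmod|auto]. }
assert (B : Rabs (Im v) <= (b - a) * M).
{ apply (norm_RInt_le_const (V := R_NormedModule) (fun t => Im (g t)) a b); auto.
  intros t Ht. eapply Rle_trans; [apply im_le_Cmod|auto]. }
lra.
Qed.

Definition spt (a b : C) (t : R) : C := (a + RtoC t * (b - a))%C.

Definition seg (f : C -> C) (a b : C) : C := ((b - a) * CI (fun t => f (spt a b t)) 0 1)%C.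

Lemma spt_lip a b t u : Cmod (spt a b t - spt a b u) = Rabs (t - u) * Cmod (b - a).
Proof.
unfold spt. replace (a + RtoC t * (b - a) - (a + RtoC u * (b - a)))%C with (RtoC (t - u) * (b - a))%C
  by (rewrite RtoC_minus; ring).
now rewrite Cmod_mult, Cmod_R.
Qed.

Lemma spt_disc a b t r : 0 <= t <= 1 -> Cmod a <= r -> Cmod b <= r -> Cmod (spt a b t) <= r.
Proof.
intros Ht Ha Hb. unfold spt.
replace (a + RtoC t * (b - a))%C with (RtoC (1 - t) * a + RtoC t * b)%C by (rewrite RtoC_minus; ring).
eapply Rle_trans; [apply Cmod_triangle|]. rewrite !Cmod_mult, !Cmod_R, !Rabs_pos_eq by lra. nra.
Qed.

Lemma Cc_pcont f (g : R -> C) t : pcont g t -> Cc f (g t) -> pcont (fun u => f (g u)) t.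
Proof.
intros [H1 H2] Hf.
assert (K : forall eps, 0 < eps -> locally t (fun u => Cmod (f (g u) - f (g t)) < eps)).
{ intros e He. destruct (Hf e He) as [d [Hd K]].
  assert (Hd2 : 0 < d / 2) by lra.
  pose proof (proj1 (filterlim_locally _ _) H1 (mkposreal _ Hd2)) as L1.
  pose proof (proj1 (filterlim_locally _ _) H2 (mkposreal _ Hd2)) as L2.
  generalize (filter_and _ _ L1 L2). apply filter_imp. intros u [A B].
  apply K. eapply Rle_lt_trans; [apply Cmod_le_Re_Im|].
  change (Rabs (Re (g u) - Re (g t)) < d / 2) in A. change (Rabs (Im (g u) - Im (g t)) < d / 2) in B.
  rewrite Re_minus, Im_minus. lra. }
split; apply (proj2 (filterlim_locally _ _)); intros e;
  generalize (K e (cond_pos e)); apply filter_imp; intros u Hu.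
- change (Rabs (Re (f (g u)) - Re (f (g t))) < e). rewrite <- Re_minus.
  eapply Rle_lt_trans; [apply re_le_Cmod|exact Hu].
- change (Rabs (Im (f (g u)) - Im (f (g t))) < e). rewrite <- Im_minus.
  eapply Rle_lt_trans; [apply im_le_Cmod|exact Hu].
Qed.

Lemma pcont_const k t : pcont (fun _ => k) t.
Proof. split; apply continuous_const. Qed.

Lemma pcont_RtoC f t : continuous f t -> pcont (fun u => RtoC (f u)) t.
Proof. intros H; split; [exact H|apply continuous_const]. Qed.

Lemma pcont_plus f g t : pcont f t -> pcont g t -> pcont (fun u => f u + g u)%C t.
Proof. intros [A B] [A' B']; split; apply (continuous_plus (V := R_NormedModule)); auto. Qed.

Lemma pcont_mult f g t : pcont f t -> pcont g t -> pcont (fun u => f u * g u)%C t.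
Proof.
intros [A B] [A' B']; split.
- apply (continuous_minus (V := R_NormedModule)); apply (continuous_mult (K := R_AbsRing)); auto.
- apply (continuous_plus (V := R_NormedModule)); apply (continuous_mult (K := R_AbsRing)); auto.
Qed.

Lemma pcont_spt a b t : pcont (spt a b) t.
Proof.
unfold spt. apply pcont_plus; [apply pcont_const|]. apply pcont_mult; [|apply pcont_const].
apply pcont_RtoC, continuous_id.
Qed.

Definition dcont (R : R) (f : C -> C) : Prop := forall w, Cmod w < R -> Cc f w.

Lemma seg_is f a b R : dcont R f -> Cmod a < R -> Cmod b < R ->
  is_CI (fun t => f (spt a b t)) 0 1 (CI (fun t => f (spt a b t)) 0 1).
Proof.
intros Hf Ha Hb. apply CI_correct. intros t Ht. rewrite Rmin_left, Rmax_right in Ht by lra.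
apply Cc_pcont; [apply pcont_spt|]. apply Hf.
eapply Rle_lt_trans; [apply (spt_disc a b t (Rmax (Cmod a) (Cmod b)) Ht (Rmax_l _ _) (Rmax_r _ _))|].
now apply Rmax_lub_lt.
Qed.

Lemma seg_diff f g a b R M : dcont R f -> dcont R g -> Cmod a < R -> Cmod b < R ->
  (forall t, 0 <= t <= 1 -> Cmod (f (spt a b t) - g (spt a b t)) <= M) ->
  Cmod (seg f a b - seg g a b) <= 2 * M * Cmod (b - a).
Proof.
intros Hf Hg Ha Hb HM. unfold seg.
replace ((b - a) * CI (fun t => f (spt a b t)) 0 1 - (b - a) * CI (fun t => g (spt a b t)) 0 1)%C
  with ((b - a) * (CI (fun t => f (spt a b t)) 0 1 - CI (fun t => g (spt a b t)) 0 1))%C by ring.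
rewrite Cmod_mult.
assert (B : Cmod (CI (fun t => f (spt a b t)) 0 1 - CI (fun t => g (spt a b t)) 0 1) <= 2 * (M * (1 - 0))).
{ apply (is_CI_bound (fun t => f (spt a b t) - g (spt a b t))%C 0 1); [lra| |exact HM].
  apply is_CI_minus; eapply seg_is; eauto. }
pose proof (Cmod_ge_0 (b - a)). nra.
Qed.

Lemma seg_mid f a b R : dcont R f -> Cmod a < R -> Cmod b < R ->
  seg f a b = (seg f a ((a + b) / 2) + seg f ((a + b) / 2) b)%C.
Proof.
intros Hf Ha Hb.
set (g := fun t => f (spt a b t)).
assert (Hc : forall t, 0 <= t <= 1 -> pcont g t).
{ intros t Ht. apply Cc_pcont; [apply pcont_spt|]. apply Hf.
  eapply Rle_lt_trans; [apply (spt_disc a b t (Rmax (Cmod a) (Cmod b)) Ht (Rmax_l _ _) (Rmax_r _ _))|].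
  now apply Rmax_lub_lt. }
assert (H1 : is_CI g 0 (1/2) (CI g 0 (1/2))).
{ apply CI_correct. intros t Ht; apply Hc. rewrite Rmin_left, Rmax_right in Ht by lra. lra. }
assert (H2 : is_CI g (1/2) 1 (CI g (1/2) 1)).
{ apply CI_correct. intros t Ht; apply Hc. rewrite Rmin_left, Rmax_right in Ht by lra. lra. }
assert (E : CI g 0 1 = (CI g 0 (1/2) + CI g (1/2) 1)%C) by (apply is_CI_unique; eapply is_CI_Chasles; eauto).
assert (K1 : is_CI (fun t => f (spt a ((a+b)/2) t)) 0 1 (2 * CI g 0 (1/2))%C).
{ apply (is_CI_ext (fun t => 2 * (RtoC (1/2) * g (1/2 * t + 0)%R))%C).
  - intros t _. unfold g. replace (spt a b (1/2 * t + 0)) with (spt a ((a + b) / 2) t).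
    + rewrite RtoC_div by lra. field.
    + unfold spt. rewrite RtoC_plus, RtoC_mult, RtoC_div by lra. field.
  - apply is_CI_scal, is_CI_comp_lin. replace (1/2*0+0) with 0 by ring. replace (1/2*1+0) with (1/2) by ring. exact H1. }
assert (K2 : is_CI (fun t => f (spt ((a+b)/2) b t)) 0 1 (2 * CI g (1/2) 1)%C).
{ apply (is_CI_ext (fun t => 2 * (RtoC (1/2) * g (1/2 * t + 1/2)%R))%C).
  - intros t _. unfold g. replace (spt a b (1/2 * t + 1/2)) with (spt ((a + b) / 2) b t).
    + rewrite RtoC_div by lra. field.
    + unfold spt. rewrite RtoC_plus, RtoC_mult, RtoC_div by lra. field.
  - apply is_CI_scal, is_CI_comp_lin. replace (1/2*0+1/2) with (1/2) by ring. replace (1/2*1+1/2) with 1 by lra. exact H2. }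
unfold seg. rewrite (is_CI_unique _ _ _ _ K1), (is_CI_unique _ _ _ _ K2). fold g. rewrite E. field.
Qed.

Lemma seg_rev f a b R : dcont R f -> Cmod a < R -> Cmod b < R -> seg f b a = (- seg f a b)%C.
Proof.
intros Hf Ha Hb. pose proof (seg_is f a b R Hf Ha Hb) as H.
assert (K : is_CI (fun t => f (spt b a t)) 0 1 (CI (fun t => f (spt a b t)) 0 1)).
{ apply (is_CI_ext (fun t => (-1) * (RtoC (-1) * f (spt a b (-1 * t + 1)%R)))%C).
  - intros t _. replace (spt a b (-1 * t + 1)) with (spt b a t).
    + ring.
    + unfold spt. rewrite RtoC_plus, RtoC_mult. ring.
  - replace (CI (fun t => f (spt a b t)) 0 1) with ((-1) * (- CI (fun t => f (spt a b t)) 0 1))%C by ring.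
    apply is_CI_scal, (is_CI_comp_lin (fun t => f (spt a b t))). replace (-1*0+1) with 1 by ring. replace (-1*1+1) with 0 by ring.
    now apply is_CI_swap. }
unfold seg. rewrite (is_CI_unique _ _ _ _ K). ring.
Qed.

Lemma is_CI_const k a b : is_CI (fun _ => k) a b (RtoC (b - a) * k)%C.
Proof.
split; simpl.
- replace ((b - a) * fst k - 0 * snd k) with (scal (b - a) (fst k)) by (unfold scal; simpl; unfold mult; simpl; ring).
  apply (is_RInt_const (V := R_NormedModule)).
- replace ((b - a) * snd k + 0 * fst k) with (scal (b - a) (snd k)) by (unfold scal; simpl; unfold mult; simpl; ring).
  apply (is_RInt_const (V := R_NormedModule)).
Qed.

Lemma seg_affine p q a b : seg (fun w => p + q * w)%C a b = ((b - a) * (p + q * ((a + b) / 2)))%C.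
Proof.
unfold seg. f_equal. apply is_CI_unique.
apply (is_CI_ext (fun t => (p + q * a) + (q * (b - a)) * RtoC t)%C).
{ intros t _. unfold spt. ring. }
replace (p + q * ((a + b) / 2))%C with (RtoC (1 - 0) * (p + q * a) + (q * (b - a)) * RtoC (1 / 2))%C
  by (rewrite RtoC_minus, RtoC_div by lra; field).
apply is_CI_plus; [apply is_CI_const|]. apply is_CI_scal. split; simpl.
- evar_last; [apply (is_RInt_derive (V := R_CompleteNormedModule) (fun x => x * x / 2) (fun x => x))|].
  + intros x _. auto_derive; auto; field.
  + intros x _. apply continuous_id.
  + unfold minus, plus, opp; simpl; field.
- evar_last; [apply (is_RInt_const (V := R_NormedModule))|]. unfold scal; simpl; unfold mult; simpl; ring.
Qed.

Lemma dcont_affine R p q : dcont R (fun w => p + q * w)%C.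
Proof. intros w _. exact (Cd_cont _ _ _ (Cd_affine p q w)). Qed.

Lemma geo_cauchy (u : nat -> R) K : (forall n, Rabs (u (S n) - u n) <= K / 2 ^ n) ->
  exists l, forall n, Rabs (u n - l) <= 2 * K / 2 ^ n.
Proof.
intros H.
assert (P2 : forall n, 0 < 2 ^ n) by (intros; apply pow_lt; lra).
(* The subtracted tail is what makes the induction on [m] close. *)
assert (D : forall n m, Rabs (u (n + m)%nat - u n) <= 2 * K / 2 ^ n - 2 * K / 2 ^ (n + m)).
{ intros n m; induction m.
  - rewrite Nat.add_0_r. replace (u n - u n) with 0 by ring. rewrite Rabs_R0. lra.
  - replace (n + S m)%nat with (S (n + m)) by lia.
    replace (u (S (n + m)) - u n) with ((u (S (n+m)) - u (n+m)%nat) + (u (n+m)%nat - u n)) by ring.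
    eapply Rle_trans; [apply Rabs_triang|]. specialize (H (n+m)%nat).
    replace (2 * K / 2 ^ S (n + m)) with (K / 2 ^ (n + m)) by (simpl; field; apply Rgt_not_eq, P2).
    replace (2 * K / 2 ^ (n + m)) with (K / 2 ^ (n + m) + K / 2 ^ (n + m)) in IHm by (field; apply Rgt_not_eq, P2). lra. }
assert (K0 : 0 <= K).
{ specialize (H 0%nat). simpl in H. pose proof (Rabs_pos (u 1%nat - u 0%nat)). lra. }
assert (D' : forall n m, Rabs (u (n + m)%nat - u n) <= 2 * K / 2 ^ n).
{ intros n m. specialize (D n m). assert (0 <= 2 * K / 2 ^ (n + m)); [|lra].
  apply Rdiv_le_0_compat; [lra|apply P2]. }
assert (EX : ex_finite_lim_seq u).
{ apply ex_lim_seq_cauchy_corr. intros e.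
  assert (HL : is_lim_seq (fun n => (2 * K) * (/2) ^ n) (2 * K * 0)).
  { apply (is_lim_seq_scal_l _ (2*K) 0). apply is_lim_seq_geom. rewrite Rabs_pos_eq; lra. }
  rewrite Rmult_0_r in HL.
  apply is_lim_seq_spec in HL. assert (e2 : 0 < e / 2) by (pose proof (cond_pos e); lra).
  destruct (HL (mkposreal _ e2)) as [N HN]. exists N. intros n m Hn Hm.
  assert (A : 2 * K / 2 ^ N < e / 2).
  { specialize (HN N (le_n _)). simpl in HN. rewrite Rminus_0_r in HN.
    rewrite pow_inv in HN. eapply Rle_lt_trans; [apply Rle_abs|exact HN]. }
  pose proof (D' N (n - N)%nat) as A1. pose proof (D' N (m - N)%nat) as A2.
  replace (N + (n - N))%nat with n in A1 by lia. replace (N + (m - N))%nat with m in A2 by lia.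
  replace (u n - u m) with ((u n - u N) - (u m - u N)) by ring.
  eapply Rle_lt_trans; [apply Rabs_triang|]. rewrite Rabs_Ropp. lra. }
destruct EX as [l Hl]. exists l. intros n.
assert (L : is_lim_seq (fun m => Rabs (u (m + n)%nat - u n)) (Rabs (l - u n))).
{ apply (is_lim_seq_abs _ (l - u n)). apply is_lim_seq_minus'; [|apply is_lim_seq_const].
  now apply is_lim_seq_incr_n. }
rewrite Rabs_minus_sym.
apply (is_lim_seq_le (fun m => Rabs (u (m + n)%nat - u n)) (fun _ => 2 * K / 2 ^ n) (Rabs (l - u n)) (2 * K / 2 ^ n)).
- intros m. rewrite Nat.add_comm. apply D'.
- exact L.
- apply is_lim_seq_const.
Qed.

Lemma Cgeo_cauchy (u : nat -> C) K : (forall n, Cmod (u (S n) - u n) <= K / 2 ^ n) ->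
  exists l, forall n, Cmod (u n - l) <= 4 * K / 2 ^ n.
Proof.
intros H.
destruct (geo_cauchy (fun n => Re (u n)) K) as [x Hx].
{ intros n. rewrite <- Re_minus. eapply Rle_trans; [apply re_le_Cmod|apply H]. }
destruct (geo_cauchy (fun n => Im (u n)) K) as [y Hy].
{ intros n. rewrite <- Im_minus. eapply Rle_trans; [apply im_le_Cmod|apply H]. }
exists (x, y). intros n. eapply Rle_trans; [apply Cmod_le_Re_Im|].
rewrite Re_minus, Im_minus. simpl. specialize (Hx n); specialize (Hy n).
replace (4 * K / 2 ^ n) with (2 * K / 2 ^ n + 2 * K / 2 ^ n) by (field; apply pow_nonzero; lra). lra.
Qed.

(** * Goursat's theorem by bisection, and primitives in a disc *)

Definition tri (f : C -> C) (T : C * C * C) : C :=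
  let '(a, b, c) := T in (seg f a b + seg f b c + seg f c a)%C.

Definition tsize (T : C * C * C) : R :=
  let '(a, b, c) := T in Cmod (b - a) + Cmod (c - b) + Cmod (a - c).

Definition tin (r : R) (T : C * C * C) : Prop :=
  let '(a, b, c) := T in Cmod a <= r /\ Cmod b <= r /\ Cmod c <= r.

(** The middle triangle [(u, v, w)] is the fallback: if each corner triangle carries less than a
    quarter of the integral, the middle one carries at least a quarter. *)
Definition tstep (f : C -> C) (T : C * C * C) : C * C * C :=
  let '(a, b, c) := T in
  let u := ((a + b) / 2)%C in let v := ((b + c) / 2)%C in let w := ((c + a) / 2)%C in
  let I := Cmod (tri f (a, b, c)) in
  if Rle_dec I (4 * Cmod (tri f (a, u, w))) then (a, u, w)
  else if Rle_dec I (4 * Cmod (tri f (u, b, v))) then (u, b, v)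
  else if Rle_dec I (4 * Cmod (tri f (w, v, c))) then (w, v, c)
  else (u, v, w).

Lemma Cmod_half z : Cmod (z / 2) = Cmod z / 2.
Proof.
rewrite Cmod_div; [|apply Cmod_gt_0; rewrite Cmod_R, Rabs_pos_eq; lra].
now rewrite Cmod_R, Rabs_pos_eq by lra.
Qed.

(** The inner edges are traversed once in each direction and cancel, so the four integrals add up to
    the whole one. The last conjunct makes the first vertices a geometric Cauchy sequence. *)
Lemma tstep_spec f R r T : dcont R f -> r < R -> tin r T ->
  tin r (tstep f T) /\ Cmod (tri f T) <= 4 * Cmod (tri f (tstep f T)) /\
  tsize (tstep f T) = tsize T / 2 /\ Cmod (fst (fst (tstep f T)) - fst (fst T)) <= tsize T.
Proof.
intros Hf Hr. destruct T as [[a b] c]. intros [Ha [Hb Hc]].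
set (u := ((a + b) / 2)%C). set (v := ((b + c) / 2)%C). set (w := ((c + a) / 2)%C).
assert (M : forall x y, Cmod x <= r -> Cmod y <= r -> Cmod ((x + y) / 2) <= r).
{ intros x y Hx Hy. rewrite Cmod_half. pose proof (Cmod_triangle x y). lra. }
assert (Hu : Cmod u <= r) by (apply M; auto). assert (Hv : Cmod v <= r) by (apply M; auto).
assert (Hw : Cmod w <= r) by (apply M; auto).
pose proof (Cmod_ge_0 (b - a)) as P1. pose proof (Cmod_ge_0 (c - b)) as P2. pose proof (Cmod_ge_0 (a - c)) as P3.
assert (E : tri f (a, b, c) = (tri f (a, u, w) + tri f (u, b, v) + tri f (w, v, c) + tri f (u, v, w))%C).
{ unfold tri. rewrite (seg_mid f a b R), (seg_mid f b c R), (seg_mid f c a R) by (auto; lra).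
  fold u v w. rewrite (seg_rev f u w R), (seg_rev f v u R), (seg_rev f w v R) by (auto; lra).
  rewrite (seg_rev f u v R) by (auto; lra). ring_simplify.
  ring. }
assert (B : Cmod (tri f (a, b, c)) <= Cmod (tri f (a, u, w)) + Cmod (tri f (u, b, v)) + Cmod (tri f (w, v, c)) + Cmod (tri f (u, v, w))).
{ rewrite E. eapply Rle_trans; [apply Cmod_triangle|]. apply Rplus_le_compat_r.
  eapply Rle_trans; [apply Cmod_triangle|]. apply Rplus_le_compat_r. apply Cmod_triangle. }
assert (S1 : Cmod (u - a) = Cmod (b - a) / 2) by (rewrite <- Cmod_half; f_equal; unfold u; field).
assert (S2 : Cmod (b - u) = Cmod (b - a) / 2) by (rewrite <- Cmod_half; f_equal; unfold u; field).
assert (S3 : Cmod (v - b) = Cmod (c - b) / 2) by (rewrite <- Cmod_half; f_equal; unfold v; field).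
assert (S4 : Cmod (c - v) = Cmod (c - b) / 2) by (rewrite <- Cmod_half; f_equal; unfold v; field).
assert (S5 : Cmod (w - c) = Cmod (a - c) / 2) by (rewrite <- Cmod_half; f_equal; unfold w; field).
assert (S6 : Cmod (a - w) = Cmod (a - c) / 2) by (rewrite <- Cmod_half; f_equal; unfold w; field).
assert (S7 : Cmod (w - u) = Cmod (c - b) / 2) by (rewrite <- Cmod_half; f_equal; unfold w, u; field).
assert (S8 : Cmod (v - u) = Cmod (a - c) / 2) by (rewrite Cmod_minus_sym, <- Cmod_half; f_equal; unfold v, u; field).
assert (S9 : Cmod (w - v) = Cmod (b - a) / 2) by (rewrite Cmod_minus_sym, <- Cmod_half; f_equal; unfold w, v; field).
assert (S7' : Cmod (u - w) = Cmod (c - b) / 2) by (rewrite Cmod_minus_sym; auto).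
assert (S8' : Cmod (u - v) = Cmod (a - c) / 2) by (rewrite Cmod_minus_sym; auto).
assert (S9' : Cmod (v - w) = Cmod (b - a) / 2) by (rewrite Cmod_minus_sym; auto).
assert (S6' : Cmod (w - a) = Cmod (a - c) / 2) by (rewrite Cmod_minus_sym; auto).
assert (S0 : Cmod (a - a) = 0) by (replace (a - a)%C with (RtoC 0) by ring; apply Cmod_0).
unfold tstep. fold u v w.
destruct (Rle_dec _ _) as [A1|A1]; [|destruct (Rle_dec _ _) as [A2|A2]; [|destruct (Rle_dec _ _) as [A3|A3]]];
  unfold tin, tsize; simpl fst; (split; [auto|]); (split; [lra|]); split; lra.
Qed.

Lemma goursat f R r T : (forall w, Cmod w < R -> exists l, Cd f w l) -> r < R -> tin r T -> tri f T = 0.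
Proof.
intros Hd Hr HT.
assert (Hc : dcont R f) by (intros w Hw; destruct (Hd w Hw) as [l Hl]; exact (Cd_cont _ _ _ Hl)).
set (Tn := fun n => Nat.iter n (tstep f) T).
assert (P2 : forall n, 0 < 2 ^ n) by (intros; apply pow_lt; lra).
set (d0 := tsize T).
assert (Hin : forall n, tin r (Tn n) /\ Cmod (tri f T) <= 4 ^ n * Cmod (tri f (Tn n)) /\ tsize (Tn n) = d0 / 2 ^ n).
{ induction n.
  - simpl. unfold d0. repeat split; auto; lra.
  - destruct IHn as [H1 [H2 H3]].
    destruct (tstep_spec f R r (Tn n) Hc Hr H1) as [K1 [K2 [K3 _]]].
    change (Tn (S n)) with (tstep f (Tn n)). split; [exact K1|]. split.
    + simpl. assert (0 < 4 ^ n) by (apply pow_lt; lra). nra.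
    + rewrite K3, H3. simpl. field. apply Rgt_not_eq, P2. }
destruct (Cgeo_cauchy (fun n => fst (fst (Tn n))) d0) as [z Hz].
{ intros n. destruct (Hin n) as [H1 [H2 H3]].
  destruct (tstep_spec f R r (Tn n) Hc Hr H1) as [_ [_ [_ K4]]].
  rewrite <- H3. exact K4. }
assert (D0 : 0 <= d0).
{ unfold d0, tsize. destruct T as [[a b] c]. pose proof (Cmod_ge_0 (b - a)). pose proof (Cmod_ge_0 (c - b)). pose proof (Cmod_ge_0 (a - c)). lra. }
(* The limit [z] is within 4 d0 / 2^n of the n-th first vertex and the triangle adds at most d0 /
   2^n; the constant 6 leaves room for strict inequalities. *)
assert (HL0 : forall e, 0 < e -> exists n, 6 * d0 / 2 ^ n < e).
{ intros e He.
  assert (HL : is_lim_seq (fun n => (6 * d0) * (/2) ^ n) (6 * d0 * 0)).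
  { apply (is_lim_seq_scal_l _ (6*d0) 0). apply is_lim_seq_geom. rewrite Rabs_pos_eq; lra. }
  rewrite Rmult_0_r in HL. apply is_lim_seq_spec in HL. destruct (HL (mkposreal _ He)) as [N HN].
  exists N. specialize (HN N (le_n _)). simpl in HN. rewrite Rminus_0_r in HN.
  rewrite pow_inv in HN. eapply Rle_lt_trans; [apply Rle_abs|exact HN]. }
assert (HzR : Cmod z < R).
{ destruct (HL0 (R - r)) as [n Hn]; [lra|]. specialize (Hz n).
  destruct (Hin n) as [H1 _]. destruct (Tn n) as [[a b] c]. simpl in Hz. destruct H1 as [H1 _].
  pose proof (Cmod_le_minus z a). rewrite Cmod_minus_sym in H.
  replace (6 * d0 / 2 ^ n) with (4 * d0 / 2 ^ n + 2 * d0 / 2 ^ n) in Hn by (field; apply Rgt_not_eq, P2).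
  assert (0 <= 2 * d0 / 2 ^ n) by (apply Rdiv_le_0_compat; [lra|apply P2]). lra. }
destruct (Hd z HzR) as [l Hl].
apply Cmod_eq_0. apply Rle_antisym; [|apply Cmod_ge_0].
apply Rnot_lt_le; intros Hpos.
set (I0 := Cmod (tri f T)) in *.
(* The estimate [F] below reads I0 <= 10 e d0^2, and this [e] makes its right side at most I0 / 2.
   The summand 1 covers a triangle of size 0. *)
set (e := I0 / (20 * (d0 * d0 + 1))).
assert (He : 0 < e) by (apply Rdiv_lt_0_compat; nra).
destruct (Cd_eps f z l Hl e He) as [d [Hdp Hdd]].
destruct (HL0 d Hdp) as [n Hn].
destruct (Hin n) as [H1 [H2 H3]]. specialize (Hz n).
set (dn := d0 / 2 ^ n) in *.
assert (Hdn : 0 <= dn) by (apply Rdiv_le_0_compat; [lra|apply P2]).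
replace (4 * d0 / 2 ^ n) with (4 * dn) in Hz by (unfold dn; field; apply Rgt_not_eq, P2).
replace (6 * d0 / 2 ^ n) with (6 * dn) in Hn by (unfold dn; field; apply Rgt_not_eq, P2).
assert (Hb : Cmod (tri f (Tn n)) <= 2 * (e * (5 * dn)) * dn).
{ destruct (Tn n) as [[a b] c]. simpl in Hz. destruct H1 as [Ha [Hb Hcc]]. unfold tsize in H3.
  pose proof (Cmod_ge_0 (b - a)) as Q1. pose proof (Cmod_ge_0 (c - b)) as Q2. pose proof (Cmod_ge_0 (a - c)) as Q3.
  (* The tangent map of [f] at [z] integrates to 0 around the triangle, so only the remainder of the
     derivative counts. *)
  set (g := fun w => (f z - l * z + l * w)%C).
  assert (G : (seg g a b + seg g b c + seg g c a)%C = 0).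
  { unfold g. rewrite !seg_affine. field. }
  assert (B : forall x y, Cmod x <= r -> Cmod y <= r -> Cmod (x - a) <= dn -> Cmod (y - a) <= dn ->
     Cmod (seg f x y - seg g x y) <= 2 * (e * (5 * dn)) * Cmod (y - x)).
  { intros x y Hx Hy Hxa Hya. apply (seg_diff f g x y R); auto; [apply dcont_affine|lra|lra|].
    intros t Ht. unfold g.
    set (w := spt x y t).
    assert (Hw : Cmod (w - z) <= 5 * dn).
    { assert (Hwa : Cmod (w - a) <= dn).
      { replace (w - a)%C with (spt (x - a) (y - a) t) by (unfold w, spt; ring).
        now apply spt_disc. }
      pose proof (Cmod_split w a z). lra. }
    replace (f w - (f z - l * z + l * w))%C with (f w - f z - l * (w - z))%C by ring.
    eapply Rle_trans; [apply Hdd|].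
    - destruct (Rle_lt_or_eq_dec 0 dn Hdn) as [Q|Q]; [lra|]. rewrite <- Q in Hw. lra.
    - apply Rmult_le_compat_l; lra. }
  assert (Za : Cmod (a - a) <= dn) by (replace (a - a)%C with (RtoC 0) by ring; rewrite Cmod_0; auto).
  assert (Zb : Cmod (b - a) <= dn) by lra.
  assert (Zc : Cmod (c - a) <= dn) by (rewrite Cmod_minus_sym; lra).
  pose proof (B a b Ha Hb Za Zb) as B1. pose proof (B b c Hb Hcc Zb Zc) as B2. pose proof (B c a Hcc Ha Zc Za) as B3.
  assert (E : tri f (a, b, c) = ((seg f a b - seg g a b) + (seg f b c - seg g b c) + (seg f c a - seg g c a))%C).
  { unfold tri. transitivity (seg f a b + seg f b c + seg f c a - (seg g a b + seg g b c + seg g c a))%C; [rewrite G; ring|ring]. }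
  rewrite E. rewrite <- H3 at 2.
  eapply Rle_trans; [eapply Rle_trans; [apply Cmod_triangle|]; apply Rplus_le_compat_r, Cmod_triangle|]. lra. }
assert (E4 : 4 ^ n * (dn * dn) = d0 * d0).
{ unfold dn. replace 4 with (2 * 2) by ring. rewrite Rpow_mult_distr. field. apply Rgt_not_eq, P2. }
assert (F : I0 <= 10 * e * (d0 * d0)).
{ eapply Rle_trans; [apply H2|]. rewrite <- E4. assert (0 < 4 ^ n) by (apply pow_lt; lra).
  apply (Rmult_le_compat_l (4 ^ n)) in Hb; lra. }
assert (X : 10 * e * (d0 * d0) <= I0 / 2).
{ unfold e. apply (Rmult_le_reg_r (20 * (d0 * d0 + 1))); [nra|].
  replace (10 * (I0 / (20 * (d0 * d0 + 1))) * (d0 * d0) * (20 * (d0 * d0 + 1))) with (10 * I0 * (d0 * d0)) by (field; nra).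
  nra. }
lra.
Qed.

(** Goursat on the triangle 0, z, w turns the increment of the radial integral [seg f 0] into
    [seg f z w], which is then compared with the constant [f z]. *)
Lemma primitive f R : (forall w, Cmod w < R -> exists l, Cd f w l) ->
  exists G, forall w, Cmod w < R -> Cd G w (f w).
Proof.
intros Hd.
assert (Hc : dcont R f) by (intros w Hw; destruct (Hd w Hw) as [l Hl]; exact (Cd_cont _ _ _ Hl)).
exists (fun w => seg f 0 w). intros z Hz. apply eps_Cd. intros e He.
destruct (Hc z Hz (e/2) ltac:(lra)) as [d [Hdp K]].
exists (Rmin d (R - Cmod z)); split; [apply Rmin_pos; lra|].
intros w Hw.
assert (Hw1 : Cmod (w - z) < d) by (eapply Rlt_le_trans; [apply Hw|apply Rmin_l]).
assert (Hw2 : Cmod (w - z) < R - Cmod z) by (eapply Rlt_le_trans; [apply Hw|apply Rmin_r]).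
pose proof (Cmod_le_minus w z).
assert (Z : Cmod 0 < R) by (rewrite Cmod_0; pose proof (Cmod_ge_0 z); lra).
assert (T : tri f (RtoC 0, z, w) = 0).
{ apply (goursat f R (Rmax (Cmod z) (Cmod w))); auto.
  - apply Rmax_lub_lt; lra.
  - simpl. rewrite Cmod_0. repeat split; [|apply Rmax_l|apply Rmax_r].
    eapply Rle_trans; [apply (Cmod_ge_0 z)|apply Rmax_l]. }
unfold tri in T. rewrite (seg_rev f 0 w R) in T by (auto; lra).
assert (E : (seg f 0 w - seg f 0 z)%C = seg f z w).
{ apply Ceq_minus. replace (seg f 0 w - seg f 0 z - seg f z w)%C with (- (seg f 0 z + seg f z w + - seg f 0 w))%C by ring.
  rewrite T. ring. }
rewrite E.
assert (A : seg (fun u => f z + 0 * u)%C z w = (f z * (w - z))%C) by (rewrite seg_affine; field).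
rewrite <- A.
replace e with (2 * (e / 2)) by field.
apply (seg_diff _ _ z w R); auto; [apply dcont_affine|lra|].
intros t Ht. replace (f z + 0 * spt z w t)%C with (f z) by ring.
apply Rlt_le, K. replace z with (spt z w 0) at 2 by (unfold spt; ring).
rewrite spt_lip, Rminus_0_r, Rabs_pos_eq by lra. pose proof (Cmod_ge_0 (w - z)). nra.
Qed.

(** * Derivatives along curves and under the integral sign *)

Definition cder (g : R -> C) (t : R) (v : C) : Prop :=
  is_derive (fun u => Re (g u)) t (Re v) /\ is_derive (fun u => Im (g u)) t (Im v).

Lemma is_derive_eps (f : R -> R) t l : is_derive f t l <-> forall e, 0 < e -> exists d, 0 < d /\
  forall u, Rabs (u - t) < d -> Rabs (f u - f t - (u - t) * l) <= e * Rabs (u - t).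
Proof.
split.
- intros H e He. apply is_derive_Reals in H. destruct (H e He) as [d Hd].
  exists d; split; [apply cond_pos|]. intros u Hu.
  destruct (Req_dec u t) as [->|N].
  + replace (f t - f t - (t - t) * l) with 0 by ring. rewrite Rabs_R0. apply Rmult_le_pos; [lra|apply Rabs_pos].
  + specialize (Hd (u - t) ltac:(lra) Hu). replace (t + (u - t)) with u in Hd by ring.
    replace (f u - f t - (u - t) * l) with (((f u - f t) / (u - t) - l) * (u - t)) by (field; lra).
    rewrite Rabs_mult. apply Rmult_le_compat_r; [apply Rabs_pos|lra].
- intros H. apply is_derive_Reals. intros e He. destruct (H (e/2) ltac:(lra)) as [d [Hd K]].
  exists (mkposreal d Hd). intros h Hh Hhd. simpl in Hhd. specialize (K (t + h)).
  replace (t + h - t) with h in K by ring. specialize (K Hhd).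
  replace ((f (t + h) - f t) / h - l) with ((f (t + h) - f t - h * l) / h) by (field; auto).
  unfold Rdiv. rewrite Rabs_mult, Rabs_inv. pose proof (Rabs_pos_lt h Hh).
  apply (Rmult_lt_reg_r (Rabs h)); auto. rewrite Rmult_assoc, Rinv_l, Rmult_1_r by lra. nra.
Qed.

Lemma cder_eps g t v : cder g t v <-> forall e, 0 < e -> exists d, 0 < d /\
  forall u, Rabs (u - t) < d -> Cmod (g u - g t - RtoC (u - t) * v) <= e * Rabs (u - t).
Proof.
split.
- intros [H1 H2] e He.
  destruct (proj1 (is_derive_eps _ _ _) H1 (e/2) ltac:(lra)) as [d1 [D1 K1]].
  destruct (proj1 (is_derive_eps _ _ _) H2 (e/2) ltac:(lra)) as [d2 [D2 K2]].
  exists (Rmin d1 d2); split; [now apply Rmin_pos|]. intros u Hu.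
  specialize (K1 u (Rlt_le_trans _ _ _ Hu (Rmin_l _ _))). specialize (K2 u (Rlt_le_trans _ _ _ Hu (Rmin_r _ _))).
  eapply Rle_trans; [apply Cmod_le_Re_Im|].
  rewrite !Re_minus, !Im_minus, re_scal_l, im_scal_l. lra.
- intros H. split; apply is_derive_eps; intros e He; destruct (H e He) as [d [D K]]; exists d; split; auto;
    intros u Hu; specialize (K u Hu).
  + pose proof (re_le_Cmod (g u - g t - RtoC (u - t) * v)) as L.
    rewrite !Re_minus, re_scal_l in L. lra.
  + pose proof (im_le_Cmod (g u - g t - RtoC (u - t) * v)) as L.
    rewrite !Im_minus, im_scal_l in L. lra.
Qed.

Lemma cder_const k t : cder (fun _ => k) t 0.
Proof. split; apply (is_derive_const (V := R_NormedModule)). Qed.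

Lemma cder_plus f g t v w : cder f t v -> cder g t w -> cder (fun u => f u + g u)%C t (v + w)%C.
Proof. intros [A B] [A' B']; split; apply (is_derive_plus (V := R_NormedModule)); auto. Qed.

Lemma cder_mult f g t v w : cder f t v -> cder g t w ->
  cder (fun u => f u * g u)%C t (v * g t + f t * w)%C.
Proof.
intros [A B] [A' B']; split; simpl.
- evar_last.
  + apply (is_derive_minus (V := R_NormedModule)); (apply (is_derive_mult (K := R_AbsRing)); [eassumption..|]);
      intros; apply Rmult_comm.
  + unfold minus, plus, opp, mult; simpl. unfold Re, Im. ring.
- evar_last.
  + apply (is_derive_plus (V := R_NormedModule)); (apply (is_derive_mult (K := R_AbsRing)); [eassumption..|]);
      intros; apply Rmult_comm.
  + unfold plus, mult; simpl. unfold Re, Im. ring.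
Qed.

Lemma cder_Cd G g t v l : cder g t v -> Cd G (g t) l -> cder (fun u => G (g u)) t (v * l)%C.
Proof.
intros Hg HG. apply cder_eps. intros e He.
set (M := Cmod v + Cmod l + 2).
pose proof (Cmod_ge_0 v) as Pv. pose proof (Cmod_ge_0 l) as Pl.
assert (HM : 2 <= M) by (unfold M; lra).
set (e1 := Rmin 1 (e / (2 * M))).
assert (E1 : 0 < e1) by (apply Rmin_pos; [lra|apply Rdiv_lt_0_compat; lra]).
assert (E1M : e1 * (2 * M) <= e).
{ assert (e1 <= e / (2 * M)) by apply Rmin_r.
  apply (Rmult_le_compat_r (2 * M)) in H; [|lra]. unfold Rdiv in H.
  rewrite Rmult_assoc, Rinv_l, Rmult_1_r in H; lra. }
assert (E11 : e1 <= 1) by apply Rmin_l.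
destruct (Cd_eps G (g t) l HG e1 E1) as [d1 [D1 K1]].
destruct (proj1 (cder_eps g t v) Hg e1 E1) as [d2 [D2 K2]].
exists (Rmin d2 (d1 / M)); split; [apply Rmin_pos; auto; apply Rdiv_lt_0_compat; lra|].
intros u Hu.
assert (Hu2 : Rabs (u - t) < d2) by (eapply Rlt_le_trans; [apply Hu|apply Rmin_l]).
assert (Hu1 : Rabs (u - t) * M < d1).
{ assert (X : Rabs (u - t) < d1 / M) by (eapply Rlt_le_trans; [apply Hu|apply Rmin_r]).
  apply (Rmult_lt_compat_r M) in X; [|lra]. unfold Rdiv in X. rewrite Rmult_assoc, Rinv_l, Rmult_1_r in X; lra. }
specialize (K2 u Hu2). pose proof (Rabs_pos (u - t)) as Pu.
assert (A : Cmod (g u - g t) <= (Cmod v + 1) * Rabs (u - t)).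
{ pose proof (Cmod_le_minus (g u - g t) (RtoC (u - t) * v)) as X. rewrite Cmod_mult, Cmod_R in X. nra. }
specialize (K1 (g u)).
assert (B : Cmod (g u - g t) < d1) by (eapply Rle_lt_trans; [apply A|]; unfold M in Hu1; nra).
specialize (K1 B).
replace (G (g u) - G (g t) - RtoC (u - t) * (v * l))%C with
  ((G (g u) - G (g t) - l * (g u - g t)) + l * (g u - g t - RtoC (u - t) * v))%C by ring.
eapply Rle_trans; [apply Cmod_triangle|]. rewrite Cmod_mult.
assert (Y1 : Cmod (G (g u) - G (g t) - l * (g u - g t)) <= e1 * ((Cmod v + 1) * Rabs (u - t))).
{ eapply Rle_trans; [apply K1|]. apply Rmult_le_compat_l; lra. }
assert (Y2 : Cmod l * Cmod (g u - g t - RtoC (u - t) * v) <= Cmod l * (e1 * Rabs (u - t))) by (apply Rmult_le_compat_l; lra).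
assert (Y3 : e1 * (Cmod v + 1 + Cmod l) * Rabs (u - t) <= e * Rabs (u - t)).
{ apply Rmult_le_compat_r; auto. unfold M in E1M. nra. }
nra.
Qed.

Definition c2 (F : R -> R -> C) (x t : R) : Prop :=
  continuity_2d_pt (fun u v => Re (F u v)) x t /\ continuity_2d_pt (fun u v => Im (F u v)) x t.

Lemma c2_const k x t : c2 (fun _ _ => k) x t.
Proof. split; apply continuity_2d_pt_const. Qed.

Lemma c2_plus F G x t : c2 F x t -> c2 G x t -> c2 (fun u v => F u v + G u v)%C x t.
Proof. intros [A B] [A' B']; split; now apply continuity_2d_pt_plus. Qed.

Lemma c2_mult F G x t : c2 F x t -> c2 G x t -> c2 (fun u v => F u v * G u v)%C x t.
Proof.
intros [A B] [A' B']; split.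
- apply continuity_2d_pt_minus; now apply continuity_2d_pt_mult.
- apply continuity_2d_pt_plus; now apply continuity_2d_pt_mult.
Qed.

Lemma c2_Cc f F x t : c2 F x t -> Cc f (F x t) -> c2 (fun u v => f (F u v)) x t.
Proof.
intros [A B] Hf.
assert (K : forall e, 0 < e -> locally_2d (fun u v => Cmod (f (F u v) - f (F x t)) < e) x t).
{ intros e He. destruct (Hf e He) as [d [Hd K]].
  assert (Hd2 : 0 < d / 2) by lra.
  destruct (locally_2d_and _ _ _ _ (A (mkposreal _ Hd2)) (B (mkposreal _ Hd2))) as [d' Hd'].
  exists d'. intros u v Hu Hv. destruct (Hd' u v Hu Hv) as [X Y]. simpl in X, Y.
  apply K. eapply Rle_lt_trans; [apply Cmod_le_Re_Im|]. rewrite Re_minus, Im_minus. lra. }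
split; intros e; destruct (K e (cond_pos e)) as [d Hd]; exists d; intros u v Hu Hv;
  (eapply Rle_lt_trans; [|exact (Hd u v Hu Hv)]).
- rewrite <- Re_minus. apply re_le_Cmod.
- rewrite <- Im_minus. apply im_le_Cmod.
Qed.

Lemma c2_fst x t : c2 (fun u _ => RtoC u) x t.
Proof.
split; [exact (continuity_2d_pt_id1 x t)|exact (continuity_2d_pt_const x t 0)].
Qed.

Lemma c2_snd g x t : pcont g t -> c2 (fun _ v => g v) x t.
Proof.
intros [A B]; split.
- apply (continuity_1d_2d_pt_comp (fun v => Re (g v)) (fun _ v => v)); [|apply continuity_2d_pt_id2].
  apply continuity_pt_filterlim; assumption.
- apply (continuity_1d_2d_pt_comp (fun v => Im (g v)) (fun _ v => v)); [|apply continuity_2d_pt_id2].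
  apply continuity_pt_filterlim; assumption.
Qed.

Lemma cder_CI_param (F dF : R -> R -> C) x a b :
  locally x (fun u => forall v, cder (fun w => F w v) u (dF u v) /\ pcont (F u) v) ->
  (forall v, c2 dF x v) ->
  cder (fun u => CI (F u) a b) x (CI (dF x) a b).
Proof.
intros H1 H2. pose proof (locally_singleton _ _ H1) as H1x.
split; simpl.
- evar_last.
  + apply is_derive_RInt_param.
    * generalize H1; apply filter_imp; intros u Hu v _. exists (Re (dF u v)). apply Hu.
    * intros t _. apply (continuity_2d_pt_ext_loc (fun u v => Re (dF u v))); [|apply H2].
      destruct H1 as [d Hd]. exists d. intros u v Hu _. symmetry. apply is_derive_unique. apply (Hd u Hu v).
    * generalize H1; apply filter_imp; intros u Hu.
      apply (ex_RInt_continuous (V := R_CompleteNormedModule)). intros t _. apply (proj2 (Hu t)).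
  + apply RInt_ext. intros t _. apply is_derive_unique. apply H1x.
- evar_last.
  + apply is_derive_RInt_param.
    * generalize H1; apply filter_imp; intros u Hu v _. exists (Im (dF u v)). apply Hu.
    * intros t _. apply (continuity_2d_pt_ext_loc (fun u v => Im (dF u v))); [|apply H2].
      destruct H1 as [d Hd]. exists d. intros u v Hu _. symmetry. apply is_derive_unique. apply (Hd u Hu v).
    * generalize H1; apply filter_imp; intros u Hu.
      apply (ex_RInt_continuous (V := R_CompleteNormedModule)). intros t _. apply (proj2 (Hu t)).
  + apply RInt_ext. intros t _. apply is_derive_unique. apply H1x.
Qed.

Lemma is_CI_derive (g dg : R -> C) a b : (forall t, cder g t (dg t)) -> (forall t, pcont dg t) ->
  is_CI dg a b (g b - g a)%C.
Proof.
intros H1 H2; split.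
- change (Re (g b - g a)%C) with (minus (Re (g b)) (Re (g a)) : R).
  apply (is_RInt_derive (V := R_CompleteNormedModule) (fun t => Re (g t)) (fun t => Re (dg t)));
    intros t _; [apply H1|apply H2].
- change (Im (g b - g a)%C) with (minus (Im (g b)) (Im (g a)) : R).
  apply (is_RInt_derive (V := R_CompleteNormedModule) (fun t => Im (g t)) (fun t => Im (dg t)));
    intros t _; [apply H1|apply H2].
Qed.

(* Euler's relation [psi = x psi'] forces [psi] to be linear. *)
Lemma euler_linear (psi xi : R -> R) d : 0 < d ->
  (forall x, - d < x < 1 + d -> is_derive psi x (xi x)) ->
  (forall x, - d < x < 1 + d -> psi x = x * xi x) -> xi 0 = xi 1.
Proof.
intros Hd H1 H2.
(* The quotient psi y / y has zero derivative for y > 0, so [psi] is linear there with slope [xi 1].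
   Differentiability at 0, with [psi 0] = 0, then forces the same slope on [xi 0]. *)
assert (L : forall x, 0 < x < 1 -> psi x = x * xi 1).
{ intros x Hx.
  destruct (MVT_gen (fun y => psi y / y) x 1 (fun _ => 0)) as [c [_ Hc]].
  - rewrite Rmin_left, Rmax_right by lra. intros y Hy.
    evar_last. apply is_derive_div; [apply H1; lra|apply is_derive_id|lra].
    rewrite (H2 y) by lra. unfold one; simpl. field; lra.
  - rewrite Rmin_left, Rmax_right by lra. intros y Hy. apply continuity_pt_filterlim.
    apply (ex_derive_continuous (K := R_AbsRing) (V := R_NormedModule) (fun y => psi y / y)).
    exists ((xi y * y - psi y * 1) / y ^ 2). apply is_derive_div; [apply H1; lra|apply (is_derive_id (K := R_AbsRing))|lra].
  - rewrite (H2 1) in Hc by lra. rewrite Rmult_0_l in Hc.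
    assert (psi x / x = xi 1) by lra. rewrite <- H. field; lra. }
apply Rminus_diag_uniq. apply Rabs_eq_0. apply Rle_antisym; [|apply Rabs_pos].
apply Rnot_lt_le; intros Hp. set (e := Rabs (xi 0 - xi 1)) in *.
destruct (proj1 (is_derive_eps _ _ _) (H1 0 ltac:(lra)) (e / 2) ltac:(lra)) as [r [Hr K]].
set (u := Rmin (r / 2) (1 / 2)).
assert (Hu : 0 < u) by (apply Rmin_pos; lra).
assert (Hu1 : u <= r / 2) by apply Rmin_l. assert (Hu2 : u <= 1 / 2) by apply Rmin_r.
specialize (K u). rewrite Rminus_0_r, (Rabs_pos_eq u) in K by lra. specialize (K ltac:(lra)).
rewrite (L u), (H2 0) in K by lra.
replace (u * xi 1 - 0 * xi 0 - u * xi 0) with (- (u * (xi 0 - xi 1))) in K by ring.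
rewrite Rabs_Ropp, Rabs_mult, (Rabs_pos_eq u) in K by lra. fold e in K. nra.
Qed.

(** * Cauchy's formula and the Schwarz formula on circles *)

Definition ec (r t : R) : C := (RtoC r * (cos t, sin t))%C.

Lemma Cmod_ec r t : 0 <= r -> Cmod (ec r t) = r.
Proof.
intros Hr. unfold ec. rewrite Cmod_mult, Cmod_R, Rabs_pos_eq by auto.
assert (E : Cmod (cos t, sin t) = 1).
{ unfold Cmod. simpl. rewrite !Rmult_1_r. pose proof (sin2_cos2 t). unfold Rsqr in H.
  replace (cos t * cos t + sin t * sin t) with 1 by lra. apply sqrt_1. }
rewrite E; ring.
Qed.

Lemma cder_ec r t : cder (ec r) t (Ci * ec r t)%C.
Proof. split; simpl; auto_derive; auto; ring. Qed.

Lemma ec_2PI r : ec r (2 * PI) = ec r 0.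
Proof. unfold ec. now rewrite cos_2PI, sin_2PI, cos_0, sin_0. Qed.

Lemma cder_pcont g t v : cder g t v -> pcont g t.
Proof.
intros [A B]; split; apply (ex_derive_continuous (K := R_AbsRing) (V := R_NormedModule)); eexists; eassumption.
Qed.

Lemma ec_ne r a t : Cmod a < r -> (ec r t - a)%C <> 0.
Proof.
intros H E. apply (f_equal Cmod) in E. rewrite Cmod_0 in E.
assert (ec r t = a) by (apply Ceq_minus; apply Cmod_eq_0; auto).
pose proof (Cmod_ge_0 a). rewrite <- (Cmod_ec r t) in H by lra. rewrite H0 in H. lra.
Qed.

(** The Cauchy kernel in the angle: dw / (w - a) = i [ker r a t] dt for w = [ec r t]. *)
Definition ker (r : R) (a : C) (t : R) : C := (ec r t * / (ec r t - a))%C.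

Lemma cder_minus_const g t v a : cder g t v -> cder (fun u => g u - a)%C t v.
Proof.
intros H. replace v with (v + 0)%C by ring. apply cder_plus; auto. apply cder_const.
Qed.

Lemma cder_inv_ec r a t : Cmod a < r ->
  cder (fun u => / (ec r u - a))%C t (Ci * ec r t * (- / ((ec r t - a) * (ec r t - a))))%C.
Proof.
intros H. apply (cder_Cd (fun w => / w)%C (fun u => ec r u - a)%C t); [apply cder_minus_const, cder_ec|].
apply Cd_inv, ec_ne; auto.
Qed.

Lemma pcont_inv_ec r a t : Cmod a < r -> pcont (fun u => / (ec r u - a))%C t.
Proof. intros H. eapply cder_pcont, cder_inv_ec; auto. Qed.

Lemma pcont_ec r t : pcont (ec r) t.
Proof. eapply cder_pcont, cder_ec. Qed.

Lemma pcont_ker r a t : Cmod a < r -> pcont (ker r a) t.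
Proof. intros H. apply pcont_mult; [apply pcont_ec|now apply pcont_inv_ec]. Qed.

(** The circle is contracted to [a] along [gam]. Differentiating the integral xi(x) of [dF x]
    directly would require a continuous derivative of [f]; a primitive [G] avoids this. The integral
    psi(x) of [F x], built from [G], has derivative xi(x) by [D2], and psi(x) = x xi(x) by [D3]. So
    [euler_linear] equates xi(1), the Cauchy integral, with xi(0), which is [f a] times the integral
    of the kernel. *)
Lemma cauchy_formula f R r a : (forall w, Cmod w < R -> exists l, Cd f w l) -> r < R -> Cmod a < r ->
  CI (fun t => f (ec r t) * ker r a t)%C 0 (2 * PI) = (f a * CI (ker r a) 0 (2 * PI))%C.
Proof.
intros Hd HrR Ha.
pose proof (Cmod_ge_0 a) as Pa.
assert (Hc : dcont R f) by (intros w Hw; destruct (Hd w Hw) as [l Hl]; exact (Cd_cont _ _ _ Hl)).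
destruct (primitive f R Hd) as [G HG].
set (gam := fun x t => (a + RtoC x * (ec r t - a))%C).
(* Chosen so that (1 + 2 d) r = R, which keeps the curve [gam x] inside the disc of radius [R] for
   -d < x < 1 + d. *)
set (d := (R - r) / (2 * r)).
assert (Hdp : 0 < d) by (apply Rdiv_lt_0_compat; lra).
assert (Hgam : forall x t, - d < x < 1 + d -> Cmod (gam x t) < R).
{ intros x t Hx. unfold gam. replace (a + RtoC x * (ec r t - a))%C with (RtoC (1 - x) * a + RtoC x * ec r t)%C by (rewrite RtoC_minus; ring).
  eapply Rle_lt_trans; [apply Cmod_triangle|]. rewrite !Cmod_mult, !Cmod_R, Cmod_ec by lra.
  assert (Rabs (1 - x) + Rabs x < 1 + 2 * d) by (unfold Rabs; destruct (Rcase_abs _), (Rcase_abs _); lra).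
  assert (E : (1 + 2 * d) * r = R) by (unfold d; field; lra).
  pose proof (Rabs_pos (1 - x)). pose proof (Rabs_pos x). nra. }
set (F := fun x t => (G (gam x t) * (ker r a t * / (ec r t - a)))%C).
set (dF := fun x t => (f (gam x t) * ker r a t)%C).
assert (pg : forall x t, pcont (gam x) t).
{ intros x t. unfold gam. apply pcont_plus; [apply pcont_const|]. apply pcont_mult; [apply pcont_const|].
  apply pcont_plus; [apply pcont_ec|apply pcont_const]. }
assert (pF : forall x t, - d < x < 1 + d -> pcont (F x) t).
{ intros x t Hx. unfold F. apply pcont_mult.
  - apply (Cc_pcont G (gam x)); auto. eapply Cd_cont, HG; auto.
  - apply pcont_mult; [apply pcont_ker; auto|apply pcont_inv_ec; auto]. }
assert (pdF : forall x t, - d < x < 1 + d -> pcont (dF x) t).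
{ intros x t Hx. unfold dF. apply pcont_mult; [|apply pcont_ker; auto].
  apply (Cc_pcont f (gam x)); auto. }
assert (D1 : forall x t, - d < x < 1 + d -> cder (fun y => F y t) x (dF x t)).
{ intros x t Hx. unfold F.
  replace (dF x t) with (((ec r t - a) * f (gam x t)) * (ker r a t * / (ec r t - a)) + G (gam x t) * 0)%C.
  - apply (cder_mult (fun y => G (gam y t)) (fun _ => (ker r a t * / (ec r t - a))%C)); [|apply cder_const].
    apply (cder_Cd G (fun y => gam y t)); [|apply HG; auto].
    replace (ec r t - a)%C with (0 + (1 * (ec r t - a) + RtoC x * 0))%C by ring.
    apply cder_plus; [apply cder_const|]. apply (cder_mult (fun y => RtoC y) (fun _ => (ec r t - a)%C)); [|apply cder_const].
    split; simpl; [apply (is_derive_id (K := R_AbsRing))|apply (is_derive_const (V := R_NormedModule))].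
  - unfold dF. field. apply ec_ne; auto. }
assert (D2 : forall x, - d < x < 1 + d -> cder (fun y => CI (F y) 0 (2 * PI)) x (CI (dF x) 0 (2 * PI))).
{ intros x Hx. apply cder_CI_param.
  - exists (mkposreal (Rmin (x + d) (1 + d - x)) ltac:(apply Rmin_pos; lra)).
    intros y Hy v. change (Rabs (y - x) < Rmin (x + d) (1 + d - x)) in Hy.
    pose proof (Rmin_l (x + d) (1 + d - x)). pose proof (Rmin_r (x + d) (1 + d - x)).
    apply Rabs_def2 in Hy. split; [apply D1; lra|apply pF; lra].
  - intros v. unfold dF. apply c2_mult; [|apply c2_snd, pcont_ker; auto].
    apply (c2_Cc f gam); auto. unfold gam. apply c2_plus; [apply c2_const|]. apply c2_mult; [apply c2_fst|].
    apply (c2_snd (fun v => (ec r v - a)%C)). apply pcont_plus; [apply pcont_ec|apply pcont_const]. }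
(* The t-derivative of G(gam) / (ec - a) equals i (x dF - F), and its integral over a full period is
   0. *)
assert (D3 : forall x, - d < x < 1 + d -> CI (F x) 0 (2 * PI) = (RtoC x * CI (dF x) 0 (2 * PI))%C).
{ intros x Hx.
  pose proof (is_CI_derive (fun t => G (gam x t) * / (ec r t - a))%C (fun t => Ci * (RtoC x * dF x t - F x t))%C 0 (2 * PI)) as H.
  assert (K : (Ci * (RtoC x * CI (dF x) 0 (2 * PI) - CI (F x) 0 (2 * PI)))%C = 0).
  { rewrite <- (is_CI_unique _ _ _ _ (is_CI_scal Ci _ _ _ _ (is_CI_minus _ _ _ _ _ _ (is_CI_scal (RtoC x) _ _ _ _ (CI_correct (dF x) 0 (2*PI) (fun t _ => pdF x t Hx))) (CI_correct (F x) 0 (2*PI) (fun t _ => pF x t Hx))))).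
    rewrite (is_CI_unique _ _ _ (G (gam x (2 * PI)%R) * / (ec r (2 * PI)%R - a) - G (gam x 0) * / (ec r 0 - a))%C).
    - unfold gam. rewrite ec_2PI. ring.
    - apply H.
      + intros t.
        replace (Ci * (RtoC x * dF x t - F x t))%C with
          (((RtoC x * (Ci * ec r t)) * f (gam x t)) * / (ec r t - a) + G (gam x t) * (Ci * ec r t * (- / ((ec r t - a) * (ec r t - a)))))%C.
        * apply (cder_mult (fun t => G (gam x t)) (fun t => / (ec r t - a))%C); [|apply cder_inv_ec; auto].
          apply (cder_Cd G (gam x)); [|apply HG; auto].
          replace (RtoC x * (Ci * ec r t))%C with (0 + (0 * (ec r t - a) + RtoC x * (Ci * ec r t)))%C by ring.
          apply cder_plus; [apply cder_const|]. apply (cder_mult (fun _ => RtoC x) (fun t => (ec r t - a)%C)); [apply cder_const|].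
          apply cder_minus_const, cder_ec.
        * unfold dF, F, ker. field. apply ec_ne; auto.
      + intros t. apply pcont_mult; [apply pcont_const|].
        replace (fun u => (RtoC x * dF x u - F x u)%C) with (fun u => (RtoC x * dF x u + (RtoC (-1)) * F x u)%C).
        * apply pcont_plus; apply pcont_mult; auto using pcont_const.
        * apply FunctionalExtensionality.functional_extensionality. intros u. ring. }
  symmetry. apply Ceq_minus.
  replace (RtoC x * CI (dF x) 0 (2 * PI) - CI (F x) 0 (2 * PI))%C with
    (- Ci * (Ci * (RtoC x * CI (dF x) 0 (2 * PI) - CI (F x) 0 (2 * PI))))%C.
  - rewrite K. ring.
  - replace (- Ci * (Ci * (RtoC x * CI (dF x) 0 (2 * PI) - CI (F x) 0 (2 * PI))))%C with
      (- (Ci * Ci) * (RtoC x * CI (dF x) 0 (2 * PI) - CI (F x) 0 (2 * PI)))%C by ring.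
    replace (Ci * Ci)%C with (RtoC (-1)) by (apply C_ext; simpl; ring). ring. }
assert (E : CI (dF 1) 0 (2 * PI) = CI (dF 0) 0 (2 * PI)).
{ symmetry. apply C_ext.
  - apply (euler_linear (fun x => Re (CI (F x) 0 (2*PI))) (fun x => Re (CI (dF x) 0 (2*PI))) d Hdp).
    + intros x Hx. exact (proj1 (D2 x Hx)).
    + intros x Hx. rewrite (D3 x Hx). apply re_scal_l.
  - apply (euler_linear (fun x => Im (CI (F x) 0 (2*PI))) (fun x => Im (CI (dF x) 0 (2*PI))) d Hdp).
    + intros x Hx. exact (proj2 (D2 x Hx)).
    + intros x Hx. rewrite (D3 x Hx). apply im_scal_l. }
assert (H1 : is_CI (dF 1) 0 (2 * PI) (CI (dF 1) 0 (2 * PI))) by (apply CI_correct; intros t _; apply pdF; lra).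
rewrite (is_CI_unique _ _ _ (CI (dF 1) 0 (2 * PI))).
- rewrite E. apply is_CI_unique. apply (is_CI_ext (fun t => f a * ker r a t)%C).
  + intros t _. unfold dF, gam. do 2 f_equal. ring.
  + apply is_CI_scal, CI_correct. intros t _. apply pcont_ker; auto.
- revert H1. apply is_CI_ext. intros t _. unfold dF, gam. do 2 f_equal. ring.
Qed.

Lemma mean_value f R r : (forall w, Cmod w < R -> exists l, Cd f w l) -> 0 < r < R ->
  is_CI (fun t => f (ec r t)) 0 (2 * PI) (RtoC (2 * PI) * f 0)%C.
Proof.
intros Hd Hr.
assert (Hc : dcont R f) by (intros w Hw; destruct (Hd w Hw) as [l Hl]; exact (Cd_cont _ _ _ Hl)).
assert (Z : Cmod 0 < r) by (rewrite Cmod_0; lra).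
assert (K1 : forall t, ker r 0 t = 1).
{ intros t. unfold ker. pose proof (ec_ne r 0 t Z). replace (ec r t - 0)%C with (ec r t) in * by ring. now apply Cinv_r. }
assert (K : CI (ker r 0) 0 (2 * PI) = RtoC (2 * PI)).
{ apply is_CI_unique. apply (is_CI_ext (fun _ => RtoC 1)); [intros; now rewrite K1|].
  replace (RtoC (2 * PI)) with (RtoC (2 * PI - 0) * 1)%C by (rewrite RtoC_minus; ring). apply is_CI_const. }
pose proof (cauchy_formula f R r 0 Hd (proj2 Hr) Z) as H. rewrite K in H.
replace (RtoC (2 * PI) * f 0)%C with (f 0 * RtoC (2 * PI))%C by ring. rewrite <- H.
apply (is_CI_ext (fun t => f (ec r t) * ker r 0 t)%C); [intros t _; rewrite K1; ring|].
apply CI_correct. intros t _. apply pcont_mult; [|apply pcont_ker; auto].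
apply (Cc_pcont f (ec r)); [apply pcont_ec|]. apply Hc. rewrite Cmod_ec; lra.
Qed.

(** On the circle the conjugate of w is r^2 / w. So the conjugate of the Cauchy kernel is an
    analytic function of w, whose pole is the reflection of [a] and lies outside the circle. *)
Lemma ker_conj r a t : Cmod a < r ->
  ker r a t = Cconj (RtoC (r * r) * / (RtoC (r * r) - Cconj a * ec r t))%C.
Proof.
intros Ha. pose proof (Cmod_ge_0 a). pose proof (ec_ne r a t Ha) as N.
assert (E : (ec r t * Cconj (ec r t))%C = RtoC (r * r)).
{ rewrite <- Cmod2_conj, Cmod_ec by lra. f_equal. ring. }
assert (E0 : Cconj (ec r t) <> 0).
{ apply Cmod_gt_0. rewrite Cmod_conj, Cmod_ec; lra. }
assert (F : (RtoC (r * r) - Cconj a * ec r t)%C = (ec r t * Cconj (ec r t - a))%C).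
{ rewrite <- E, Cminus_conj. ring. }
rewrite F. assert (ec r t <> 0) by (apply Cmod_gt_0; rewrite Cmod_ec; lra).
assert (N' : Cconj (ec r t - a) <> 0) by (apply Cmod_gt_0; rewrite Cmod_conj; apply Cmod_gt_0; auto).
rewrite <- E. rewrite Cmult_conj, Cinv_conj, !Cmult_conj, !Cconj_conj by (apply Cmult_neq_0; auto).
unfold ker. field. auto.
Qed.

(** By [ker_conj] the integrand is the conjugate of f(w) r^2 / (r^2 - conj(a) w), which is analytic
    slightly beyond the circle; the mean value property evaluates it at the centre. *)
Lemma conj_side f r a : (forall w, Cmod w < 1 -> exists l, Cd f w l) -> r < 1 -> Cmod a < r ->
  is_CI (fun t => Cconj (f (ec r t)) * ker r a t)%C 0 (2 * PI) (RtoC (2 * PI) * Cconj (f 0))%C.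
Proof.
intros Hd Hr Ha. pose proof (Cmod_ge_0 a) as Pa.
(* Strictly between [r] and the modulus r^2 / |a| of the pole: |a| is replaced by the midpoint of
   |a| and r, which is positive even for a = 0. *)
set (R := Rmin 1 (r * r / (Cmod a + (r - Cmod a) / 2))).
assert (Hden : 0 < Cmod a + (r - Cmod a) / 2) by lra.
assert (HR : r < R).
{ apply Rmin_glb_lt; [lra|]. apply (Rmult_lt_reg_r (Cmod a + (r - Cmod a) / 2)); [lra|].
  unfold Rdiv at 2. rewrite Rmult_assoc, Rinv_l, Rmult_1_r by lra. nra. }
assert (HD : forall w, Cmod w < R -> exists l, Cd (fun w => f w * (RtoC (r * r) * / (RtoC (r * r) + (- Cconj a) * w)))%C w l).
{ intros w Hw. destruct (Hd w) as [l Hl]; [eapply Rlt_le_trans; [apply Hw|apply Rmin_l]|].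
  eexists. apply Cd_mult; [apply Hl|]. apply Cd_mult; [apply Cd_const|].
  apply (Cd_comp (fun u => / u)%C (fun w => RtoC (r * r) + (- Cconj a) * w)%C); [|apply Cd_affine].
  apply Cd_inv. apply Cmod_gt_0.
  pose proof (Cmod_ge_minus (RtoC (r * r) + (- Cconj a) * w) (RtoC (r * r))) as G.
  replace (RtoC (r * r) + (- Cconj a) * w - RtoC (r * r))%C with (- Cconj a * w)%C in G by ring.
  rewrite Cmod_mult, Cmod_opp, Cmod_conj, Cmod_R, Rabs_pos_eq in G by nra.
  assert (X : Cmod w * (Cmod a + (r - Cmod a) / 2) < r * r).
  { assert (Y : Cmod w < r * r / (Cmod a + (r - Cmod a) / 2)) by (eapply Rlt_le_trans; [apply Hw|apply Rmin_r]).
    apply (Rmult_lt_compat_r (Cmod a + (r - Cmod a) / 2)) in Y; [|lra].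
    unfold Rdiv in Y at 2. rewrite Rmult_assoc, Rinv_l, Rmult_1_r in Y; lra. }
  pose proof (Cmod_ge_0 w). nra. }
pose proof (is_CI_conj _ _ _ _ (mean_value _ R r HD ltac:(lra))) as H.
replace (RtoC (2 * PI) * Cconj (f 0))%C with
  (Cconj (RtoC (2 * PI) * (f 0 * (RtoC (r * r) * / (RtoC (r * r) + - Cconj a * 0))))%C).
- revert H. apply is_CI_ext. intros t _.
  rewrite (ker_conj r a t Ha), <- Cmult_conj.
  replace (RtoC (r * r) + - Cconj a * ec r t)%C with (RtoC (r * r) - Cconj a * ec r t)%C by ring. reflexivity.
- replace (RtoC (r * r) * / (RtoC (r * r) + - Cconj a * 0))%C with (RtoC 1).
  + rewrite Cmult_1_r, Cmult_conj. f_equal. apply C_ext; simpl; ring.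
  + replace (RtoC (r * r) + - Cconj a * 0)%C with (RtoC (r * r)) by ring. symmetry. apply Cinv_r.
    apply Cmod_gt_0. rewrite Cmod_R, Rabs_pos_eq; nra.
Qed.

(* Cauchy's formula for [f] together with its conjugate at the reflected point, which contributes
   only [f 0]. *)
Lemma schwarz_formula f r a : (forall w, Cmod w < 1 -> exists l, Cd f w l) -> r < 1 -> Cmod a < r ->
  is_CI (fun t => RtoC (Re (f (ec r t))) * ((ec r t + a) * / (ec r t - a)))%C 0 (2 * PI)
    (RtoC (2 * PI) * (f a - Ci * RtoC (Im (f 0))))%C.
Proof.
intros Hd Hr Ha. pose proof (Cmod_ge_0 a) as Pa.
assert (Hc : dcont 1 f) by (intros w Hw; destruct (Hd w Hw) as [l Hl]; exact (Cd_cont _ _ _ Hl)).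
(* The reflected formula for the constant 1 already gives the total integral of the Cauchy
   kernel. *)
assert (K : CI (ker r a) 0 (2 * PI) = RtoC (2 * PI)).
{ apply is_CI_unique. pose proof (conj_side (fun _ => RtoC 1) r a) as H.
  replace (RtoC (2 * PI)) with (RtoC (2 * PI) * Cconj 1)%C by (apply C_ext; simpl; ring).
  apply (is_CI_ext (fun t => Cconj 1 * ker r a t)%C).
  - intros t _. replace (Cconj 1) with (RtoC 1) by (apply C_ext; simpl; ring). ring.
  - apply H; auto. intros w _. exists (RtoC 0). apply Cd_const. }
assert (pf : forall t, pcont (fun t => f (ec r t)) t).
{ intros t. apply (Cc_pcont f (ec r)); [apply pcont_ec|]. apply Hc. rewrite Cmod_ec; lra. }
assert (A : is_CI (fun t => f (ec r t) * ker r a t)%C 0 (2 * PI) (f a * RtoC (2 * PI))%C).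
{ rewrite <- K, <- (cauchy_formula f 1 r a Hd Hr Ha). apply CI_correct. intros t _.
  apply pcont_mult; [apply pf|apply pcont_ker; auto]. }
pose proof (conj_side f r a Hd Hr Ha) as B.
pose proof (mean_value f 1 r Hd ltac:(lra)) as M.
assert (D : is_CI (fun t => RtoC (Re (f (ec r t)))) 0 (2 * PI) (RtoC (Re (RtoC (2 * PI) * f 0)%C))).
{ split; simpl.
  - apply M.
  - replace 0 with (scal (2 * PI - 0) 0) at 2 by (unfold scal; simpl; unfold mult; simpl; ring).
    apply (is_RInt_const (V := R_NormedModule)). }
pose proof (is_CI_minus _ _ _ _ _ _ (is_CI_plus _ _ _ _ _ _ A B) D) as S.
replace (RtoC (2 * PI) * (f a - Ci * RtoC (Im (f 0))))%C with
  (f a * RtoC (2 * PI) + RtoC (2 * PI) * Cconj (f 0) - RtoC (Re (RtoC (2 * PI) * f 0)%C))%C.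
- revert S. apply is_CI_ext. intros t _.
  assert (E : (f (ec r t) + Cconj (f (ec r t)))%C = (2 * RtoC (Re (f (ec r t))))%C).
  { rewrite re_alt. field. }
  replace (f (ec r t) * ker r a t + Cconj (f (ec r t)) * ker r a t)%C with ((2 * RtoC (Re (f (ec r t)))) * ker r a t)%C by (rewrite <- E; ring).
  unfold ker. field. apply ec_ne; auto.
- rewrite re_scal_l. apply C_ext; simpl; unfold Re, Im; ring.
Qed.

Ltac eq_in_R := match goal with |- @eq _ ?x ?y => change (@eq R x y) end.

(** * Integral representation by a positive functional *)

Lemma lt_div_mult x y k : 0 < k -> x < y / k -> x * k < y.
Proof. intros Hk H. apply (Rmult_lt_compat_r k) in H; auto. unfold Rdiv in H. rewrite (Rmult_assoc y), Rinv_l, Rmult_1_r in H; lra. Qed.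

Definition cbdd (f : R -> R -> C) : Prop :=
  exists B, forall c s, circ c s -> Cmod (f c s) <= B.

Definition JC (J : (R -> R -> R) -> R) (f : R -> R -> C) : C :=
  (J (fun c s => Re (f c s)), J (fun c s => Im (f c s))).

Lemma cbdd_Re f : cbdd f -> bdd (fun c s => Re (f c s)).
Proof. intros [B H]; exists B; intros c s Hc. eapply Rle_trans; [apply re_le_Cmod|auto]. Qed.

Lemma cbdd_Im f : cbdd f -> bdd (fun c s => Im (f c s)).
Proof. intros [B H]; exists B; intros c s Hc. eapply Rle_trans; [apply im_le_Cmod|auto]. Qed.

Lemma cbdd_const a : cbdd (fun _ _ => a).
Proof. exists (Cmod a); intros; lra. Qed.

Lemma cbdd_RtoC f : bdd f -> cbdd (fun c s => RtoC (f c s)).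
Proof. intros [B H]; exists B; intros c s Hc. rewrite Cmod_R. auto. Qed.

Lemma cbdd_plus f g : cbdd f -> cbdd g -> cbdd (fun c s => f c s + g c s)%C.
Proof.
intros [A HA] [B HB]; exists (A + B); intros c s Hc. eapply Rle_trans; [apply Cmod_triangle|].
apply Rplus_le_compat; auto.
Qed.

Lemma cbdd_mult f g : cbdd f -> cbdd g -> cbdd (fun c s => f c s * g c s)%C.
Proof.
intros [A HA] [B HB]; exists (A * B); intros c s Hc. rewrite Cmod_mult.
apply Rmult_le_compat; auto using Cmod_ge_0.
Qed.

Lemma cbdd_ext f g : (forall c s, circ c s -> f c s = g c s) -> cbdd f -> cbdd g.
Proof. intros E [B HB]; exists B; intros c s H; rewrite <- E; auto. Qed.

#[export] Hint Resolve cbdd_const cbdd_RtoC cbdd_plus cbdd_mult cbdd_Re cbdd_Im : bdd.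

Section JC.
Context {J : (R -> R -> R) -> R} (HJ : posfun J).

Lemma JC_ext f g : cbdd f -> cbdd g -> (forall c s, circ c s -> f c s = g c s) -> JC J f = JC J g.
Proof.
intros Hf Hg E. unfold JC. f_equal; apply (pf_ext HJ); auto with bdd; intros; rewrite E; auto.
Qed.

Lemma JC_plus f g : cbdd f -> cbdd g -> JC J (fun c s => f c s + g c s)%C = (JC J f + JC J g)%C.
Proof.
intros Hf Hg. apply C_ext; simpl.
- apply (pf_add _ HJ (fun c s => Re (f c s)) (fun c s => Re (g c s))); auto with bdd.
- apply (pf_add _ HJ (fun c s => Im (f c s)) (fun c s => Im (g c s))); auto with bdd.
Qed.

Lemma JC_scal a f : cbdd f -> JC J (fun c s => a * f c s)%C = (a * JC J f)%C.
Proof.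
intros Hf. apply C_ext; simpl.
- rewrite <- !(pf_scal _ HJ) by auto with bdd. rewrite <- (pf_minus HJ) by auto with bdd. reflexivity.
- rewrite <- !(pf_scal _ HJ) by auto with bdd. rewrite <- (pf_add _ HJ) by auto with bdd. reflexivity.
Qed.

Lemma JC_minus f g : cbdd f -> cbdd g -> JC J (fun c s => f c s - g c s)%C = (JC J f - JC J g)%C.
Proof.
intros Hf Hg. rewrite (JC_ext _ (fun c s => f c s + (-1) * g c s)%C).
- rewrite JC_plus, JC_scal; auto with bdd. ring.
- destruct Hf as [A HA], Hg as [B HB]; exists (A + B); intros c s Hc.
  eapply Rle_trans; [apply Cmod_minus_le|]. apply Rplus_le_compat; auto.
- auto with bdd.
- intros; ring.
Qed.

Lemma JC_RtoC f : bdd f -> JC J (fun c s => RtoC (f c s)) = RtoC (J f).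
Proof.
intros Hf. apply C_ext; simpl; [reflexivity|]. apply (pf_0 HJ).
Qed.

Lemma JC_bound f g : cbdd f -> bdd g -> (forall c s, circ c s -> Cmod (f c s) <= g c s) ->
  Cmod (JC J f) <= 2 * J g.
Proof.
intros Hf Hg H. eapply Rle_trans; [apply Cmod_le_Re_Im|]. simpl.
assert (A : Rabs (J (fun c s => Re (f c s))) <= J g).
{ apply (pf_abs_le HJ); auto with bdd. intros c s Hc. eapply Rle_trans; [apply re_le_Cmod|auto]. }
assert (B : Rabs (J (fun c s => Im (f c s))) <= J g).
{ apply (pf_abs_le HJ); auto with bdd. intros c s Hc. eapply Rle_trans; [apply im_le_Cmod|auto]. }
lra.
Qed.

End JC.

Lemma JC_weight J w f : JC (fun g => J (fun c s => w c s * g c s)) f = JC J (fun c s => RtoC (w c s) * f c s)%C.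
Proof.
unfold JC. f_equal; f_equal; do 2 (apply FunctionalExtensionality.functional_extensionality; intro).
- now rewrite re_scal_l.
- now rewrite im_scal_l.
Qed.

(* The Poisson-type kernel (1 + t z)/(t - z) of the Herglotz representation, with the boundary
   point t = s/c written in homogeneous coordinates on the unit circle. *)
Definition hker (z : C) (c s : R) : C := ((RtoC c + RtoC s * z) / (RtoC s - RtoC c * z))%C.

Definition Rep (g : R) (J : (R -> R -> R) -> R) (h : C -> C) : Prop :=
  forall z, upper z -> h z = (RtoC g + JC J (hker z))%C.

(** The boundary point of the disc that corresponds to t = s/c: (i - t) / (i + t) = (c + i s)^2.
    Squaring identifies (c, s) with (-c, -s), which give the same t. *)
Definition cis2 (c s : R) : C := ((c, s) * (c, s))%C.

Lemma Cmod_circ c s : circ c s -> Cmod (c, s) = 1.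
Proof.
intros H. unfold Cmod. simpl. rewrite !Rmult_1_r. unfold circ in H. rewrite H. apply sqrt_1.
Qed.

Lemma Cmod_cis2 c s : circ c s -> Cmod (cis2 c s) = 1.
Proof. intros H. unfold cis2. rewrite Cmod_mult, (Cmod_circ c s H). ring. Qed.

Definition KK (r : R) (a : C) (c s : R) : C :=
  ((RtoC r * cis2 c s + a) * / (RtoC r * cis2 c s - a))%C.

Lemma KK_den r a c s : circ c s -> Cmod a < r -> r - Cmod a <= Cmod (RtoC r * cis2 c s - a).
Proof.
intros Hc Ha. pose proof (Cmod_ge_0 a).
pose proof (Cmod_le_minus (RtoC r * cis2 c s) (- a)) as H1. rewrite Cmod_opp in H1.
pose proof (Cmod_le_minus (RtoC r * cis2 c s) a) as H2.
rewrite Cmod_mult, Cmod_cis2, Cmod_R, Rabs_pos_eq in H2 by (auto; lra). lra.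
Qed.

Lemma KK_ne r a c s : circ c s -> Cmod a < r -> (RtoC r * cis2 c s - a)%C <> 0.
Proof. intros Hc Ha. apply Cmod_gt_0. pose proof (KK_den r a c s Hc Ha). lra. Qed.

Lemma KK_bdd r a : Cmod a < r -> cbdd (KK r a).
Proof.
intros Ha. pose proof (Cmod_ge_0 a). exists ((r + r) * / (r - Cmod a)). intros c s Hc.
unfold KK. rewrite Cmod_mult, Cmod_inv by now apply KK_ne.
apply Rmult_le_compat; auto using Cmod_ge_0.
- apply Rlt_le, Rinv_0_lt_compat, Cmod_gt_0, KK_ne; auto.
- eapply Rle_trans; [apply Cmod_triangle|]. rewrite Cmod_mult, Cmod_cis2, Cmod_R, Rabs_pos_eq by (auto; lra). lra.
- apply Rinv_le_contravar; [lra|]. now apply KK_den.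
Qed.

(** Uniform over the circle, which is what lets the radius tend to 1 under finitely additive
    functionals. The numerator of the difference is at most 2 (1 - r), and the denominators are at
    least 1 - |a| and half of it. *)
Lemma KK_close r a c s : circ c s -> Cmod a < r -> (1 + Cmod a) / 2 <= r -> r <= 1 ->
  Cmod (KK 1 a c s - KK r a c s) <= 4 * (1 - r) / ((1 - Cmod a) * (1 - Cmod a)).
Proof.
intros Hc Ha Hr Hr1. pose proof (Cmod_ge_0 a).
pose proof (KK_den r a c s Hc Ha) as D1. pose proof (KK_den 1 a c s Hc ltac:(lra)) as D2.
pose proof (KK_ne r a c s Hc Ha) as N1. pose proof (KK_ne 1 a c s Hc ltac:(lra)) as N2.
replace (KK 1 a c s - KK r a c s)%C with
  (2 * a * cis2 c s * RtoC (r - 1) * (/ (RtoC 1 * cis2 c s - a) * / (RtoC r * cis2 c s - a)))%C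
  by (unfold KK; rewrite RtoC_minus; field; split; [exact N1|now rewrite Cmult_1_l in N2]).
rewrite !Cmod_mult, !Cmod_inv, Cmod_cis2, !Cmod_R by auto.
rewrite (Rabs_pos_eq 2), (Rabs_left1 (r - 1)) by lra.
assert (I1 : / Cmod (RtoC 1 * cis2 c s - a) <= / (1 - Cmod a)) by (apply Rinv_le_contravar; lra).
assert (I2 : / Cmod (RtoC r * cis2 c s - a) <= / ((1 - Cmod a) / 2)) by (apply Rinv_le_contravar; lra).
assert (P1 : 0 < / Cmod (RtoC 1 * cis2 c s - a)) by (apply Rinv_0_lt_compat; lra).
assert (P2 : 0 < / Cmod (RtoC r * cis2 c s - a)) by (apply Rinv_0_lt_compat; lra).
replace (4 * (1 - r) / ((1 - Cmod a) * (1 - Cmod a))) with (2 * (1 - r) * (/ (1 - Cmod a) * / ((1 - Cmod a) / 2))) by (field; lra).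
apply Rmult_le_compat.
- repeat apply Rmult_le_pos; lra.
- apply Rmult_le_pos; lra.
- nra.
- apply Rmult_le_compat; lra.
Qed.

Section Disc.
Context (F : C -> C) (HF : forall w, Cmod w < 1 -> exists l, Cd F w l)
  (HP : forall w, Cmod w < 1 -> 0 <= Re (F w)).

Lemma circ_cos_sin t : circ (cos t) (sin t).
Proof. unfold circ. pose proof (sin2_cos2 t) as H. unfold Rsqr in H. lra. Qed.

(** The integral against Re F / (2 pi) makes sense only on integrable functions. An ultrafilter
    refining the filter of Riemann sums extends it to all bounded functions and agrees with it on
    the kernels of the Schwarz formula. *)
Lemma disc_functional r : 0 < r < 1 -> exists J, posfun J /\
  forall a, Cmod a < r -> JC J (KK r a) = (F a - Ci * RtoC (Im (F 0)))%C.
Proof.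
intros Hr.
destruct (ultrafilter_extends _ (Riemann_fine_filter 0 (2 * PI))) as [U [HU UF]].
set (rho := fun t => / (2 * PI) * Re (F (ec r t))).
pose proof PI_RGT_0 as Pi.
assert (Hrho : forall t, 0 <= rho t).
{ intros t. apply Rmult_le_pos; [apply Rlt_le, Rinv_0_lt_compat; lra|]. apply HP. rewrite Cmod_ec; lra. }
(* Half angles, because [cis2] doubles them: [ec r t] is r times [cis2] at the angle t/2. *)
set (Jinv := fun (p : SF_seq) (f : R -> R -> R) => Riemann_sum (fun t => rho t * f (cos (t / 2)) (sin (t / 2))) p).
assert (Hpos : forall p, pointed_subdiv p -> posfun (Jinv p)).
{ intros p Hp; unfold Jinv; constructor.
  - intros f g _ _.
    pose proof (Riemann_sum_plus (V := R_NormedModule) (fun t => rho t * f (cos (t / 2)) (sin (t / 2)))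
      (fun t => rho t * g (cos (t / 2)) (sin (t / 2))) p) as E.
    refine (eq_trans _ E). apply (f_equal (fun k => Riemann_sum k p)).
    apply FunctionalExtensionality.functional_extensionality; intros t. apply Rmult_plus_distr_l.
  - intros a f _.
    pose proof (Riemann_sum_scal (V := R_NormedModule) a (fun t => rho t * f (cos (t / 2)) (sin (t / 2))) p) as E.
    refine (eq_trans _ E). apply (f_equal (fun k => Riemann_sum k p)).
    apply FunctionalExtensionality.functional_extensionality; intros t.
    change (rho t * (a * f (cos (t / 2)) (sin (t / 2))) = a * (rho t * f (cos (t / 2)) (sin (t / 2)))). ring.
  - intros f g _ _ H. apply Riemann_sum_le; auto. intros t _. apply Rmult_le_compat_l; auto. apply H, circ_cos_sin. }
assert (Hlim : forall f l, is_RInt (fun t => rho t * f (cos (t / 2)) (sin (t / 2))) 0 (2 * PI) l ->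
   forall e, 0 < e -> U (fun p => Rabs (Jinv p f - l) < e)).
{ intros f l Hl e He. apply UF.
  pose proof (proj1 (filterlim_locally _ _) Hl (mkposreal e He)) as L.
  revert L. apply filter_imp. intros p Hp.
  assert (S : sign (2 * PI - 0) = 1) by (apply sign_eq_1; lra).
  change (Rabs (sign (2 * PI - 0) * Jinv p f - l) < e) in Hp.
  rewrite S, Rmult_1_l in Hp. exact Hp. }
assert (HK : forall a, Cmod a < r ->
   is_RInt (fun t => rho t * Re (KK r a (cos (t/2)) (sin (t/2)))) 0 (2 * PI) (Re (F a - Ci * RtoC (Im (F 0)))%C) /\
   is_RInt (fun t => rho t * Im (KK r a (cos (t/2)) (sin (t/2)))) 0 (2 * PI) (Im (F a - Ci * RtoC (Im (F 0)))%C)).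
{ intros a Ha.
  pose proof (schwarz_formula F r a HF (proj2 Hr) Ha) as S.
  apply (is_CI_scal (RtoC (/ (2 * PI)))) in S.
  replace (RtoC (/ (2 * PI)) * (RtoC (2 * PI) * (F a - Ci * RtoC (Im (F 0)))))%C with (F a - Ci * RtoC (Im (F 0)))%C in S.
  2:{ rewrite Cmult_assoc, <- RtoC_mult, Rinv_l by lra. ring. }
  assert (E : forall t, ec r t = (RtoC r * cis2 (cos (t/2)) (sin (t/2)))%C).
  { intros t. unfold ec, cis2. f_equal. apply C_ext; simpl.
    - replace t with (2 * (t / 2)) at 1 by field. rewrite cos_2a. reflexivity.
    - replace t with (2 * (t / 2)) at 1 by field. rewrite sin_2a. ring. }
  destruct S as [S1 S2]. split.
  - revert S1. apply is_RInt_ext. intros t _. rewrite !re_scal_l. unfold rho, KK. rewrite <- E. eq_in_R. ring.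
  - revert S2. apply is_RInt_ext. intros t _. rewrite !im_scal_l. unfold rho, KK. rewrite <- E. eq_in_R. ring. }
(* The kernel at a = 0 is the constant 1, so the Schwarz formula there computes the total mass Re (F
   0). *)
assert (H1 : U (fun p => posfun (Jinv p) /\ Jinv p (fun _ _ => 1) <= Re (F 0) + 1)).
{ assert (Z : Cmod 0 < r) by (rewrite Cmod_0; lra).
  destruct (HK 0 Z) as [A _].
  assert (B : is_RInt (fun t => rho t * (fun _ _ => 1) (cos (t/2)) (sin (t/2))) 0 (2 * PI) (Re (F 0))).
  { replace (Re (F 0)) with (Re (F 0 - Ci * RtoC (Im (F 0)))%C) by (rewrite Re_minus, Re_mult; simpl; ring).
    revert A. apply is_RInt_ext. intros t _. f_equal. pose proof (KK_ne r 0 (cos (t/2)) (sin (t/2)) (circ_cos_sin _) Z) as N.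
    unfold KK. replace (RtoC r * cis2 (cos (t / 2)) (sin (t / 2)) + 0)%C with (RtoC r * cis2 (cos (t / 2)) (sin (t / 2)) - 0)%C by ring.
    rewrite Cinv_r; auto. }
  apply (uf_imp _ HU (fun p => pointed_subdiv p /\ Rabs (Jinv p (fun _ _ => 1) - Re (F 0)) < 1)).
  - intros p [P Q]. split; [auto|]. apply Rabs_def2 in Q. lra.
  - apply (uf_and _ HU); [|apply (Hlim (fun _ _ => 1)); auto; lra].
    apply UF. exists (mkposreal 1 Rlt_0_1). intros p _ Q. exact (proj1 Q). }
destruct (ulim_posfun U Jinv _ HU H1) as [PJ SJ].
exists (fun f => ulim U (fun t => Jinv t f)). split; [exact PJ|].
intros a Ha. destruct (HK a Ha) as [A B].
apply C_ext.
- exact (ulim_unique U _ _ HU (Hlim (fun c s => Re (KK r a c s)) _ A)).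
- exact (ulim_unique U _ _ HU (Hlim (fun c s => Im (KK r a c s)) _ B)).
Qed.

(** The functionals for all radii have the same mass Re (F 0), so they have a limit along an
    ultrafilter, and [KK_close] replaces the kernels of radius [r n] by that of radius 1. *)
Lemma boundary_functional : exists J, posfun J /\
  forall a, Cmod a < 1 -> JC J (KK 1 a) = (F a - Ci * RtoC (Im (F 0)))%C.
Proof.
set (r := fun n : nat => 1 - / (INR n + 2)).
assert (Hr : forall n, 0 < r n < 1).
{ intros n. unfold r. pose proof (pos_INR n).
  assert (0 < / (INR n + 2)) by (apply Rinv_0_lt_compat; lra).
  assert (/ (INR n + 2) <= / 2) by (apply Rinv_le_contravar; lra). lra. }
assert (HJ : exists Jn : nat -> (R -> R -> R) -> R, forall n, posfun (Jn n) /\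
  forall a, Cmod a < r n -> JC (Jn n) (KK (r n) a) = (F a - Ci * RtoC (Im (F 0)))%C).
{ exists (fun n => ClassicalEpsilon.epsilon (inhabits (fun _ => 0)) (fun J => posfun J /\
    forall a, Cmod a < r n -> JC J (KK (r n) a) = (F a - Ci * RtoC (Im (F 0)))%C)).
  intros n. apply ClassicalEpsilon.epsilon_spec. apply disc_functional, Hr. }
destruct HJ as [Jn HJn].
assert (M1 : forall n, Jn n (fun _ _ => 1) = Re (F 0)).
{ intros n. destruct (HJn n) as [P Q].
  assert (Z : Cmod 0 < r n) by (rewrite Cmod_0; apply Hr).
  specialize (Q 0 Z). apply (f_equal Re) in Q.
  rewrite Re_minus, Re_mult in Q. replace (Re Ci) with 0 in Q by reflexivity.
  rewrite re_RtoC, im_RtoC in Q.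
  transitivity (Re (JC (Jn n) (KK (r n) 0))); [|rewrite Q; ring].
  apply (pf_ext P (fun _ _ => 1) (fun c s => Re (KK (r n) 0 c s))); auto with bdd.
  - apply cbdd_Re, KK_bdd; auto.
  - intros c s Hc. pose proof (KK_ne (r n) 0 c s Hc Z) as N. unfold KK.
    replace (RtoC (r n) * cis2 c s + 0)%C with (RtoC (r n) * cis2 c s - 0)%C by ring.
    rewrite Cinv_r; auto. }
destruct (ultrafilter_extends _ eventually_filter) as [U [HU UF]].
destruct (ulim_posfun U Jn (Re (F 0)) HU) as [PJ SJ].
{ apply UF. exists 0%nat. intros n _. split; [apply HJn|]. rewrite M1; lra. }
exists (fun f => ulim U (fun t => Jn t f)). split; [exact PJ|].
intros a Ha. pose proof (Cmod_ge_0 a) as Pa.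
assert (HF0 : 0 <= Re (F 0)) by (apply HP; rewrite Cmod_0; lra).
assert (Lr : forall e, 0 < e -> U (fun n => 1 - r n < e)).
{ intros e He. apply UF.
  destruct (nfloor_ex (/ e)) as [N HN]; [apply Rlt_le, Rinv_0_lt_compat; auto|].
  exists N. intros n Hn. unfold r. apply le_INR in Hn.
  replace (1 - (1 - / (INR n + 2))) with (/ (INR n + 2)) by ring.
  rewrite <- (Rinv_inv e). apply Rinv_lt_contravar; [|lra].
  apply Rmult_lt_0_compat; [apply Rinv_0_lt_compat; auto|]. pose proof (pos_INR n). lra. }
assert (Key : forall e, 0 < e -> U (fun n => Cmod (JC (Jn n) (KK 1 a) - (F a - Ci * RtoC (Im (F 0)))) < e)).
{ intros e He.
  set (D := 4 / ((1 - Cmod a) * (1 - Cmod a))).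
  assert (HD : 0 < D) by (apply Rdiv_lt_0_compat; nra).
  (* The first bound gives the condition on the radius in [KK_close]; the second makes 2 D (1 - r n)
     times the mass smaller than [e]. *)
  set (e1 := Rmin ((1 - Cmod a) / 2) (e / (2 * D * (Re (F 0) + 1)))).
  assert (He1 : 0 < e1) by (apply Rmin_pos; [lra|]; apply Rdiv_lt_0_compat; nra).
  generalize (Lr e1 He1). apply (uf_imp _ HU). intros n Hn.
  assert (H1 : 1 - r n < (1 - Cmod a) / 2) by (eapply Rlt_le_trans; [apply Hn|apply Rmin_l]).
  assert (H2 : 1 - r n < e / (2 * D * (Re (F 0) + 1))) by (eapply Rlt_le_trans; [apply Hn|apply Rmin_r]).
  destruct (HJn n) as [P Q]. specialize (Hr n).
  assert (Han : Cmod a < r n) by lra.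
  rewrite <- (Q a Han).
  rewrite <- (JC_minus P) by (apply KK_bdd; lra).
  assert (B1 : cbdd (fun c s => KK 1 a c s - KK (r n) a c s)%C).
  { exists (4 * (1 - r n) / ((1 - Cmod a) * (1 - Cmod a))). intros c s Hc. apply KK_close; auto; lra. }
  eapply Rle_lt_trans; [apply (JC_bound P _ (fun _ _ => 4 * (1 - r n) / ((1 - Cmod a) * (1 - Cmod a)))); auto with bdd|].
  { intros c s Hc. apply KK_close; auto; lra. }
  rewrite (pf_const P), M1.
  replace (4 * (1 - r n) / ((1 - Cmod a) * (1 - Cmod a))) with (D * (1 - r n)) by (unfold D; field; lra).
  apply lt_div_mult in H2; nra. }
apply C_ext.
- refine (ulim_unique U _ _ HU _). intros e He. generalize (Key e He). apply (uf_imp _ HU). intros n Hn.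
  eapply Rle_lt_trans; [|apply Hn]. eapply Rle_trans; [|apply re_le_Cmod]. apply Req_le. reflexivity.
- refine (ulim_unique U _ _ HU _). intros e He. generalize (Key e He). apply (uf_imp _ HU). intros n Hn.
  eapply Rle_lt_trans; [|apply Hn]. eapply Rle_trans; [|apply im_le_Cmod]. apply Req_le. reflexivity.
Qed.

End Disc.

Lemma hker_den_ne z c s : upper z -> circ c s -> (RtoC s - RtoC c * z)%C <> 0.
Proof.
intros Hz Hc E. unfold upper in Hz. unfold circ in Hc.
assert (E1 := f_equal Re E). assert (E2 := f_equal Im E). simpl in E1, E2. unfold Im in Hz.
assert (c = 0) by nra. subst c. assert (s = 0) by nra. subst. lra.
Qed.

(** The Cayley map [phi] carries the disc to the half-plane, -i h(phi) has nonnegative real part,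
    and the Schwarz kernel becomes -i [hker]. The usual linear term has no separate place: at c = 0
    the kernel equals z. *)
Lemma herglotz_rep h : Herglotz h -> exists g J, posfun J /\ Rep g J h.
Proof.
intros [Ha Hp].
set (phi := fun w : C => (Ci * ((1 + (RtoC (-1)) * w) * / (1 + 1 * w)))%C).
set (F := fun w => (- Ci * h (phi w))%C).
assert (Nz : forall w, Cmod w < 1 -> (1 + 1 * w)%C <> 0).
{ intros w Hw. apply Cmod_gt_0. pose proof (Cmod_ge_minus (1 + 1 * w) 1) as G.
  replace (1 + 1 * w - 1)%C with w in G by ring. rewrite Cmod_1 in G. lra. }
assert (Up : forall w, Cmod w < 1 -> upper (phi w)).
{ intros w Hw. pose proof (Nz w Hw) as N.
  assert (E : phi w = (Ci * ((1 - w) * Cconj (1 + w)) * RtoC (/ (Cmod (1 + w) ^ 2)))%C).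
  { assert (N' : (1 + w)%C <> 0) by (replace (1 + w)%C with (1 + 1 * w)%C by ring; auto).
    rewrite RtoC_inv by (apply pow_nonzero, Rgt_not_eq, Cmod_gt_0; auto).
    rewrite Cmod2_conj. unfold phi. field. split; auto.
    apply Cmod_gt_0. rewrite Cmod_conj. apply Cmod_gt_0; auto. }
  unfold upper. rewrite E, im_scal_r. apply Rmult_lt_0_compat.
  - pose proof (Cmod2_alt w). pose proof (Cmod_ge_0 w).
    assert (Cmod w ^ 2 < 1) by (simpl; nra). simpl. unfold Re, Im in H. simpl in H, H1. nra.
  - apply Rinv_0_lt_compat, pow_lt, Cmod_gt_0. replace (1 + w)%C with (1 + 1 * w)%C by ring; auto. }
assert (HF : forall w, Cmod w < 1 -> exists l, Cd F w l).
{ intros w Hw. destruct (ex_derive_Cd h (phi w) (Ha _ (Up w Hw))) as [l Hl].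
  eexists. apply Cd_mult; [apply Cd_const|]. apply Cd_comp; [exact Hl|].
  apply Cd_mult; [apply Cd_const|]. apply Cd_mult; [apply Cd_affine|].
  apply (Cd_comp (fun u => / u)%C (fun w => 1 + 1 * w)%C); [apply Cd_inv; auto|apply Cd_affine]. }
assert (HP : forall w, Cmod w < 1 -> 0 <= Re (F w)).
{ intros w Hw. specialize (Hp _ (Up w Hw)). unfold F. simpl. unfold Im in Hp. lra. }
destruct (boundary_functional F HF HP) as [J [PJ RJ]].
(* As [phi] sends 0 to i, this constant is the real part of h(i). *)
exists (- Im (F 0)), J. split; [exact PJ|].
intros z Hz.
assert (Nzi : (Ci + z)%C <> 0).
{ intros E. apply (f_equal Im) in E. simpl in E. unfold upper, Im in Hz. lra. }
set (w := ((Ci - z) / (Ci + z))%C).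
assert (Hw : Cmod w < 1).
{ unfold w. rewrite Cmod_div by auto. assert (0 < Cmod (Ci + z)) by now apply Cmod_gt_0.
  apply (Rmult_lt_reg_r (Cmod (Ci + z))); auto. unfold Rdiv. rewrite Rmult_assoc, Rinv_l, Rmult_1_r, Rmult_1_l by lra.
  apply Rsqr_incrst_0; try apply Cmod_ge_0. rewrite !Rsqr_pow2, !Cmod2_alt. simpl. unfold upper, Im in Hz. nra. }
assert (Ephi : phi w = z).
{ pose proof (Nz w Hw) as N. unfold phi.
  assert (E1 : (1 + 1 * w)%C = (2 * Ci / (Ci + z))%C) by (unfold w; field; auto).
  rewrite E1. unfold w. assert (Ci <> 0) by apply Ci_nz.
  assert (N2 : RtoC 2 <> 0) by (intros X; apply RtoC_inj in X; lra).
  field. repeat split; auto. }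
specialize (RJ w Hw).
assert (Ekk : forall c s, circ c s -> KK 1 w c s = (- Ci * hker z c s)%C).
{ intros c s Hc. pose proof (hker_den_ne z c s Hz Hc) as N1. pose proof (KK_ne 1 w c s Hc Hw) as N2.
  assert (F1 : (cis2 c s * (Ci + z) + (Ci - z))%C = (2 * Ci * (c, s) * (RtoC c + RtoC s * z))%C).
  { replace (Ci - z)%C with (RtoC (c * c + s * s) * (Ci - z))%C by (rewrite Hc; ring).
    apply C_ext; simpl; ring. }
  assert (F2 : (cis2 c s * (Ci + z) - (Ci - z))%C = (- (2) * (c, s) * (RtoC s - RtoC c * z))%C).
  { replace (Ci - z)%C with (RtoC (c * c + s * s) * (Ci - z))%C by (rewrite Hc; ring).
    apply C_ext; simpl; ring. }
  assert (D1 : (RtoC 1 * cis2 c s + w)%C = (2 * Ci * (c, s) * (RtoC c + RtoC s * z) / (Ci + z))%C).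
  { rewrite <- F1. unfold w. field; auto. }
  assert (D2 : (RtoC 1 * cis2 c s - w)%C = (- (2) * (c, s) * (RtoC s - RtoC c * z) / (Ci + z))%C).
  { rewrite <- F2. unfold w. field; auto. }
  assert (Nu : (c, s) <> RtoC 0) by (apply Cmod_gt_0; rewrite Cmod_circ; auto; lra).
  assert (N3 : RtoC 2 <> 0) by (intros X; apply RtoC_inj in X; lra).
  unfold KK. rewrite D1, D2. unfold hker. field. repeat split; auto. }
assert (EK : JC J (KK 1 w) = (- Ci * JC J (hker z))%C).
{ assert (Bk : cbdd (hker z)).
  { apply (cbdd_ext (fun c s => Ci * KK 1 w c s)%C).
    - intros c s Hc. rewrite Ekk by auto.
      replace (Ci * (- Ci * hker z c s))%C with (- (Ci * Ci) * hker z c s)%C by ring.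
      replace (Ci * Ci)%C with (RtoC (-1)) by (apply C_ext; simpl; ring). ring.
    - apply cbdd_mult; [apply cbdd_const|apply KK_bdd; auto]. }
  rewrite <- (JC_scal PJ) by auto. apply (JC_ext PJ); [apply KK_bdd; auto|auto with bdd|exact Ekk]. }
rewrite EK in RJ. unfold F at 1 in RJ. rewrite Ephi in RJ.
assert (E : h z = (Ci * (- Ci * JC J (hker z) + Ci * RtoC (Im (F 0))))%C).
{ rewrite RJ. replace (Ci * (- Ci * h z - Ci * RtoC (Im (F 0)) + Ci * RtoC (Im (F 0))))%C with (- (Ci * Ci) * h z)%C by ring.
  replace (Ci * Ci)%C with (RtoC (-1)) by (apply C_ext; simpl; ring). ring. }
rewrite E. replace (Ci * (- Ci * JC J (hker z) + Ci * RtoC (Im (F 0))))%C with (Ci * Ci * (RtoC (Im (F 0)) - JC J (hker z)))%C by ring.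
replace (Ci * Ci)%C with (RtoC (-1)) by (apply C_ext; simpl; ring). rewrite RtoC_opp. ring.
Qed.

(** * Point masses and reduction of order at the origin *)

Definition lim0 (P : R -> R) (l : R) : Prop :=
  forall eps, 0 < eps -> exists d, 0 < d /\ forall e, 0 < e < d -> Rabs (P e - l) < eps.

Lemma lim0_ext P Q l : (forall e, 0 < e -> P e = Q e) -> lim0 P l -> lim0 Q l.
Proof.
intros E H eps He. destruct (H eps He) as [d [Hd K]]. exists d; split; auto.
intros e Hee. rewrite <- E by lra. auto.
Qed.

Lemma lim0_const a : lim0 (fun _ => a) a.
Proof. intros eps He. exists 1; split; [lra|]. intros. replace (a - a) with 0 by ring. rewrite Rabs_R0; lra. Qed.

Lemma lim0_plus P Q l m : lim0 P l -> lim0 Q m -> lim0 (fun e => P e + Q e) (l + m).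
Proof.
intros H K eps He. destruct (H (eps/2) ltac:(lra)) as [d [Hd Hk]]. destruct (K (eps/2) ltac:(lra)) as [d' [Hd' Hk']].
exists (Rmin d d'); split; [now apply Rmin_pos|]. intros e Hee.
pose proof (Rmin_l d d'); pose proof (Rmin_r d d').
specialize (Hk e ltac:(lra)); specialize (Hk' e ltac:(lra)).
replace (P e + Q e - (l + m)) with ((P e - l) + (Q e - m)) by ring.
eapply Rle_lt_trans; [apply Rabs_triang|]. lra.
Qed.

Lemma lim0_scal a P l : lim0 P l -> lim0 (fun e => a * P e) (a * l).
Proof.
intros H eps He. pose proof (Rabs_pos a).
destruct (H (eps / (Rabs a + 1)) ltac:(apply Rdiv_lt_0_compat; lra)) as [d [Hd K]].
exists d; split; auto. intros e Hee. specialize (K e Hee).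
apply lt_div_mult in K; [|lra]. rewrite <- Rmult_minus_distr_l, Rabs_mult.
pose proof (Rabs_pos (P e - l)). nra.
Qed.

Lemma lim0_minus P Q l m : lim0 P l -> lim0 Q m -> lim0 (fun e => P e - Q e) (l - m).
Proof.
intros H K. replace (l - m) with (l + (-1) * m) by ring.
apply (lim0_ext (fun e => P e + (-1) * Q e)); [intros; ring|].
apply lim0_plus, lim0_scal; auto.
Qed.

Lemma lim0_unique P l m : lim0 P l -> lim0 P m -> l = m.
Proof.
intros H K. apply Rminus_diag_uniq, Rabs_eq_0, Rle_antisym; [|apply Rabs_pos].
apply Rnot_lt_le; intros Hp. set (x := Rabs (l - m)) in *.
destruct (H (x/2) ltac:(lra)) as [d [Hd Hk]]. destruct (K (x/2) ltac:(lra)) as [d' [Hd' Hk']].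
assert (D : 0 < Rmin d d') by now apply Rmin_pos.
pose proof (Rmin_l d d'); pose proof (Rmin_r d d').
specialize (Hk (Rmin d d' / 2) ltac:(lra)); specialize (Hk' (Rmin d d' / 2) ltac:(lra)).
assert (x <= Rabs (P (Rmin d d' / 2) - l) + Rabs (P (Rmin d d' / 2) - m)); [|lra].
unfold x. replace (l - m) with (- (P (Rmin d d' / 2) - l) + (P (Rmin d d' / 2) - m)) by ring.
eapply Rle_trans; [apply Rabs_triang|]. rewrite Rabs_Ropp; lra.
Qed.

Lemma lim0_bound P l K : 0 <= K -> (forall e, 0 < e < 1 -> Rabs (P e - l) <= K * e) -> lim0 P l.
Proof.
intros HK H eps He. exists (Rmin 1 (eps / (K + 1))); split.
{ apply Rmin_pos; [lra|apply Rdiv_lt_0_compat; lra]. }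
intros e [He0 He1]. pose proof (Rmin_l 1 (eps / (K + 1))); pose proof (Rmin_r 1 (eps / (K + 1))).
assert (X : e < eps / (K + 1)) by lra. apply lt_div_mult in X; [|lra].
eapply Rle_lt_trans; [apply H; lra|]. nra.
Qed.

Lemma lim0_le P l B : (forall e, 0 < e -> P e <= B) -> lim0 P l -> l <= B.
Proof.
intros H K. apply Rnot_lt_le; intros Hlt. destruct (K (l - B) ltac:(lra)) as [d [Hd Kd]].
specialize (Kd (d/2) ltac:(lra)). specialize (H (d/2) ltac:(lra)). apply Rabs_def2 in Kd. lra.
Qed.

Lemma mono_lim0 (P : R -> R) m : (forall e f, 0 < e <= f -> P e <= P f) -> (forall e, 0 < e -> m <= P e) ->
  exists l, m <= l /\ lim0 P l /\ forall e, 0 < e -> l <= P e.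
Proof.
intros Hm Hb.
destruct (completeness (fun x => exists e, 0 < e /\ x = - P e)) as [l [Hu Hl]].
- exists (- m). intros x [e [He ->]]. specialize (Hb e He). lra.
- exists (- P 1), 1. split; [lra|reflexivity].
- exists (- l). assert (Hle : forall e, 0 < e -> - l <= P e).
  { intros e He. specialize (Hu (- P e) (ex_intro _ e (conj He eq_refl))). lra. }
  repeat split; auto.
  + assert (l <= - m); [|lra]. apply Hl. intros x [e [He ->]]. specialize (Hb e He). lra.
  + intros eps Heps.
    assert (Hex : exists e, 0 < e /\ P e < - l + eps).
    { destruct (Classical_Prop.classic (exists e, 0 < e /\ P e < - l + eps)) as [E|N]; [exact E|].
      exfalso. assert (l <= l - eps); [|lra]. apply Hl. intros x [e [He ->]].
      apply Rnot_lt_le; intros Hlt. apply N. exists e; split; [auto|lra]. }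
    destruct Hex as [e0 [He0 K0]]. exists e0; split; auto. intros e Hee.
    specialize (Hm e e0 ltac:(lra)). specialize (Hle e ltac:(lra)). apply Rabs_def1; lra.
Qed.

Lemma antimono_lim0 (P : R -> R) M : (forall e f, 0 < e <= f -> P f <= P e) -> (forall e, 0 < e -> P e <= M) ->
  exists l, l <= M /\ lim0 P l /\ forall e, 0 < e -> P e <= l.
Proof.
intros Hm Hb. destruct (mono_lim0 (fun e => - P e) (- M)) as [l [H1 [H2 H3]]].
- intros e f H; specialize (Hm e f H); lra.
- intros e H; specialize (Hb e H); lra.
- exists (- l). repeat split; [lra| |].
  + apply (lim0_ext (fun e => (-1) * (- P e))); [intros; ring|]. replace (- l) with ((-1) * l) by ring. now apply lim0_scal.
  + intros e H; specialize (H3 e H); lra.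
Qed.

(** One ultrafilter is fixed globally so that [J1] is a function of [J] alone. By [lim0_ulim] the
    choice does not affect a value that is a true limit. *)
Definition nat_ultra : (nat -> Prop) -> Prop :=
  ClassicalEpsilon.epsilon (inhabits (fun _ => True))
    (fun U => ultrafilter U /\ forall A, eventually A -> U A).

Lemma nat_ultra_spec : ultrafilter nat_ultra /\ forall A, eventually A -> nat_ultra A.
Proof.
unfold nat_ultra. apply (ClassicalEpsilon.epsilon_spec (inhabits (fun _ => True)) (fun U => ultrafilter U /\ forall A, eventually A -> U A)).
apply ultrafilter_extends, eventually_filter.
Qed.

Lemma lim0_ulim P l : lim0 P l -> ulim nat_ultra (fun n => P (/ (INR n + 1))) = l.
Proof.
intros H. destruct nat_ultra_spec as [HU UF]. apply ulim_unique; auto. intros eps He.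
destruct (H eps He) as [d [Hd K]]. apply UF.
destruct (nfloor_ex (/ d)) as [N HN]; [apply Rlt_le, Rinv_0_lt_compat; auto|].
exists N. intros n Hn. apply le_INR in Hn. pose proof (pos_INR N). apply K. split.
- apply Rinv_0_lt_compat; lra.
- rewrite <- (Rinv_inv d). apply Rinv_lt_contravar; [|lra].
  apply Rmult_lt_0_compat; [apply Rinv_0_lt_compat; auto|lra].
Qed.

(* Decreases to the indicator of [s = 0] as [e] decreases to 0. *)
Definition u (e c s : R) : R := c * c * (e * e) / (s * s + c * c * (e * e)).

Lemma den_low e c s : circ c s -> Rmin 1 (e * e) <= s * s + c * c * (e * e).
Proof.
unfold circ; intros H. pose proof (Rmin_l 1 (e * e)). pose proof (Rmin_r 1 (e * e)). nra.
Qed.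

Lemma den_pos e c s : 0 < e -> circ c s -> 0 < s * s + c * c * (e * e).
Proof.
intros He H. eapply Rlt_le_trans; [|apply den_low; auto]. apply Rmin_pos; [lra|nra].
Qed.

Lemma bdd_over_den f e : 0 < e -> bdd f -> bdd (fun c s => f c s / (s * s + c * c * (e * e))).
Proof.
intros He Hf. apply (bdd_div f _ (Rmin 1 (e * e))); auto; [apply Rmin_pos; [lra|nra]|].
intros; now apply den_low.
Qed.

Lemma u_bdd e : 0 < e -> bdd (u e).
Proof. intros He. apply bdd_over_den; auto 6 with bdd. Qed.

Lemma u_01 e c s : 0 < e -> circ c s -> 0 <= u e c s <= 1.
Proof.
intros He H. pose proof (den_pos e c s He H). unfold u. split.
- apply Rdiv_le_0_compat; nra.
- apply (Rmult_le_reg_r (s * s + c * c * (e * e))); auto. unfold Rdiv. rewrite Rmult_assoc, Rinv_l; nra.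
Qed.

Lemma u_compl e c s : 0 < e -> circ c s -> 1 - u e c s = s * s / (s * s + c * c * (e * e)).
Proof. intros He H. pose proof (den_pos e c s He H). unfold u. field. lra. Qed.

Lemma u_mono e f c s : 0 < e <= f -> circ c s -> u e c s <= u f c s.
Proof.
intros He H. pose proof (den_pos e c s ltac:(lra) H). pose proof (den_pos f c s ltac:(lra) H).
unfold u. apply (Rmult_le_reg_r ((s * s + c * c * (e * e)) * (s * s + c * c * (f * f)))); [nra|].
replace (c * c * (e * e) / (s * s + c * c * (e * e)) * ((s * s + c * c * (e * e)) * (s * s + c * c * (f * f))))
  with (c * c * (e * e) * (s * s + c * c * (f * f))) by (field; lra).
replace (c * c * (f * f) / (s * s + c * c * (f * f)) * ((s * s + c * c * (e * e)) * (s * s + c * c * (f * f))))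
  with (c * c * (f * f) * (s * s + c * c * (e * e))) by (field; lra).
assert (e * e <= f * f) by nra. assert (0 <= c * c * (s * s)) by nra. nra.
Qed.

(** Point mass at t = 0 as seen by continuous functions. The value of [J] on the indicator of s = 0
    may be smaller, because mass may sit infinitely close to s = 0. *)
Definition atom (J : (R -> R -> R) -> R) (al : R) : Prop :=
  lim0 (fun e => J (u e)) al /\ forall e, 0 < e -> al <= J (u e).

Lemma atom_ex J : posfun J -> exists al, 0 <= al /\ atom J al.
Proof.
intros HJ. destruct (mono_lim0 (fun e => J (u e)) 0) as [l [H0 [H1 H2]]].
- intros e f H. apply (pf_mono _ HJ); try (apply u_bdd; lra). intros; now apply u_mono.
- intros e He. apply (pf_pos HJ); [now apply u_bdd|]. intros; now apply u_01.
- exists l; split; auto. split; auto.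
Qed.

(* Increases to [s^-2] as [d] decreases to 0, but vanishes at [s = 0], so that a point mass there
   is not seen. *)
Definition wd (d c s : R) : R := s * s / ((s * s + d * d) * (s * s + d * d)).

Lemma wd_pos d c s : 0 < d -> 0 <= wd d c s.
Proof. intros Hd. assert (0 < s * s + d * d) by nra. apply Rdiv_le_0_compat; nra. Qed.

Lemma wd_bdd d : 0 < d -> bdd (wd d).
Proof.
intros Hd. assert (P : 0 < d * d) by nra. apply (bdd_div _ _ ((d * d) * (d * d))); [auto with bdd|nra|].
intros c s _. apply Rmult_le_compat; nra.
Qed.

Lemma wd_s2 d c s : 0 < d -> 0 <= 1 - s * s * wd d c s <= 2 * (d * d) / (s * s + d * d).
Proof.
intros Hd. assert (P : 0 < s * s + d * d) by nra.
assert (E : 1 - s * s * wd d c s = (d * d) * (2 * (s * s) + d * d) / ((s * s + d * d) * (s * s + d * d))).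
{ unfold wd. field. lra. }
assert (0 < d * d) by nra. rewrite E. split; [apply Rdiv_le_0_compat; nra|].
apply (Rmult_le_reg_r ((s * s + d * d) * (s * s + d * d))); [nra|].
replace (d * d * (2 * (s * s) + d * d) / ((s * s + d * d) * (s * s + d * d)) * ((s * s + d * d) * (s * s + d * d)))
  with (d * d * (2 * (s * s) + d * d)) by (field; lra).
replace (2 * (d * d) / (s * s + d * d) * ((s * s + d * d) * (s * s + d * d))) with (2 * (d * d) * (s * s + d * d)) by (field; lra).
nra.
Qed.

Lemma wd_anti d e c s : 0 < d <= e -> wd e c s <= wd d c s.
Proof.
intros H. assert (0 < s * s + d * d) by nra.
apply Rmult_le_compat_l; [nra|]. apply Rinv_le_contravar; [nra|].
apply Rmult_le_compat; nra.
Qed.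

(** Integrability of t^-2 off 0. The measure is mu = c^-2 J, so t^-2 mu is s^-2 J, and [wd]
    increases to s^-2 off s = 0. *)
Definition Good1 (J : (R -> R -> R) -> R) : Prop := exists B, forall d, 0 < d -> J (wd d) <= B.

(** The functional s^-2 J without the point mass at s = 0; the limit along [nat_ultra] stands in for
    monotone convergence and keeps linearity. *)
Definition J1 (J : (R -> R -> R) -> R) (f : R -> R -> R) : R :=
  ulim nat_ultra (fun n => J (fun c s => wd (/ (INR n + 1)) c s * f c s)).

Section Reduction.
Context {J : (R -> R -> R) -> R} (HJ : posfun J) (G : Good1 J).

Lemma J1_posfun : posfun (J1 J).
Proof.
destruct G as [B HB]. destruct nat_ultra_spec as [HU UF].
apply (ulim_posfun nat_ultra (fun n f => J (fun c s => wd (/ (INR n + 1)) c s * f c s)) B HU).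
apply UF. exists 0%nat. intros n _.
assert (Hd : 0 < / (INR n + 1)) by (apply Rinv_0_lt_compat; pose proof (pos_INR n); lra).
split.
- apply (pf_weight HJ); [now apply wd_bdd|]. intros; now apply wd_pos.
- rewrite (pf_ext HJ _ (wd (/ (INR n + 1)))); auto using wd_bdd with bdd. intros; ring.
Qed.

Lemma J1_lim f l : lim0 (fun d => J (fun c s => wd d c s * f c s)) l -> J1 J f = l.
Proof. intros H. exact (lim0_ulim _ _ H). Qed.

(** Linear vanishing at s = 0 hides the point mass and makes the convergence uniform: the error (1 -
    s^2 wd) f is at most K d, because 2 d |s| <= s^2 + d^2. *)
Lemma J1_absorb f K : bdd f -> (forall c s, circ c s -> Rabs (f c s) <= K * Rabs s) ->
  J f = J1 J (fun c s => s * s * f c s).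
Proof.
intros Hf HK. symmetry. apply J1_lim.
assert (K0 : 0 <= K).
{ assert (C01 : circ 0 1) by (unfold circ; ring). specialize (HK 0 1 C01).
  rewrite Rabs_R1 in HK. pose proof (Rabs_pos (f 0 1)). lra. }
apply (lim0_bound _ _ (K * J (fun _ _ => 1))); [apply Rmult_le_pos; [auto|apply (pf_1 HJ)]|].
intros d Hd. assert (Bw : bdd (wd d)) by (apply wd_bdd; lra).
rewrite <- (pf_minus HJ) by auto with bdd.
replace (K * J (fun _ _ => 1) * d) with ((K * d) * J (fun _ _ => 1)) by ring.
apply (pf_bound HJ); [auto with bdd|]. intros c s Hc.
replace (wd d c s * (s * s * f c s) - f c s) with (- ((1 - s * s * wd d c s) * f c s)) by ring.
rewrite Rabs_Ropp, Rabs_mult. destruct (wd_s2 d c s ltac:(lra)) as [W0 W1].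
rewrite (Rabs_pos_eq (1 - _)) by auto.
apply Rle_trans with ((2 * (d * d) / (s * s + d * d)) * (K * Rabs s)).
{ apply Rmult_le_compat; auto using Rabs_pos. }
assert (P : 0 < s * s + d * d) by nra.
apply (Rmult_le_reg_r (s * s + d * d)); auto.
replace (2 * (d * d) / (s * s + d * d) * (K * Rabs s) * (s * s + d * d)) with (K * d * (2 * d * Rabs s)) by (field; lra).
apply Rmult_le_compat_l; [nra|].
replace (s * s) with (Rabs s * Rabs s) by (rewrite Rabs_sq; ring).
pose proof (Rle_0_sqr (Rabs s - d)) as Q. unfold Rsqr in Q. lra.
Qed.

Lemma one_minus_u e c s : 0 < e -> circ c s -> Rabs (1 - u e c s) <= / Rmin 1 (e * e) * Rabs s.
Proof.
intros He Hc. rewrite u_compl by auto. pose proof (den_low e c s Hc) as D. pose proof (den_pos e c s He Hc) as P.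
assert (M : 0 < Rmin 1 (e * e)) by (apply Rmin_pos; [lra|nra]).
unfold Rdiv. rewrite Rabs_mult, (Rabs_pos_eq (/ _)) by (apply Rlt_le, Rinv_0_lt_compat; auto).
rewrite Rmult_comm. apply Rmult_le_compat.
- apply Rlt_le, Rinv_0_lt_compat; auto.
- apply Rabs_pos.
- apply Rinv_le_contravar; auto.
- destruct (circ_le1 c s Hc) as [_ Hs]. rewrite Rabs_mult. pose proof (Rabs_pos s). nra.
Qed.

(** Subtracting [f0 * u e] leaves a function that vanishes linearly at s = 0, though with a constant
    depending on [e], so [J1_absorb] applies for each fixed [e]. The correction on the [J1] side
    then disappears because s^2 [u e] <= e uniformly. *)
Lemma J_split f f0 K al : bdd f -> atom J al -> (forall c s, circ c s -> Rabs (f c s - f0) <= K * Rabs s) ->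
  J f = f0 * al + J1 J (fun c s => s * s * f c s).
Proof.
intros Hf [Hal _] HK. pose proof J1_posfun as P1.
apply (lim0_unique (fun e => f0 * J (u e) + J1 J (fun c s => s * s * f c s) - f0 * J1 J (fun c s => s * s * u e c s))).
- apply (lim0_ext (fun _ => J f)); [|apply lim0_const]. intros e He.
  pose proof (u_bdd e He) as Bu.
  assert (E : J (fun c s => f c s - f0 * u e c s) = J1 J (fun c s => s * s * (f c s - f0 * u e c s))).
  { apply (J1_absorb _ (K + Rabs f0 * / Rmin 1 (e * e))); [auto with bdd|].
    intros c s Hc. replace (f c s - f0 * u e c s) with ((f c s - f0) + f0 * (1 - u e c s)) by ring.
    eapply Rle_trans; [apply Rabs_triang|]. rewrite Rabs_mult.
    specialize (HK c s Hc). pose proof (one_minus_u e c s He Hc). pose proof (Rabs_pos f0).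
    apply (Rmult_le_compat_l (Rabs f0)) in H; auto. lra. }
  rewrite (pf_minus HJ), (pf_scal _ HJ) in E by auto with bdd.
  rewrite (pf_ext P1 (fun c s => s * s * (f c s - f0 * u e c s)) (fun c s => s * s * f c s - f0 * (s * s * u e c s))) in E; auto 7 with bdd.
  + rewrite (pf_minus P1), (pf_scal _ P1) in E by auto 7 with bdd. lra.
  + intros; ring.
- replace (f0 * al + J1 J (fun c s => s * s * f c s)) with (f0 * al + J1 J (fun c s => s * s * f c s) - f0 * 0) by ring.
  apply lim0_minus; [apply lim0_plus; [now apply lim0_scal|apply lim0_const]|].
  apply lim0_scal. apply (lim0_bound _ _ (J1 J (fun _ _ => 1))); [apply (pf_1 P1)|].
  intros e He. pose proof (u_bdd e ltac:(lra)) as Bu. rewrite Rminus_0_r, Rmult_comm. apply (pf_bound P1); [auto with bdd|].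
  intros c s Hc. pose proof (u_01 e c s ltac:(lra) Hc). rewrite Rabs_pos_eq by nra.
  pose proof (den_pos e c s ltac:(lra) Hc) as P. unfold circ in Hc.
  unfold u. apply (Rmult_le_reg_r (s * s + c * c * (e * e))); auto.
  replace (s * s * (c * c * (e * e) / (s * s + c * c * (e * e))) * (s * s + c * c * (e * e))) with ((c * c) * (s * s) * (e * e)) by (field; lra).
  assert (c * c <= 1) by nra. assert (e * e <= e) by nra.
  assert (A1 : (c * c) * (s * s) * (e * e) <= 1 * (s * s) * e) by (apply Rmult_le_compat; nra).
  assert (0 <= e * (c * c * (e * e))) by nra. lra.
Qed.

(** Where |s| >= e the weight [wd d] converges to s^-2 uniformly as [d] tends to 0. *)
Lemma J1_away f e : 0 < e -> bdd f -> (forall c s, circ c s -> Rabs s < e -> f c s = 0) ->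
  J1 J f = J (fun c s => f c s / (s * s)).
Proof.
intros He Hf Hz. apply J1_lim.
destruct Hf as [B HB].
assert (Bf : bdd f) by (now exists B).
assert (HB' : forall c s, circ c s -> Rabs (f c s / (s * s)) <= B / (e * e)).
{ intros c s Hc. specialize (HB c s Hc).
  assert (0 <= B) by (pose proof (Rabs_pos (f c s)); lra).
  destruct (Rlt_le_dec (Rabs s) e) as [L|L].
  - rewrite (Hz c s Hc L). unfold Rdiv. rewrite Rmult_0_l, Rabs_R0. apply Rmult_le_pos; auto.
    apply Rlt_le, Rinv_0_lt_compat; nra.
  - assert (S : e * e <= s * s) by (replace (s * s) with (Rabs s * Rabs s) by (rewrite Rabs_sq; ring); nra).
    unfold Rdiv. rewrite Rabs_mult, (Rabs_pos_eq (/ _)) by (apply Rlt_le, Rinv_0_lt_compat; nra).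
    apply Rmult_le_compat; auto using Rabs_pos; [apply Rlt_le, Rinv_0_lt_compat; nra|].
    apply Rinv_le_contravar; nra. }
assert (Bq : bdd (fun c s => f c s / (s * s))) by (exists (B / (e * e)); auto).
assert (B0 : 0 <= B).
{ assert (C01 : circ 0 1) by (unfold circ; ring). specialize (HB 0 1 C01). pose proof (Rabs_pos (f 0 1)). lra. }
apply (lim0_bound _ _ (B / (e * e) * (2 / (e * e)) * J (fun _ _ => 1))).
{ apply Rmult_le_pos; [|apply (pf_1 HJ)]. apply Rmult_le_pos; apply Rdiv_le_0_compat; nra. }
intros d Hd. assert (Bw : bdd (wd d)) by (apply wd_bdd; lra).
rewrite <- (pf_minus HJ) by auto with bdd.
replace (B / (e * e) * (2 / (e * e)) * J (fun _ _ => 1) * d) with ((B / (e * e) * (2 * d / (e * e))) * J (fun _ _ => 1)) by (field; nra).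
apply (pf_bound HJ); [auto with bdd|]. intros c s Hc.
destruct (Rlt_le_dec (Rabs s) e) as [L|L].
- rewrite (Hz c s Hc L). unfold Rdiv. rewrite Rmult_0_l, Rmult_0_r, Rminus_0_r, Rabs_R0.
  apply Rmult_le_pos; apply Rdiv_le_0_compat; nra.
- assert (S : e * e <= s * s) by (replace (s * s) with (Rabs s * Rabs s) by (rewrite Rabs_sq; ring); nra).
  assert (P : 0 < s * s) by nra.
  replace (wd d c s * f c s - f c s / (s * s)) with (- ((f c s / (s * s)) * (1 - s * s * wd d c s))) by (field; nra).
  rewrite Rabs_Ropp, Rabs_mult. destruct (wd_s2 d c s ltac:(lra)) as [W0 W1].
  rewrite (Rabs_pos_eq (1 - _)) by auto.
  apply Rmult_le_compat; auto using Rabs_pos.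
  eapply Rle_trans; [apply W1|]. apply Rmult_le_compat; [nra|apply Rlt_le, Rinv_0_lt_compat; nra|nra|].
  apply Rinv_le_contravar; nra.
Qed.

(* With [mu] the representing measure of [J] and [t = s/c], this represents [t^-2 mu]. *)
Definition Jred (f : R -> R -> R) : R := J1 J (fun c s => c * c * f c s).

Lemma Jred_posfun : posfun Jred.
Proof. apply (pf_weight J1_posfun (fun c s => c * c)); [auto with bdd|]. intros; nra. Qed.

End Reduction.
Arguments Jred J f : clear implicits.

(* The functional of [z |-> h (-1/z)]. *)
Definition Jinv (J : (R -> R -> R) -> R) (f : R -> R -> R) : R := J (fun c s => f (- s) c).

Lemma circ_rot c s : circ c s -> circ (- s) c.
Proof. unfold circ; intros; lra. Qed.

Lemma Jinv_posfun J : posfun J -> posfun (Jinv J).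
Proof. intros HJ. apply (pf_comp HJ (fun c s => - s) (fun c s => c)). intros c s; apply circ_rot. Qed.

(** * The kernel *)

Lemma hker_den_sq z c s : Cmod (RtoC s - RtoC c * z) ^ 2 = (s - c * Re z) * (s - c * Re z) + (c * Im z) * (c * Im z).
Proof. rewrite Cmod2_alt, Re_minus, Im_minus, re_scal_l, im_scal_l, re_RtoC, im_RtoC. ring. Qed.

Lemma hker_den_low z : upper z -> exists k, 0 < k /\ forall c s, circ c s -> k <= Cmod (RtoC s - RtoC c * z).
Proof.
intros Hz. pose proof Hz as Hz'. unfold upper in Hz'. set (x := Re z) in *. set (y := Im z) in *.
(* Comes from s^2 <= 2 (s - c x)^2 + 2 c^2 x^2 together with c^2 + s^2 = 1. *)
set (k := y * y / (1 + 2 * (x * x) + 2 * (y * y))).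
assert (Hk : 0 < k) by (apply Rdiv_lt_0_compat; nra).
assert (L : forall c s, circ c s -> k <= Cmod (RtoC s - RtoC c * z) ^ 2).
{ intros c s Hc. rewrite hker_den_sq. fold x y. unfold k.
  apply (Rmult_le_reg_r (1 + 2 * (x * x) + 2 * (y * y))); [nra|].
  unfold Rdiv. rewrite Rmult_assoc, Rinv_l by nra.
  unfold circ in Hc.
  assert (S2 : s * s <= 2 * ((s - c * x) * (s - c * x)) + 2 * (c * c) * (x * x)).
  { pose proof (Rle_0_sqr (s - c * x - c * x)) as Q. unfold Rsqr in Q. lra. }
  generalize dependent (s - c * x). intros A S2.
  apply (Rmult_le_compat_l (y * y)) in S2; [|nra].
  assert (0 <= (A * A) * (x * x)) by nra. assert (0 <= (c * y) * (c * y) * (y * y)) by nra.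
  assert (0 <= A * A) by nra.
  assert (y * y * (c * c + s * s) = y * y) by (rewrite Hc; ring). lra. }
(* [k] bounds the square of the modulus from below; the minimum with 1 turns this into a bound for
   the modulus itself. *)
exists (Rmin 1 k). split; [apply Rmin_pos; lra|]. intros c s Hc.
specialize (L c s Hc). pose proof (Cmod_ge_0 (RtoC s - RtoC c * z)).
pose proof (Rmin_l 1 k). pose proof (Rmin_r 1 k).
apply Rnot_lt_le; intros Hlt. simpl in L. nra.
Qed.

Lemma hker_bdd z : upper z -> cbdd (hker z).
Proof.
intros Hz. destruct (hker_den_low z Hz) as [k [Hk L]].
exists ((1 + Cmod z) * / k). intros c s Hc. unfold hker, Cdiv.
rewrite Cmod_mult, Cmod_inv by now apply hker_den_ne.
destruct (circ_le1 c s Hc) as [C1 S1].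
apply Rmult_le_compat; [apply Cmod_ge_0| | |].
- apply Rlt_le, Rinv_0_lt_compat, Cmod_gt_0, hker_den_ne; auto.
- eapply Rle_trans; [apply Cmod_triangle|]. rewrite Cmod_mult, !Cmod_R. pose proof (Cmod_ge_0 z). nra.
- apply Rinv_le_contravar; auto.
Qed.
#[export] Hint Resolve hker_bdd : bdd.

Lemma Cmult_conj_div (a b : C) : b <> 0 -> (a / b)%C = (RtoC (/ (Cmod b ^ 2)) * (a * Cconj b))%C.
Proof.
intros Hb. rewrite RtoC_inv by (apply pow_nonzero, Rgt_not_eq, Cmod_gt_0; auto).
rewrite Cmod2_conj. field. split; auto.
apply Cmod_gt_0. rewrite Cmod_conj. apply Cmod_gt_0; auto.
Qed.

Lemma Im_hker z c s : upper z -> circ c s ->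
  Im (hker z c s) = Im z / ((s - c * Re z) * (s - c * Re z) + (c * Im z) * (c * Im z)).
Proof.
intros Hz Hc. pose proof (hker_den_ne z c s Hz Hc) as N.
unfold hker. rewrite Cmult_conj_div by auto. rewrite im_scal_l, hker_den_sq. unfold circ in Hc.
unfold Rdiv. rewrite Rmult_comm. f_equal. simpl. unfold Re, Im.
transitivity ((c * c + s * s) * snd z); [ring|rewrite Hc; ring].
Qed.

(** * Asymptotic expansions at the origin *)

(** Horner form, so that one step peels off one coefficient. It is applied to z f(z), where a pole
    a_{-1}/z becomes the constant term; hence index j stands for a_{j-1}. *)
Fixpoint hpoly (n : nat) (A : nat -> R) (z : C) : C :=
  match n with
  | O => RtoC (A O)
  | S m => (RtoC (A O) + z * hpoly m (fun j => A (S j)) z)%C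
  end.

(** A Stoltz domain in algebraic form, with k = 1 - cos(theta) in [stoltz_Stz]. For k = 1 it is the
    imaginary half-axis. *)
Definition Stz (k : R) (z : C) : Prop := upper z /\ Rabs (Re z) <= (1 - k) * Cmod z.

Definition pexp (F : C -> C) (n : nat) (A : nat -> R) : Prop :=
  forall k, 0 < k <= 1 -> forall eps, 0 < eps -> exists d, 0 < d /\
    forall z, Stz k z -> Cmod z < d -> Cmod (F z - hpoly n A z) <= eps * Cmod z ^ n.

(** Only the imaginary half-axis is tested. This already determines the coefficients and suffices to
    recover finite moments. *)
Definition iexp (F : C -> C) (n : nat) (A : nat -> R) : Prop :=
  forall eps, 0 < eps -> exists d, 0 < d /\
    forall y, 0 < y < d -> Cmod (F (0, y) - hpoly n A (0, y)) <= eps * y ^ n.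

Lemma Cmod_iy y : 0 <= y -> Cmod (0, y) = y.
Proof. intros Hy. unfold Cmod; simpl. replace (0 * (0 * 1) + y * (y * 1)) with (y * y) by ring. apply sqrt_square; auto. Qed.

Lemma pexp_iexp F n A : pexp F n A -> iexp F n A.
Proof.
intros H eps He. destruct (H 1 ltac:(lra) eps He) as [d [Hd K]]. exists d; split; auto.
intros y Hy. specialize (K (0, y)). rewrite Cmod_iy in K by lra. apply K; [|lra].
split; [unfold upper; simpl; lra|]. simpl. rewrite Rabs_R0. lra.
Qed.

Lemma hpoly_ext n A B z : (forall j, (j <= n)%nat -> A j = B j) -> hpoly n A z = hpoly n B z.
Proof.
revert A B. induction n; intros A B H; simpl; rewrite (H 0%nat) by lia; [reflexivity|].
do 2 f_equal. apply IHn. intros; apply H; lia.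
Qed.

Lemma hpoly_minus n A B z : hpoly n (fun j => A j - B j) z = (hpoly n A z - hpoly n B z)%C.
Proof.
revert A B. induction n; intros A B; simpl; rewrite RtoC_minus; [reflexivity|].
rewrite (IHn (fun j => A (S j)) (fun j => B (S j))). ring.
Qed.

Lemma hpoly_last n A z : hpoly (S n) A z = (hpoly n A z + RtoC (A (S n)) * z ^ S n)%C.
Proof.
revert A. induction n; intros A; [simpl; ring|].
change (hpoly (S (S n)) A z) with (RtoC (A O) + z * hpoly (S n) (fun j => A (S j)) z)%C.
rewrite IHn. simpl. ring.
Qed.

Lemma pexp_step F G n A : pexp F n (fun j => A (S j)) ->
  (forall z, upper z -> G z = (RtoC (A O) + z * F z)%C) -> pexp G (S n) A.
Proof.
intros H E k Hk eps He. destruct (H k Hk eps He) as [d [Hd K]]. exists d; split; auto.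
intros z Hz Hzd. specialize (K z Hz Hzd). rewrite E by apply Hz. simpl hpoly.
replace (RtoC (A O) + z * F z - (RtoC (A O) + z * hpoly n (fun j => A (S j)) z))%C
  with (z * (F z - hpoly n (fun j => A (S j)) z))%C by ring.
rewrite Cmod_mult. simpl. pose proof (Cmod_ge_0 z). nra.
Qed.

Lemma pexp_minus F G n A B : pexp F n A -> pexp G n B ->
  pexp (fun z => F z - G z)%C n (fun j => A j - B j).
Proof.
intros H K k Hk eps He. destruct (H k Hk (eps/2) ltac:(lra)) as [d [Hd H1]].
destruct (K k Hk (eps/2) ltac:(lra)) as [d' [Hd' K1]].
exists (Rmin d d'); split; [now apply Rmin_pos|]. intros z Hz Hzd.
specialize (H1 z Hz (Rlt_le_trans _ _ _ Hzd (Rmin_l _ _))). specialize (K1 z Hz (Rlt_le_trans _ _ _ Hzd (Rmin_r _ _))).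
rewrite hpoly_minus.
replace (F z - G z - (hpoly n A z - hpoly n B z))%C with ((F z - hpoly n A z) - (G z - hpoly n B z))%C by ring.
eapply Rle_trans; [apply Cmod_minus_le|]. lra.
Qed.

Lemma iexp_minus F G n A B : iexp F n A -> iexp G n B ->
  iexp (fun z => F z - G z)%C n (fun j => A j - B j).
Proof.
intros H K eps He. destruct (H (eps/2) ltac:(lra)) as [d [Hd H1]].
destruct (K (eps/2) ltac:(lra)) as [d' [Hd' K1]].
exists (Rmin d d'); split; [now apply Rmin_pos|]. intros y Hy.
pose proof (Rmin_l d d'); pose proof (Rmin_r d d').
specialize (H1 y ltac:(lra)). specialize (K1 y ltac:(lra)).
rewrite hpoly_minus.
replace (F (0, y) - G (0, y) - (hpoly n A (0, y) - hpoly n B (0, y)))%C with ((F (0, y) - hpoly n A (0, y)) - (G (0, y) - hpoly n B (0, y)))%C by ring.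
eapply Rle_trans; [apply Cmod_minus_le|]. lra.
Qed.

Lemma iexp_ext F G n A : (forall y, 0 < y -> F (0, y) = G (0, y)) -> iexp F n A -> iexp G n A.
Proof.
intros E H eps He. destruct (H eps He) as [d [Hd K]]. exists d; split; auto.
intros y Hy. rewrite <- E by lra. auto.
Qed.

Lemma iexp_trunc1 F n A : iexp F (S n) A -> iexp F n A.
Proof.
intros H eps He. destruct (H 1 Rlt_0_1) as [d [Hd K]].
pose proof (Rabs_pos (A (S n))) as PA.
exists (Rmin d (eps / (Rabs (A (S n)) + 1))); split.
{ apply Rmin_pos; auto. apply Rdiv_lt_0_compat; lra. }
intros y [Hy Hyd]. pose proof (Rmin_l d (eps / (Rabs (A (S n)) + 1))). pose proof (Rmin_r d (eps / (Rabs (A (S n)) + 1))).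
assert (X : y < eps / (Rabs (A (S n)) + 1)) by lra. apply lt_div_mult in X; [|lra].
specialize (K y ltac:(lra)). rewrite hpoly_last in K.
replace (F (0, y) - hpoly n A (0, y))%C with
  ((F (0, y) - (hpoly n A (0, y) + RtoC (A (S n)) * (0, y) ^ S n)) + RtoC (A (S n)) * (0, y) ^ S n)%C by ring.
eapply Rle_trans; [apply Cmod_triangle|]. rewrite (Cmod_mult (RtoC _)), Cmod_R, Cmod_pow, Cmod_iy by lra.
assert (P : 0 < y ^ n) by (apply pow_lt; lra). simpl in *. nra.
Qed.

Lemma iexp_trunc F n m A : (m <= n)%nat -> iexp F n A -> iexp F m A.
Proof. intros H; induction H; auto. intros K; apply IHle. now apply iexp_trunc1. Qed.

Lemma iexp_0_lim F A : iexp F 0 A -> forall eps, 0 < eps -> exists d, 0 < d /\ forall y, 0 < y < d -> Cmod (F (0,y) - RtoC (A O)) <= eps.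
Proof. intros H eps He. destruct (H eps He) as [d [Hd K]]. exists d; split; auto. intros y Hy. specialize (K y Hy). simpl in K. lra. Qed.

Lemma iexp_zero n D : iexp (fun _ => RtoC 0) n D -> forall j, (j <= n)%nat -> D j = 0.
Proof.
revert D. induction n; intros D H.
- intros j Hj. replace j with 0%nat by lia.
  apply Rabs_eq_0, Rle_antisym; [|apply Rabs_pos]. apply Rnot_lt_le; intros Hp.
  destruct (iexp_0_lim _ _ H (Rabs (D O) / 2) ltac:(lra)) as [d [Hd K]].
  specialize (K (d/2) ltac:(lra)). replace (RtoC 0 - RtoC (D O))%C with (RtoC (- D O)) in K by (rewrite RtoC_opp; ring).
  rewrite Cmod_R, Rabs_Ropp in K. lra.
- assert (D0 : D O = 0).
  { apply Rabs_eq_0, Rle_antisym; [|apply Rabs_pos]. apply Rnot_lt_le; intros Hp.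
    pose proof (iexp_trunc _ (S n) 0 D ltac:(lia) H) as H0.
    destruct (iexp_0_lim _ _ H0 (Rabs (D O) / 2) ltac:(lra)) as [d [Hd K]].
    specialize (K (d/2) ltac:(lra)). replace (RtoC 0 - RtoC (D O))%C with (RtoC (- D O)) in K by (rewrite RtoC_opp; ring).
    rewrite Cmod_R, Rabs_Ropp in K. lra. }
  assert (H' : iexp (fun _ => RtoC 0) n (fun j => D (S j))).
  { intros eps He. destruct (H eps He) as [d [Hd K]]. exists d; split; auto. intros y Hy. specialize (K y Hy).
    simpl hpoly in K. rewrite D0 in K.
    replace (RtoC 0 - (RtoC 0 + (0, y) * hpoly n (fun j => D (S j)) (0, y)))%C with
      ((0, y) * (RtoC 0 - hpoly n (fun j => D (S j)) (0, y)))%C in K by ring.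
    rewrite Cmod_mult, Cmod_iy in K by lra. simpl in K. apply (Rmult_le_reg_l y); [lra|].
    lra. }
  intros [|j] Hj; auto. apply (IHn _ H'). lia.
Qed.

Lemma iexp_unique F n A B : iexp F n A -> iexp F n B -> forall j, (j <= n)%nat -> A j = B j.
Proof.
intros H K j Hj. pose proof (iexp_minus _ _ _ _ _ H K) as M.
apply Rminus_diag_uniq. apply (iexp_zero n (fun j => A j - B j)); auto.
revert M. apply iexp_ext. intros; ring.
Qed.

Lemma iexp_unstep F G n A : iexp G (S n) A ->
  (forall y, 0 < y -> G (0, y) = (RtoC (A O) + (0, y) * F (0, y))%C) -> iexp F n (fun j => A (S j)).
Proof.
intros H E eps He. destruct (H eps He) as [d [Hd K]]. exists d; split; auto. intros y Hy. specialize (K y Hy).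
rewrite E in K by lra. simpl hpoly in K.
replace (RtoC (A O) + (0, y) * F (0, y) - (RtoC (A O) + (0, y) * hpoly n (fun j => A (S j)) (0, y)))%C with
  ((0, y) * (F (0, y) - hpoly n (fun j => A (S j)) (0, y)))%C in K by ring.
rewrite Cmod_mult, Cmod_iy in K by lra. simpl in K. apply (Rmult_le_reg_l y); lra.
Qed.

(** By partial fractions the integrand is e^2 / (e^2 - r^2) times [u e] - [u r], and the condition
    on [r] makes this factor at most 2. It bounds the mass near s = 0 other than the point mass,
    uniformly in [r]. *)
Lemma J_uu J e r al : posfun J -> atom J al -> 0 < r -> 2 * (r * r) <= e * e -> 0 < e ->
  J (fun c s => u e c s * (1 - u r c s)) <= 2 * (J (u e) - al).
Proof.
intros HJ [_ Hal] Hr Hre He.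
assert (D : 0 < e * e - r * r) by nra.
pose proof (u_bdd e He) as Be. pose proof (u_bdd r Hr) as Br.
rewrite (pf_ext HJ _ (fun c s => (e * e) / (e * e - r * r) * (u e c s - u r c s))); auto with bdd.
- rewrite (pf_scal _ HJ), (pf_minus HJ) by auto with bdd. specialize (Hal r Hr) as H1. specialize (Hal e He) as H2.
  assert (Q : e * e / (e * e - r * r) <= 2).
  { apply (Rmult_le_reg_r (e * e - r * r)); auto. unfold Rdiv. rewrite Rmult_assoc, Rinv_l; lra. }
  assert (Q0 : 0 < e * e / (e * e - r * r)) by (apply Rdiv_lt_0_compat; nra).
  assert (e * e / (e * e - r * r) * (J (u e) - J (u r)) <= e * e / (e * e - r * r) * (J (u e) - al)) by (apply Rmult_le_compat_l; lra).
  nra.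
- intros c s Hc. pose proof (den_pos e c s He Hc). pose proof (den_pos r c s Hr Hc).
  unfold u. field. repeat split; lra.
Qed.

(** On the cone the cross term 2 s c Re z is at most 1 - k times s^2 + c^2 |z|^2, so the denominator
    is comparable with its size on the imaginary axis. *)
Lemma Stz_den k z c s : Stz k z -> 0 < k <= 1 ->
  k * (s * s + c * c * (Cmod z * Cmod z)) <= Cmod (RtoC s - RtoC c * z) ^ 2.
Proof.
intros [Hz Hx] Hk. rewrite hker_den_sq.
assert (E : Cmod z * Cmod z = Re z * Re z + Im z * Im z).
{ pose proof (Cmod2_alt z) as X. simpl in X. lra. }
pose proof (Cmod_ge_0 z) as P. set (r := Cmod z) in *.
set (x := Re z) in *. set (y := Im z) in *.
assert (X : - (2 * (s * c * x)) >= - ((1 - k) * (s * s + c * c * (r * r)))).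
{ assert (A : s * c * x <= Rabs s * Rabs c * ((1 - k) * r)).
  { eapply Rle_trans; [apply Rle_abs|]. rewrite !Rabs_mult. apply Rmult_le_compat_l; auto.
    apply Rmult_le_pos; apply Rabs_pos. }
  assert (Rs : s * s = Rabs s * Rabs s) by (rewrite Rabs_sq; ring).
  assert (Rc : c * c = Rabs c * Rabs c) by (rewrite Rabs_sq; ring).
  rewrite Rs, Rc. pose proof (Rle_0_sqr (Rabs s - Rabs c * r)) as Q. unfold Rsqr in Q.
  assert (0 <= (1 - k) * ((Rabs s - Rabs c * r) * (Rabs s - Rabs c * r))) by (apply Rmult_le_pos; lra). lra. }
rewrite E in *. lra.
Qed.

(** Since z [hker] + 1 = s (1 + z^2) / (s - c z), the sum z [hker] + [u e] is not small where |s| is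
    of the order of |z|, but it stays bounded there. The mass in that zone other than the point mass
    is charged to [J (u e) - al] by [J_uu]; away from s = 0 the factor z suffices. *)
Lemma exp_order0 g J h al : posfun J -> Rep g J h -> atom J al ->
  pexp (fun z => z * h z)%C 0 (fun _ => - al).
Proof.
intros HJ HR Hal k Hk eps Heps.
set (T := J (fun _ _ => 1)). assert (HT : 0 <= T) by apply (pf_1 HJ).
(* The total error is at most 2 eta T + 4 tol / (k eta) + tol + |z| B; the choices of [eta], of
   [tol] and of the radius keep each of the four terms at most eps / 4. *)
set (eta := eps / (16 * (T + 1))).
assert (Heta : 0 < eta) by (apply Rdiv_lt_0_compat; lra).
assert (Eeta : eta * (T + 1) = eps / 16) by (unfold eta; field; lra).
set (tol := Rmin (eps / 8) (k * eta * eps / 16)).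
assert (Htol : 0 < tol) by (apply Rmin_pos; [lra|]; apply Rdiv_lt_0_compat; [|lra]; clear Eeta; clearbody eta; repeat apply Rmult_lt_0_compat; lra).
destruct (proj1 Hal tol Htol) as [e0 [He0 K0]].
set (e := Rmin 1 (e0 / 2)). assert (He : 0 < e) by (apply Rmin_pos; lra).
assert (He1 : e <= 1) by apply Rmin_l. assert (He2 : e <= e0 / 2) by apply Rmin_r.
assert (Hu : 0 <= J (u e) - al < tol).
{ specialize (K0 e ltac:(lra)). pose proof (proj2 Hal e He). apply Rabs_def2 in K0. lra. }
set (m := e * e). assert (Hm : 0 < m) by (unfold m; nra).
set (B := Rabs g + 8 * T / (k * m)).
assert (HB : 0 <= B).
{ unfold B. pose proof (Rabs_pos g). assert (0 <= 8 * T / (k * m)); [|lra]. apply Rdiv_le_0_compat; [lra|]. nra. }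
exists (Rmin (e / 2) (eps / (4 * (B + 1)))); split.
{ apply Rmin_pos; [lra|]. apply Rdiv_lt_0_compat; lra. }
intros z Hz Hzd.
set (r := Cmod z) in *.
assert (Hr1 : r < e / 2) by (eapply Rlt_le_trans; [apply Hzd|apply Rmin_l]).
assert (Hr2 : r < eps / (4 * (B + 1))) by (eapply Rlt_le_trans; [apply Hzd|apply Rmin_r]).
apply lt_div_mult in Hr2; [|lra].
assert (Hup : upper z) by apply Hz.
assert (Hr : 0 < r).
{ apply Cmod_gt_0. intros E. rewrite E in Hup. unfold upper in Hup. simpl in Hup. lra. }
simpl hpoly. simpl pow. rewrite Rmult_1_r.
pose proof (u_bdd e He) as Be. pose proof (u_bdd r Hr) as Br.
assert (Bk : cbdd (fun c s => z * hker z c s + RtoC (u e c s))%C) by auto with bdd.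
assert (E : (z * h z - RtoC (- al))%C = (z * RtoC g + JC J (fun c s => z * hker z c s + RtoC (u e c s)) + RtoC (al - J (u e)))%C).
{ rewrite (JC_plus HJ), (JC_scal HJ), (JC_RtoC HJ) by auto with bdd. rewrite (HR z Hup), RtoC_opp, RtoC_minus. ring. }
rewrite E.
set (gb := fun c s => eta + / (k * eta) * (u e c s * (1 - u r c s)) + 4 * r / (k * m)).
assert (Bg : bdd gb) by (unfold gb; auto 8 with bdd).
assert (PB : forall c s, circ c s -> Cmod (z * hker z c s + RtoC (u e c s)) <= gb c s).
{ intros c s Hc. pose proof (hker_den_ne z c s Hup Hc) as N.
  set (w := (RtoC s - RtoC c * z)%C) in *.
  assert (Hw : 0 < Cmod w) by now apply Cmod_gt_0.
  (* X^2 is at most (1 - [u r]) / k by [Stz_den], and 2 X <= eta + X^2 / eta brings the near part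
     into the form integrated by [J_uu]. *)
  set (X := Rabs s / Cmod w).
  assert (X0 : 0 <= X) by (apply Rdiv_le_0_compat; auto using Rabs_pos).
  pose proof (u_01 e c s He Hc) as U1. pose proof (u_01 r c s Hr Hc) as U2.
  destruct (circ_le1 c s Hc) as [C1 S1]. pose proof (Rabs_pos s) as Ps.
  assert (HX : X * X <= (1 - u r c s) / k).
  { rewrite u_compl by auto. pose proof (den_pos r c s Hr Hc) as P.
    pose proof (Stz_den k z c s Hz Hk) as D. fold r w in D. replace (s * s + c * c * (r * r)) with (s * s + c * c * (r * r)) in D by ring.
    assert (Q : X * X = s * s * / (Cmod w ^ 2)).
    { unfold X. replace (s * s) with (Rabs s * Rabs s) by (rewrite Rabs_sq; ring). simpl. field. lra. }
    rewrite Q. replace (s * s / (s * s + c * c * (r * r)) / k) with (s * s * / (k * (s * s + c * c * (r * r)))) by (field; lra).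
    apply Rmult_le_compat_l; [nra|]. apply Rinv_le_contravar; [nra|]. exact D. }
  assert (Ea : (z * hker z c s + RtoC (u e c s))%C =
    (RtoC (u e c s) * (RtoC s * (1 + z * z) / w) + RtoC (1 - u e c s) * (z * ((RtoC c + RtoC s * z) / w)))%C).
  { unfold hker. fold w.
    assert (Ew : (RtoC s * (1 + z * z) / w)%C = (z * ((RtoC c + RtoC s * z) / w) + 1)%C).
    { transitivity ((z * (RtoC c + RtoC s * z) + w) / w)%C; [unfold w; f_equal; ring|field; auto]. }
    rewrite Ew, RtoC_minus. ring. }
  rewrite Ea. eapply Rle_trans; [apply Cmod_triangle|].
  rewrite !Cmod_mult, !Cmod_div, !Cmod_mult, !Cmod_R by auto. fold r.
  rewrite (Rabs_pos_eq (u e c s)), (Rabs_pos_eq (1 - u e c s)) by lra.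
  assert (Z2 : Cmod (1 + z * z) <= 2).
  { eapply Rle_trans; [apply Cmod_triangle|]. rewrite Cmod_1, Cmod_mult. fold r. nra. }
  assert (T1 : u e c s * (Rabs s * Cmod (1 + z * z) / Cmod w) <= eta + / (k * eta) * (u e c s * (1 - u r c s))).
  { replace (Rabs s * Cmod (1 + z * z) / Cmod w) with (Cmod (1 + z * z) * X) by (unfold X; field; lra).
    assert (A1 : u e c s * (Cmod (1 + z * z) * X) <= u e c s * (2 * X)).
    { apply Rmult_le_compat_l; [lra|]. apply Rmult_le_compat_r; auto. }
    assert (A2 : 2 * X <= eta + X * X / eta).
    { pose proof (Rle_0_sqr (X - eta)) as Q. unfold Rsqr in Q. apply (Rmult_le_reg_r eta); auto.
      replace ((eta + X * X / eta) * eta) with (eta * eta + X * X) by (field; lra). lra. }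
    assert (A3 : X * X / eta <= / (k * eta) * (1 - u r c s)).
    { replace (/ (k * eta) * (1 - u r c s)) with ((1 - u r c s) / k / eta) by (field; lra).
      apply Rmult_le_compat_r; [apply Rlt_le, Rinv_0_lt_compat; auto|auto]. }
    assert (A4 : 0 <= / (k * eta) * (1 - u r c s)).
    { apply Rmult_le_pos; [apply Rlt_le, Rinv_0_lt_compat; nra|lra]. }
    replace (/ (k * eta) * (u e c s * (1 - u r c s))) with (u e c s * (/ (k * eta) * (1 - u r c s))) by ring.
    assert (u e c s * (2 * X) <= u e c s * (eta + / (k * eta) * (1 - u r c s))) by (apply Rmult_le_compat_l; lra).
    nra. }
  assert (T2 : (1 - u e c s) * (r * (Cmod (RtoC c + RtoC s * z) / Cmod w)) <= 4 * r / (k * m)).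
  { assert (A1 : Cmod (RtoC c + RtoC s * z) <= 2).
    { eapply Rle_trans; [apply Cmod_triangle|]. rewrite Cmod_mult, !Cmod_R. fold r. nra. }
    assert (A2 : 1 - u e c s <= Rabs s * Rabs s / m).
    { rewrite u_compl by auto. pose proof (den_low e c s Hc) as D. rewrite Rmin_right in D by nra.
      replace (s * s) with (Rabs s * Rabs s) at 1 by (rewrite Rabs_sq; ring).
      apply Rmult_le_compat_l; [nra|]. apply Rinv_le_contravar; auto. }
    assert (A3 : (Rabs s * Rabs s / m) * (r * (2 / Cmod w)) = 2 * r / m * (Rabs s * X)) by (unfold X; field; lra).
    assert (A4 : Rabs s * X <= 2 / k).
    { assert (Q : (1 - u r c s) / k <= 1 / k) by (apply Rmult_le_compat_r; [apply Rlt_le, Rinv_0_lt_compat; lra|lra]).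
      assert (Q1 : 1 <= 1 / k) by (apply (Rmult_le_reg_r k); [lra|]; unfold Rdiv; rewrite Rmult_assoc, Rinv_l; lra).
      assert (X <= X * X + 1) by nra.
      assert (Rabs s * X <= 1 * X) by (apply Rmult_le_compat_r; auto).
      replace (2 / k) with (1 / k + 1 / k) by (field; lra). lra. }
    apply Rle_trans with ((Rabs s * Rabs s / m) * (r * (2 / Cmod w))).
    - apply Rmult_le_compat; [lra| |auto|].
      + apply Rmult_le_pos; [lra|]. apply Rdiv_le_0_compat; auto using Cmod_ge_0.
      + apply Rmult_le_compat_l; [lra|]. apply Rmult_le_compat_r; auto. apply Rlt_le, Rinv_0_lt_compat; auto.
    - rewrite A3. replace (4 * r / (k * m)) with (2 * r / m * (2 / k)) by (field; lra).
      apply Rmult_le_compat_l; auto. apply Rdiv_le_0_compat; lra. }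
  unfold gb. lra. }
pose proof (JC_bound HJ _ gb Bk Bg PB) as JB.
assert (Jg : J gb = eta * T + / (k * eta) * J (fun c s => u e c s * (1 - u r c s)) + 4 * r / (k * m) * T).
{ unfold gb.
  rewrite (pf_add _ HJ (fun c s => eta + / (k * eta) * (u e c s * (1 - u r c s))) (fun _ _ => 4 * r / (k * m))) by auto 8 with bdd.
  rewrite (pf_add _ HJ (fun _ _ => eta) (fun c s => / (k * eta) * (u e c s * (1 - u r c s)))) by auto 8 with bdd.
  rewrite (pf_scal _ HJ (/ (k * eta)) (fun c s => u e c s * (1 - u r c s))) by auto 8 with bdd.
  rewrite (pf_const HJ eta), (pf_const HJ (4 * r / (k * m))). unfold T. ring. }
assert (Ju : J (fun c s => u e c s * (1 - u r c s)) <= 2 * (J (u e) - al)) by (apply J_uu; auto; nra).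
assert (Z1 : / (k * eta) * J (fun c s => u e c s * (1 - u r c s)) <= eps / 8).
{ assert (A : tol <= k * eta * eps / 16) by apply Rmin_r.
  apply (Rmult_le_reg_l (k * eta)); [nra|]. rewrite <- Rmult_assoc, Rinv_r, Rmult_1_l by (apply Rgt_not_eq; nra). lra. }
assert (tol <= eps / 8) by apply Rmin_l.
assert (Z2 : r * Rabs g + 2 * (4 * r / (k * m) * T) = r * B) by (unfold B; field; split; lra).
eapply Rle_trans; [apply Cmod_triangle|]. rewrite Cmod_R.
eapply Rle_trans; [apply Rplus_le_compat_r, Cmod_triangle|]. rewrite Cmod_mult, Cmod_R. fold r.
rewrite (Rabs_left1 (al - J (u e))) by lra. rewrite Jg in JB. nra.
Qed.

(** In terms of mu, the integral of 1 / (t (1 + t^2)) off 0; it is the correction to the constant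
    term in [reduce]. *)
Definition mxy (J : (R -> R -> R) -> R) : R := J1 J (fun c s => c * s).

(** The integral of t^-2 off 0 in terms of mu, plus the mass of [J] at infinity, where s^-2 = 1. *)
Definition mtot (J : (R -> R -> R) -> R) : R := J1 J (fun _ _ => 1).

Section Reduce.
Context {J : (R -> R -> R) -> R} (HJ : posfun J) (G : Good1 J).

Lemma JC_split f f0 K al : cbdd f -> atom J al ->
  (forall c s, circ c s -> Cmod (f c s - f0) <= K * Rabs s) ->
  JC J f = (f0 * RtoC al + JC (J1 J) (fun c s => RtoC (s * s) * f c s))%C.
Proof.
intros Hf Hal HK. apply C_ext.
- change (Re (JC J f)) with (J (fun c s => Re (f c s))).
  rewrite (J_split HJ G _ (Re f0) K al); auto with bdd.
  + rewrite Re_plus, re_scal_r. apply f_equal.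
    change (J1 J (fun c s => s * s * Re (f c s)) = J1 J (fun c s => Re (RtoC (s * s) * f c s)%C)). apply f_equal.
    do 2 (apply FunctionalExtensionality.functional_extensionality; intro). now rewrite re_scal_l.
  + intros c s Hc. rewrite <- Re_minus. eapply Rle_trans; [apply re_le_Cmod|auto].
- change (Im (JC J f)) with (J (fun c s => Im (f c s))).
  rewrite (J_split HJ G _ (Im f0) K al); auto with bdd.
  + rewrite Im_plus, im_scal_r. apply f_equal.
    change (J1 J (fun c s => s * s * Im (f c s)) = J1 J (fun c s => Im (RtoC (s * s) * f c s)%C)). apply f_equal.
    do 2 (apply FunctionalExtensionality.functional_extensionality; intro). now rewrite im_scal_l.
  + intros c s Hc. rewrite <- Im_minus. eapply Rle_trans; [apply im_le_Cmod|auto].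
Qed.

Definition red (z : C) : C := (RtoC (mxy J) + JC (Jred J) (hker z))%C.

Lemma red_rep : Rep (mxy J) (Jred J) red.
Proof. intros z _. reflexivity. Qed.

Lemma upper_ne0 z : upper z -> z <> 0.
Proof. intros H E. rewrite E in H. unfold upper in H. simpl in H. lra. Qed.

(* Iterating [s^2 (c + s z)/(s - c z) = s c + z + z^2 c/(s - c z)] lowers the order by two. *)
Lemma reduce g h al z : Rep g J h -> atom J al -> upper z ->
  (z * h z)%C = (RtoC (- al) + z * (RtoC (g + mxy J) + z * (RtoC (mtot J) + z * red z)))%C.
Proof.
intros HR Hal Hz. pose proof (J1_posfun HJ G) as P1.
pose proof (upper_ne0 z Hz) as Nz.
destruct (hker_den_low z Hz) as [k [Hk L]].
assert (S : JC J (hker z) = (- / z * RtoC al + JC (J1 J) (fun c s => RtoC (s * s) * hker z c s))%C).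
{ apply (JC_split _ _ (Cmod (1 + z * z) * / Cmod z * / k)); auto with bdd.
  intros c s Hc. pose proof (hker_den_ne z c s Hz Hc) as N. specialize (L c s Hc).
  replace (hker z c s - - / z)%C with (RtoC s * ((1 + z * z) * / z * / (RtoC s - RtoC c * z)))%C.
  - rewrite !Cmod_mult, !Cmod_inv, Cmod_R by auto. rewrite Rmult_comm.
    apply Rmult_le_compat_r; [apply Rabs_pos|]. apply Rmult_le_compat_l.
    + apply Rmult_le_pos; [apply Cmod_ge_0|]. apply Rlt_le, Rinv_0_lt_compat, Cmod_gt_0; auto.
    + apply Rinv_le_contravar; auto.
  - unfold hker. field. split; auto. }
assert (Ecs : JC (J1 J) (fun c s => RtoC (s * s) * hker z c s)%C =
  (RtoC (mxy J) + z * (RtoC (mtot J) + z * red z))%C).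
{ unfold red. rewrite (JC_weight (J1 J) (fun c s => c * c)).
  unfold mxy, mtot.
  rewrite <- (JC_RtoC P1 (fun c s => c * s)), <- (JC_RtoC P1 (fun _ _ => 1)) by auto with bdd.
  rewrite <- (JC_plus P1) by auto 6 with bdd. rewrite <- (JC_scal P1) by auto 6 with bdd.
  rewrite <- (JC_plus P1) by auto 6 with bdd. rewrite <- (JC_scal P1) by auto 8 with bdd.
  rewrite <- (JC_plus P1) by auto 8 with bdd. apply (JC_ext P1); auto 9 with bdd.
  intros c s Hc. pose proof (hker_den_ne z c s Hz Hc) as N.
  unfold hker.
  set (w := (RtoC s - RtoC c * z)%C) in *.
  transitivity ((RtoC (s * s) * (RtoC c + RtoC s * z)) / w)%C; [field; auto|].
  transitivity ((RtoC (c * s) * w + z * (RtoC 1 * w + z * (RtoC (c * s) * w + RtoC (c * c) * (RtoC c + RtoC s * z)))) / w)%C; [|field; auto].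
  f_equal. unfold w.
  assert (E : RtoC (s * s) = (1 - RtoC (c * c))%C) by (rewrite <- RtoC_minus; f_equal; unfold circ in Hc; lra).
  rewrite !RtoC_mult in *.
  replace (RtoC c * RtoC s * (RtoC s - RtoC c * z))%C with ((RtoC s * RtoC s) * RtoC c - RtoC c * RtoC c * RtoC s * z)%C by ring.
  rewrite E. ring. }
rewrite (HR z Hz), S, Ecs, RtoC_opp, RtoC_plus. field. auto.
Qed.

End Reduce.
Arguments red J z : clear implicits.

(** Finiteness of the moment of order -2N at the origin, unfolded along the reduction mu -> t^-2
    mu. *)
Fixpoint Good (N : nat) (J : (R -> R -> R) -> R) : Prop :=
  match N with
  | O => True
  | S m => Good1 J /\ Good m (Jred J)
  end.

(** * Truncated moments of the functional *)

(** On the circle |s c| = |t| / (1 + t^2), so a single inequality cuts at 0 and at infinity,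
    comparably to e <= |t| <= 1/e, and it is invariant under t -> -1/t. *)
Definition tau (e c s : R) : R := if Rle_dec e (Rabs (s * c)) then 1 else 0.

(* [t^k (1 + t^2)] in homogeneous coordinates [t = s/c]: the weight [1 + t^2] turns the bounded
   functional into the unbounded representing measure. *)
Definition mk (k : Z) (c s : R) : R := powerRZ s k * powerRZ c (- k - 2).

Definition tmoment (k : Z) (e : R) (J : (R -> R -> R) -> R) : R := J (fun c s => mk k c s * tau e c s).

Lemma tau_01 e c s : 0 <= tau e c s <= 1.
Proof. unfold tau; destruct (Rle_dec _ _); lra. Qed.

Lemma tau_bdd e : bdd (tau e).
Proof. exists 1. intros c s _. pose proof (tau_01 e c s). rewrite Rabs_pos_eq; lra. Qed.

Lemma tau_cases e c s : (e <= Rabs (s * c) /\ tau e c s = 1) \/ (Rabs (s * c) < e /\ tau e c s = 0).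
Proof. unfold tau; destruct (Rle_dec _ _); [left|right]; split; auto; lra. Qed.

#[export] Hint Resolve tau_bdd : bdd.

Lemma sc_ge e c s : circ c s -> e <= Rabs (s * c) -> e <= Rabs s <= 1 /\ e <= Rabs c <= 1.
Proof.
intros Hc H. destruct (circ_le1 c s Hc). rewrite Rabs_mult in H. pose proof (Rabs_pos s). pose proof (Rabs_pos c). nra.
Qed.

Lemma powerRZ_bd x k e : 0 < e -> e <= Rabs x <= 1 -> Rabs (powerRZ x k) <= (/ e) ^ (Z.abs_nat k) + 1.
Proof.
intros He Hx. assert (P : 0 < / e) by (apply Rinv_0_lt_compat; auto).
assert (Q : forall n, 0 <= (/ e) ^ n) by (intros; apply pow_le; lra).
destruct k as [|p|p]; simpl.
- rewrite Rabs_R1. specialize (Q 0%nat). simpl in Q. lra.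
- rewrite <- RPow_abs. assert (Rabs x ^ Pos.to_nat p <= 1); [|specialize (Q (Pos.to_nat p)); lra].
  rewrite <- (pow1 (Pos.to_nat p)). apply pow_incr; lra.
- rewrite Rabs_inv, <- RPow_abs, <- pow_inv. assert (/ Rabs x ^ Pos.to_nat p = (/ Rabs x) ^ Pos.to_nat p) by (rewrite pow_inv; auto).
  assert ((/ Rabs x) ^ Pos.to_nat p <= (/ e) ^ Pos.to_nat p); [|rewrite ?H; lra].
  apply pow_incr. split; [apply Rlt_le, Rinv_0_lt_compat; lra|apply Rinv_le_contravar; lra].
Qed.

Lemma mt_bdd k e : 0 < e -> bdd (fun c s => mk k c s * tau e c s).
Proof.
intros He. exists (((/ e) ^ (Z.abs_nat k) + 1) * ((/ e) ^ (Z.abs_nat (- k - 2)) + 1)).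
assert (Q : forall n, 0 <= (/ e) ^ n) by (intros; apply pow_le, Rlt_le, Rinv_0_lt_compat; lra).
intros c s Hc. destruct (tau_cases e c s) as [[H ->]|[H ->]].
- destruct (sc_ge e c s Hc H). rewrite Rmult_1_r. unfold mk. rewrite Rabs_mult.
  apply Rmult_le_compat; auto using Rabs_pos, powerRZ_bd.
- rewrite Rmult_0_r, Rabs_R0. pose proof (Q (Z.abs_nat k)). pose proof (Q (Z.abs_nat (- k - 2))). nra.
Qed.

#[export] Hint Resolve mt_bdd : bdd.

Lemma sc_ne e c s : 0 < e -> e <= Rabs (s * c) -> s <> 0 /\ c <> 0.
Proof. intros He H; split; intros ->; rewrite ?Rmult_0_l, ?Rmult_0_r, Rabs_R0 in H; lra. Qed.

Lemma mk_shift k c s : s <> 0 -> c <> 0 -> mk (k + 2) c s = mk k c s * (s * s) / (c * c).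
Proof.
intros Hs Hc. unfold mk. replace (- (k + 2) - 2)%Z with ((- k - 2) + (- (2)))%Z by lia.
rewrite !powerRZ_add, powerRZ_neg' by auto. simpl. field. auto.
Qed.

Lemma tmoment_Jred J k e : posfun J -> Good1 J -> 0 < e -> tmoment (k + 2) e (Jred J) = tmoment k e J.
Proof.
intros HJ G He. unfold tmoment, Jred.
rewrite (J1_away HJ (fun c s => c * c * (mk (k + 2) c s * tau e c s)) e He); auto with bdd.
- apply (pf_ext HJ); auto with bdd.
  + apply (bdd_ext (fun c s => mk k c s * tau e c s)); auto with bdd.
    intros c s Hc. destruct (tau_cases e c s) as [[H ->]|[H ->]].
    * destruct (sc_ne e c s He H). rewrite mk_shift by auto. field. auto.
    * unfold Rdiv; ring.
  + intros c s Hc. destruct (tau_cases e c s) as [[H ->]|[H ->]].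
    * destruct (sc_ne e c s He H). rewrite mk_shift by auto. field. auto.
    * unfold Rdiv; ring.
- intros c s Hc Hs. destruct (tau_cases e c s) as [[H _]|[_ ->]]; [|ring].
  destruct (sc_ge e c s Hc H). lra.
Qed.

Lemma tau_rot e c s : tau e (- s) c = tau e c s.
Proof. unfold tau. replace (Rabs (c * - s)) with (Rabs (s * c)); auto. rewrite <- Rabs_Ropp. f_equal. ring. Qed.

(** Under t -> -1/t the factor 1 + t^2 becomes (1 + t^2) / t^2; hence the exponent -k-2 rather than
    -k. *)
Lemma mk_rot k c s : mk k (- s) c = powerRZ (-1) k * mk (- k - 2) c s.
Proof.
unfold mk. replace (- (- k - 2) - 2)%Z with k by lia.
replace (- s) with (-1 * s) by ring. rewrite powerRZ_mult.
assert (E : powerRZ (-1) (- k - 2) = powerRZ (-1) k).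
{ replace (- k - 2)%Z with (- k + (- (2)))%Z by lia. rewrite powerRZ_add, !powerRZ_neg' by lra.
  assert (S : powerRZ (-1) k * powerRZ (-1) k = 1).
  { rewrite <- powerRZ_mult. replace (-1 * -1) with 1 by ring. apply powerRZ_R1. }
  assert (N : powerRZ (-1) k <> 0) by (intros Z; rewrite Z in S; lra).
  simpl. replace (/ (-1 * (-1 * 1))) with 1 by field. rewrite Rmult_1_r.
  apply (Rmult_eq_reg_r (powerRZ (-1) k)); auto. rewrite S. apply Rinv_l; auto. }
rewrite E. ring.
Qed.

Lemma tmoment_Jinv J k e : posfun J -> 0 < e -> tmoment k e (Jinv J) = powerRZ (-1) k * tmoment (- k - 2) e J.
Proof.
intros HJ He. unfold tmoment, Jinv. rewrite <- (pf_scal _ HJ) by auto with bdd.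
apply f_equal. do 2 (apply FunctionalExtensionality.functional_extensionality; intro).
rewrite mk_rot, tau_rot. ring.
Qed.

Lemma tau_sc_lim P : posfun P -> lim0 (fun e => P (fun c s => tau e c s * (c * s))) (P (fun c s => c * s)).
Proof.
intros HP. apply (lim0_bound _ _ (P (fun _ _ => 1))); [apply (pf_1 HP)|].
intros e He. rewrite <- (pf_minus HP), Rmult_comm by auto with bdd. apply (pf_bound HP); auto with bdd.
intros c s Hc. destruct (tau_cases e c s) as [[H ->]|[H ->]].
- replace (1 * (c * s) - c * s) with 0 by ring. rewrite Rabs_R0; lra.
- replace (0 * (c * s) - c * s) with (- (s * c)) by ring. rewrite Rabs_Ropp; lra.
Qed.

Lemma tau_div_bdd f e : 0 < e -> bdd f -> bdd (fun c s => tau e c s * f c s / (s * s)).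
Proof.
intros He [B HB]. exists (B / (e * e)). intros c s Hc. specialize (HB c s Hc).
assert (0 <= B) by (pose proof (Rabs_pos (f c s)); lra).
destruct (tau_cases e c s) as [[H0 ->]|[H0 ->]].
- destruct (sc_ge e c s Hc H0) as [Hs _]. rewrite Rmult_1_l. unfold Rdiv. rewrite Rabs_mult, Rabs_inv, Rabs_mult.
  apply Rmult_le_compat; auto using Rabs_pos.
  + apply Rlt_le, Rinv_0_lt_compat. nra.
  + apply Rinv_le_contravar; nra.
- unfold Rdiv. rewrite !Rmult_0_l, Rabs_R0. apply Rmult_le_pos; auto. apply Rlt_le, Rinv_0_lt_compat; nra.
Qed.

Lemma J1_tau J f e : posfun J -> 0 < e -> bdd f ->
  J1 J (fun c s => tau e c s * f c s) = J (fun c s => tau e c s * f c s / (s * s)).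
Proof.
intros HJ He Hf. apply (J1_away HJ _ e He); auto with bdd.
intros c s Hc Hs. destruct (tau_cases e c s) as [[H _]|[_ ->]]; [|ring].
destruct (sc_ge e c s Hc H). lra.
Qed.

(** The weight splits as 1/(s c) = c/s + s/c. The first term is singular only at 0 and is handled by
    [J1 J], the second only at infinity and is handled by [J1 (Jinv J)]; this is why order -1 needs
    information at both ends. *)
Lemma tmoment_m1_lim J : posfun J -> Good1 J -> Good1 (Jinv J) ->
  lim0 (fun e => tmoment (-1) e J) (mxy J - mxy (Jinv J)).
Proof.
intros HJ G1 G2. pose proof (Jinv_posfun J HJ) as HT.
apply (lim0_ext (fun e => J1 J (fun c s => tau e c s * (c * s)) - J1 (Jinv J) (fun c s => tau e c s * (c * s)))).
- intros e He. rewrite (J1_tau J), (J1_tau (Jinv J)) by auto with bdd.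
  assert (B1 : bdd (fun c s => tau e c s * (c * s) / (s * s))) by (apply (tau_div_bdd (fun c s => c * s)); auto with bdd).
  assert (B2 : bdd (fun c s => tau e (- s) c * (- s * c) / (c * c))).
  { destruct B1 as [B HB]. exists B. intros c s Hc. exact (HB (- s) c (circ_rot c s Hc)). }
  change (Jinv J (fun c s => tau e c s * (c * s) / (s * s))) with (J (fun c s => tau e (- s) c * (- s * c) / (c * c))).
  unfold tmoment. rewrite <- (pf_minus HJ) by auto.
  apply (pf_ext HJ); auto with bdd.
  intros c s Hc. rewrite tau_rot.
  destruct (tau_cases e c s) as [[H ->]|[H ->]].
  + destruct (sc_ne e c s He H). unfold mk. simpl. unfold circ in Hc.
    transitivity ((c * c + s * s) / (s * c)); [field; auto|rewrite Hc; field; auto].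
  + unfold Rdiv; ring.
- unfold mxy. apply lim0_minus; apply tau_sc_lim; apply J1_posfun; auto.
Qed.

Lemma u_near c s f : circ c s -> 1 / 2 <= c * c -> 0 < f <= 1 -> 1 - c * c * u f c s <= 4 * (s * s) / (f * f).
Proof.
intros Hc Hcc Hf. pose proof (den_pos f c s ltac:(lra) Hc) as P. unfold circ in Hc.
assert (F : 0 < f * f <= 1) by nra.
assert (E : 1 - c * c * u f c s = (s * s + c * c * (s * s) * (f * f)) / (s * s + c * c * (f * f))).
{ unfold u. replace (s * s + c * c * (s * s) * (f * f)) with (s * s + c * c * (1 - c * c) * (f * f)) by (rewrite <- Hc; ring). field. lra. }
rewrite E. apply (Rmult_le_reg_r ((f * f) * (s * s + c * c * (f * f)))); [nra|].
replace ((s * s + c * c * (s * s) * (f * f)) / (s * s + c * c * (f * f)) * (f * f * (s * s + c * c * (f * f))))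
  with ((s * s) * (f * f) * (1 + c * c * (f * f))) by (field; lra).
replace (4 * (s * s) / (f * f) * (f * f * (s * s + c * c * (f * f)))) with ((s * s) * (4 * (s * s) + 4 * (c * c) * (f * f))) by (field; nra).
rewrite Rmult_assoc. apply Rmult_le_compat_l; [nra|].
assert (c * c <= 1) by nra. assert (c * c * (f * f) <= 1 * 1) by (apply Rmult_le_compat; nra).
assert ((f * f) * (c * c * (f * f)) <= (f * f) * 1) by (apply Rmult_le_compat_l; lra).
assert (1/2 * (f * f) <= c * c * (f * f)) by (apply Rmult_le_compat_r; lra). nra.
Qed.

Lemma u_rot_bdd f : 0 < f -> bdd (fun c s => u f (- s) c).
Proof.
intros Hf. exists 1. intros c s Hc. pose proof (u_01 f (- s) c Hf (circ_rot c s Hc)). rewrite Rabs_pos_eq; lra.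
Qed.

Lemma u_le f c s : 0 < f -> s <> 0 -> circ c s -> u f c s <= (f * f) * (c * c) / (s * s).
Proof.
intros Hf Hs Hc. unfold u. replace (c * c * (f * f)) with (f * f * (c * c)) by ring. apply Rmult_le_compat_l; [nra|].
assert (0 < s * s) by nra. apply Rinv_le_contravar; nra.
Qed.

(** The moment of order -2 is [J1 J (tau e)], and the cutoff removes in the limit the masses of
    [J1 J] at s = 0 and at c = 0. The discontinuous function 1 - [tau e] is enclosed by means of the
    functions [u], whose limits are known. *)
Lemma tmoment_m2_lim J al at' : posfun J -> Good1 J -> atom (Jred J) al -> atom (Jinv J) at' ->
  lim0 (fun e => tmoment (-2) e J) (mtot J - al - at').
Proof.
intros HJ G1 [Hal _] [Hat _]. pose proof (J1_posfun HJ G1) as P1.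
unfold mtot. set (T := J1 J (fun _ _ => 1)). assert (T0 : 0 <= T) by apply (pf_1 P1).
set (P := fun f => J1 J (fun c s => c * c * u f c s + s * s * u f (- s) c)).
(* At s = 0 the mass of [J1 J] is the point mass of [Jred J], since c^2 = 1 there. At c = 0 the
   factor s^2 cancels the s^-2 of [J1 J] and leaves the point mass of [Jinv J]. *)
assert (HP : lim0 P (al + at')).
{ apply (lim0_ext (fun f => Jred J (u f) + Jinv J (u f))); [|apply lim0_plus; auto].
  intros f Hf. pose proof (u_bdd f Hf). pose proof (u_rot_bdd f Hf). unfold P. rewrite (pf_add _ P1) by auto with bdd.
  unfold Jred. f_equal. unfold Jinv. apply (J1_absorb HJ _ (f * f * / Rmin 1 (f * f))); auto.
  intros c s Hc. pose proof (u_01 f (- s) c Hf (circ_rot c s Hc)) as U. rewrite Rabs_pos_eq by lra.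
  pose proof (den_low f (- s) c (circ_rot c s Hc)) as D.
  assert (M : 0 < Rmin 1 (f * f)) by (apply Rmin_pos; [lra|nra]).
  destruct (circ_le1 c s Hc) as [_ Hs]. pose proof (Rabs_pos s).
  apply Rle_trans with ((Rabs s * (f * f)) * / Rmin 1 (f * f)); [|right; ring].
  unfold u, Rdiv. apply Rmult_le_compat; [nra| | |apply Rinv_le_contravar; auto].
  - apply Rlt_le, Rinv_0_lt_compat. lra.
  - apply Rmult_le_compat_r; [nra|]. replace (- s * - s) with (Rabs s * Rabs s) by (rewrite Rabs_sq; ring). nra. }
apply (lim0_ext (fun e => T - J1 J (fun c s => 1 - tau e c s))).
{ intros e He. rewrite (pf_minus P1) by auto with bdd. fold T. unfold tmoment.
  replace (T - (T - J1 J (tau e))) with (J1 J (tau e)) by ring.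
  rewrite (pf_ext P1 (tau e) (fun c s => tau e c s * 1)); auto with bdd.
  - rewrite (J1_tau J (fun _ _ => 1)) by auto with bdd. f_equal.
    do 2 (apply FunctionalExtensionality.functional_extensionality; intro). unfold mk. simpl.
    unfold Rdiv. rewrite !Rmult_1_r. ring.
  - intros; ring. }
replace (T - al - at') with (T - (al + at')) by ring.
apply lim0_minus; [apply lim0_const|].
intros eps Heps. destruct (HP (eps / 2) ltac:(lra)) as [f0 [Hf0 K]].
set (f := Rmin 1 (f0 / 2)). assert (Hf : 0 < f) by (apply Rmin_pos; lra).
assert (Hf1 : f <= 1) by apply Rmin_l. assert (Hf2 : f <= f0 / 2) by apply Rmin_r.
specialize (K f ltac:(lra)). apply Rabs_def2 in K.
clearbody f. assert (F2 : 0 < f * f) by (apply Rmult_lt_0_compat; auto).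
assert (D0 : 0 < eps * (f * f) / (16 * (T + 1))) by (apply Rdiv_lt_0_compat; [apply Rmult_lt_0_compat; auto|lra]).
exists (Rmin 1 (eps * (f * f) / (16 * (T + 1)))); split; [apply Rmin_pos; lra|].
intros e [He He2]. pose proof (Rmin_l 1 (eps * (f * f) / (16 * (T + 1)))). pose proof (Rmin_r 1 (eps * (f * f) / (16 * (T + 1)))).
assert (X : e < eps * (f * f) / (16 * (T + 1))) by lra. apply lt_div_mult in X; [|lra].
pose proof (u_bdd f Hf) as Bu. pose proof (u_rot_bdd f Hf) as Bu'.
(* Where |s c| < e, one of s^2 and c^2 is at most 2 e^2 and [u_near] makes the corresponding term of
   [P f] close to 1. *)
assert (Up : J1 J (fun c s => 1 - tau e c s) <= P f + 8 * (e * e) / (f * f) * T).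
{ unfold P, T. rewrite <- (pf_const P1), <- (pf_add _ P1) by auto 7 with bdd. apply (pf_mono _ P1); auto 8 with bdd.
  intros c s Hc. pose proof (u_01 f c s Hf Hc) as U1. pose proof (u_01 f (- s) c Hf (circ_rot c s Hc)) as U2.
  assert (Q0 : 0 <= 8 * (e * e) / (f * f)) by (apply Rdiv_le_0_compat; nra).
  assert (0 <= c * c * u f c s) by nra. assert (0 <= s * s * u f (- s) c) by nra.
  destruct (tau_cases e c s) as [[H3 ->]|[H3 ->]]; [lra|].
  assert (Hsc : s * s * (c * c) < e * e).
  { replace (s * s * (c * c)) with (Rabs (s * c) * Rabs (s * c)) by (rewrite Rabs_sq; ring).
    pose proof (Rabs_pos (s * c)). nra. }
  assert (W : forall x, 4 * x <= 8 * (e * e) -> 4 * x / (f * f) <= 8 * (e * e) / (f * f)).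
  { intros x Hx. apply Rmult_le_compat_r; auto. apply Rlt_le, Rinv_0_lt_compat; nra. }
  assert (Hc' := Hc). unfold circ in Hc'.
  destruct (Rle_dec (1/2) (c * c)) as [C|C].
  - pose proof (u_near c s f Hc C ltac:(lra)). specialize (W (s * s) ltac:(nra)). lra.
  - pose proof (u_near (- s) c f (circ_rot c s Hc) ltac:(nra) ltac:(lra)) as Q. specialize (W (c * c) ltac:(nra)).
    replace (- s * - s * u f (- s) c) with (s * s * u f (- s) c) in Q by ring. lra. }
(* Where [tau e] is 1, both |s| and |c| are at least e and each term of [P f'] is at most f'^2 /
   e^2; this error vanishes as f' tends to 0 with e fixed. *)
assert (Lo : al + at' <= J1 J (fun c s => 1 - tau e c s)).
{ apply (lim0_le (fun f => P f - f * f * (2 / (e * e) * T))).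
  - intros f' Hf'. unfold P, T. pose proof (u_bdd f' Hf') as Bv. pose proof (u_rot_bdd f' Hf') as Bv'.
    rewrite <- Rmult_assoc, <- (pf_const P1), <- (pf_minus P1) by auto 7 with bdd.
    apply (pf_mono _ P1); auto 8 with bdd. intros c s Hc.
    pose proof (u_01 f' c s Hf' Hc) as U1. pose proof (u_01 f' (- s) c Hf' (circ_rot c s Hc)) as U2.
    assert (Hc' := Hc). unfold circ in Hc'.
    assert (Q0 : 0 <= f' * f' * (2 / (e * e))) by (apply Rmult_le_pos; [nra|apply Rdiv_le_0_compat; nra]).
    destruct (tau_cases e c s) as [[H3 ->]|[H3 ->]].
    + destruct (sc_ge e c s Hc H3) as [[S1 _] [S2 _]]. destruct (sc_ne e c s He H3) as [N1 N2].
      assert (E1 : e * e <= s * s) by (replace (s * s) with (Rabs s * Rabs s) by (rewrite Rabs_sq; ring); nra).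
      assert (E2 : e * e <= c * c) by (replace (c * c) with (Rabs c * Rabs c) by (rewrite Rabs_sq; ring); nra).
      pose proof (u_le f' c s Hf' N1 Hc) as L1. pose proof (u_le f' (- s) c Hf' N2 (circ_rot c s Hc)) as L2.
      assert (M1 : f' * f' * (c * c) / (s * s) <= f' * f' * / (e * e)).
      { unfold Rdiv. rewrite Rmult_assoc. apply Rmult_le_compat_l; [nra|].
        rewrite <- (Rmult_1_l (/ (e * e))). apply Rmult_le_compat; [nra|apply Rlt_le, Rinv_0_lt_compat; nra|nra|apply Rinv_le_contravar; nra]. }
      assert (M2 : f' * f' * (- s * - s) / (c * c) <= f' * f' * / (e * e)).
      { unfold Rdiv. rewrite Rmult_assoc. apply Rmult_le_compat_l; [nra|].
        rewrite <- (Rmult_1_l (/ (e * e))). apply Rmult_le_compat; [nra|apply Rlt_le, Rinv_0_lt_compat; nra|nra|apply Rinv_le_contravar; nra]. }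
      replace (f' * f' * (2 / (e * e))) with (f' * f' * / (e * e) + f' * f' * / (e * e)) by (field; lra).
      assert (c * c * u f' c s <= 1 * u f' c s) by (apply Rmult_le_compat_r; nra).
      assert (s * s * u f' (- s) c <= 1 * u f' (- s) c) by (apply Rmult_le_compat_r; nra). lra.
    + assert (c * c * u f' c s <= c * c * 1) by (apply Rmult_le_compat_l; nra).
      assert (s * s * u f' (- s) c <= s * s * 1) by (apply Rmult_le_compat_l; nra). lra.
  - replace (al + at') with (al + at' - 0) by ring. apply lim0_minus; auto.
    apply (lim0_bound _ _ (2 / (e * e) * T)); [apply Rmult_le_pos; auto; apply Rdiv_le_0_compat; nra|].
    intros x Hx. rewrite Rminus_0_r, Rabs_pos_eq.
    + rewrite Rmult_comm. apply Rmult_le_compat_l; [|nra]. apply Rmult_le_pos; auto; apply Rdiv_le_0_compat; nra.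
    + apply Rmult_le_pos; [nra|]. apply Rmult_le_pos; auto; apply Rdiv_le_0_compat; nra. }
assert (Q : 8 * (e * e) / (f * f) * T <= eps / 2).
{ apply (Rmult_le_reg_r (f * f)); [nra|]. replace (8 * (e * e) / (f * f) * T * (f * f)) with (8 * (e * e) * T) by (field; lra).
  assert (e * e <= e) by nra. nra. }
apply Rabs_def1; lra.
Qed.

(** * Expansions of one Herglotz function at the origin and its moments *)

Definition addc (a : R) (A : nat -> R) (j : nat) : R := match j with O => a + A O | S i => A (S i) end.

Lemma pexp_addc F n A a : pexp F n A -> pexp (fun z => RtoC a + F z)%C n (addc a A).
Proof.
intros H k Hk eps He. destruct (H k Hk eps He) as [d [Hd K]]. exists d; split; auto.
intros z Hz Hzd. specialize (K z Hz Hzd).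
replace (RtoC a + F z - hpoly n (addc a A) z)%C with (F z - hpoly n A z)%C; auto.
destruct n; simpl; rewrite RtoC_plus; [ring|]. ring.
Qed.

Definition kcons (a b : R) (A : nat -> R) (j : nat) : R :=
  match j with O => a | S O => b | S (S i) => A i end.

(** The weight c^2 in [Jred] vanishes at infinity, which leaves no point mass there. *)
Lemma Jinv_Jred_no_atom J al : posfun J -> Good1 J -> atom (Jinv (Jred J)) al -> al = 0.
Proof.
intros HJ G [Ha _]. pose proof (J1_posfun HJ G) as P1.
apply (lim0_unique (fun f => Jinv (Jred J) (u f))); auto.
apply (lim0_bound _ _ (J1 J (fun _ _ => 1))); [apply (pf_1 P1)|].
intros f Hf. rewrite Rminus_0_r, Rmult_comm. unfold Jinv, Jred.
pose proof (u_rot_bdd f ltac:(lra)) as Bu.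
apply (pf_bound P1); auto with bdd. intros c s Hc.
pose proof (u_01 f (- s) c ltac:(lra) (circ_rot c s Hc)) as U. rewrite Rabs_pos_eq by nra.
pose proof (den_pos f (- s) c ltac:(lra) (circ_rot c s Hc)) as P. unfold circ in Hc.
unfold u. apply (Rmult_le_reg_r (c * c + - s * - s * (f * f))); auto.
replace (c * c * (- s * - s * (f * f) / (c * c + - s * - s * (f * f))) * (c * c + - s * - s * (f * f)))
  with ((c * c) * ((s * s) * (f * f))) by (field; lra).
assert (A : (s * s) * (f * f) <= 1 * f) by (apply Rmult_le_compat; nra).
assert (c * c * (s * s * (f * f)) <= c * c * f) by (apply Rmult_le_compat_l; nra).
assert (0 <= s * s * (f * f)) by nra. nra.
Qed.

Lemma Good1_Jinv_Jred J : posfun J -> Good1 J -> Good1 (Jinv (Jred J)).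
Proof.
intros HJ G. pose proof (J1_posfun HJ G) as P1. exists (1 * J1 J (fun _ _ => 1)). intros d Hd.
unfold Jinv, Jred.
assert (B : bdd (fun c s => c * c * wd d (- s) c)).
{ destruct (wd_bdd d Hd) as [B HB]. apply bdd_mult; [auto with bdd|]. exists B. intros c s Hc. apply HB, circ_rot; auto. }
apply (pf_le_const P1); auto. intros c s Hc. destruct (wd_s2 d (- s) c Hd). lra.
Qed.

(** At infinity the weight c^2 of [Jred] cancels the c^-2 of the outer [J1], and the quarter turn
    changes c s into - s c. *)
Lemma mxy_Jinv_Jred J : posfun J -> Good1 J -> mxy (Jinv (Jred J)) = - mxy J.
Proof.
intros HJ G. pose proof (J1_posfun HJ G) as P1. unfold mxy. apply J1_lim.
apply (lim0_bound _ _ (J1 J (fun _ _ => 1))); [apply (pf_1 P1)|].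
intros d Hd. unfold Jinv, Jred.
assert (B : bdd (fun c s => wd d (- s) c)).
{ destruct (wd_bdd d ltac:(lra)) as [B HB]. exists B. intros c s Hc. apply HB, circ_rot; auto. }
replace (J1 J (fun c s => c * c * (wd d (- s) c * (- s * c))) - - J1 J (fun c s => c * s)) with
  (J1 J (fun c s => c * c * (wd d (- s) c * (- s * c))) + J1 J (fun c s => c * s)) by ring.
rewrite <- (pf_add _ P1), Rmult_comm by auto 6 with bdd.
apply (pf_bound P1); auto 7 with bdd. intros c s Hc.
replace (c * c * (wd d (- s) c * (- s * c)) + c * s) with ((1 - c * c * wd d (- s) c) * (c * s)) by ring.
destruct (wd_s2 d (- s) c ltac:(lra)) as [W0 W1]. rewrite Rabs_mult, (Rabs_pos_eq (1 - _)), Rabs_mult by auto.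
destruct (circ_le1 c s Hc) as [C1 S1]. pose proof (Rabs_pos c). pose proof (Rabs_pos s).
apply Rle_trans with ((2 * (d * d) / (c * c + d * d)) * (Rabs c * 1)).
{ apply Rmult_le_compat; auto; [nra|]. apply Rmult_le_compat_l; auto. }
assert (P : 0 < c * c + d * d) by nra.
apply (Rmult_le_reg_r (c * c + d * d)); auto.
replace (2 * (d * d) / (c * c + d * d) * (Rabs c * 1) * (c * c + d * d)) with (d * (2 * d * Rabs c)) by (field; lra).
apply Rmult_le_compat_l; [lra|].
replace (c * c) with (Rabs c * Rabs c) by (rewrite Rabs_sq; ring).
pose proof (Rle_0_sqr (Rabs c - d)) as Q. unfold Rsqr in Q. lra.
Qed.

(** The entries below k = 3 involve more than mu near 0: [A 1] contains the constant [g], and [A 2]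
    the point mass at infinity, which the kernel turns into a linear term. From k = 3 on, the weight
    c^2 of [Jred] has removed infinity and the coefficients are plain moments. *)
Lemma expansion_of_good N : forall J g h, posfun J -> Rep g J h -> Good N J ->
  exists A, pexp (fun z => z * h z)%C (2 * N) A /\
    (forall al, atom J al -> A O = - al) /\
    ((1 <= N)%nat -> A 1%nat = g + mxy J) /\
    ((1 <= N)%nat -> forall al, atom (Jinv J) al -> lim0 (fun e => tmoment (-2) e J) (A 2%nat - al)) /\
    (forall k : nat, (3 <= k <= 2 * N)%nat -> lim0 (fun e => tmoment (- Z.of_nat k) e J) (A k)).
Proof.
induction N; intros J g h HJ HR HG.
- destruct (atom_ex J HJ) as [al [_ Hal]]. exists (fun _ => - al). repeat split; try (intros; lia).
  + now apply (exp_order0 g J h al).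
  + intros al' Hal'. f_equal. apply (lim0_unique _ _ _ (proj1 Hal) (proj1 Hal')).
- destruct HG as [G1 GN]. pose proof (Jred_posfun HJ G1) as HJp.
  destruct (IHN (Jred J) _ (red J) HJp red_rep GN) as [A' [E' [I0 [I1 [I2 I3]]]]].
  destruct (atom_ex J HJ) as [al [_ Hal]].
  exists (kcons (- al) (g + mxy J) (addc (mtot J) A')).
  split; [|split; [|split; [|split]]].
  + replace (2 * S N)%nat with (S (S (2 * N))) by lia.
    apply (pexp_step (fun z => RtoC (g + mxy J) + z * (RtoC (mtot J) + z * red J z))%C).
    * apply (pexp_step (fun z => RtoC (mtot J) + z * red J z)%C).
      -- change (pexp (fun z => RtoC (mtot J) + (fun z => z * red J z) z)%C (2 * N) (addc (mtot J) A')).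
         apply pexp_addc. exact E'.
      -- reflexivity.
    * intros z Hz. apply (reduce HJ G1 g h al z HR Hal Hz).
  + intros al' Hal'. simpl. f_equal. apply (lim0_unique _ _ _ (proj1 Hal) (proj1 Hal')).
  + reflexivity.
  + intros _ at' Hat'. simpl. destruct (atom_ex (Jred J) HJp) as [al1 [_ Hal1]].
    rewrite (I0 al1 Hal1). apply (tmoment_m2_lim J al1 at'); auto.
  + intros k Hk. destruct N as [|N]; [lia|].
    (* Orders shift by two under [Jred]: k = 3 is its moment of order -1, k = 4 its moment of order
       -2 with no mass at infinity, and k >= 5 is the induction hypothesis. *)
    destruct k as [|[|[|[|[|k]]]]]; try lia.
    * destruct GN as [G1' _]. simpl kcons. simpl addc.
      rewrite (I1 ltac:(lia)). replace (mxy J + mxy (Jred J)) with (mxy (Jred J) - mxy (Jinv (Jred J))) by (rewrite (mxy_Jinv_Jred J) by auto; ring).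
      apply (lim0_ext (fun e => tmoment (-1) e (Jred J))); [|apply tmoment_m1_lim; auto using Good1_Jinv_Jred].
      intros e He. apply (tmoment_Jred J (-3) e HJ G1 He).
    * simpl kcons. simpl addc. destruct (atom_ex (Jinv (Jred J)) (Jinv_posfun _ HJp)) as [a2 [_ Ha2]].
      pose proof (I2 ltac:(lia) a2 Ha2) as L. rewrite (Jinv_Jred_no_atom J a2 HJ G1 Ha2), Rminus_0_r in L.
      revert L. apply lim0_ext. intros e He. apply (tmoment_Jred J (-4) e HJ G1 He).
    * change (kcons (- al) (g + mxy J) (addc (mtot J) A') (S (S (S (S (S k)))))) with (A' (S (S (S k)))).
      apply (lim0_ext (fun e => tmoment (- Z.of_nat (S (S (S k)))) e (Jred J))); [|apply I3; lia].
      intros e He. replace (- Z.of_nat (S (S (S k))))%Z with (- Z.of_nat (S (S (S (S (S k))))) + 2)%Z by lia.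
      apply tmoment_Jred; auto.
Qed.

(** On the imaginary axis the real part of z h is -J(v y), so J(v y) = - A 0 + (A 2) y^2 up to y^2.
    Comparing the scales y and 2 y cancels the point mass in [A 0], and v(2y) - v(y) dominates 3 y^2
    [wd (2 * y)]. *)
Lemma good1_of_iexp J g h A : posfun J -> Rep g J h -> iexp (fun z => z * h z)%C 2 A -> Good1 J.
Proof.
intros HJ HR H. destruct (H 1 Rlt_0_1) as [d [Hd K]].
set (v := fun y c s => y * y / (s * s + c * c * (y * y))).
assert (Bv : forall y, 0 < y -> bdd (v y)) by (intros; apply bdd_over_den; auto with bdd).
assert (E : forall y, 0 < y < d -> Rabs (J (v y) + A O - A 2%nat * (y * y)) <= y * y).
{ intros y Hy. specialize (K y Hy). assert (U : upper (0, y)) by (unfold upper; simpl; lra).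
  pose proof (re_le_Cmod ((0, y) * h (0, y) - hpoly 2 A (0, y))) as L.
  rewrite (HR _ U) in L, K.
  assert (X : Re ((0, y) * (RtoC g + JC J (hker (0, y))) - hpoly 2 A (0, y))%C = - (J (v y) + A O - A 2%nat * (y * y))).
  { rewrite Re_minus, Re_mult, Im_plus. simpl hpoly.
    replace (J (v y)) with (y * Im (JC J (hker (0, y)))).
    - simpl. unfold Im, Re. ring.
    - change (Im (JC J (hker (0, y)))) with (J (fun c s => Im (hker (0, y) c s))). rewrite <- (pf_scal _ HJ) by (apply cbdd_Im, hker_bdd; auto).
      apply (pf_ext HJ); auto.
      + apply bdd_mult; [auto with bdd|]. apply cbdd_Im, hker_bdd; auto.
      + intros c s Hc. rewrite Im_hker by auto. simpl. pose proof (den_pos y c s ltac:(lra) Hc).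
        unfold v. replace ((s - c * 0) * (s - c * 0) + c * y * (c * y)) with (s * s + c * c * (y * y)) by ring. field. lra. }
  rewrite X, Rabs_Ropp in L. lra. }
(* The two errors y^2 and 4 y^2 add up to 5 y^2, which is at most 2 times 3 y^2. *)
set (B := Rabs (A 2%nat) + 2).
assert (W : forall y, 0 < y < d / 2 -> J (wd (2 * y)) <= B).
{ intros y Hy. pose proof (E y ltac:(lra)) as E1. pose proof (E (2 * y) ltac:(lra)) as E2.
  assert (Y : 0 < y * y) by nra.
  assert (M : 3 * (y * y) * J (wd (2 * y)) <= J (v (2 * y)) - J (v y)).
  { rewrite <- (pf_minus HJ), <- (pf_scal _ HJ) by (try apply Bv; try apply wd_bdd; lra).
    apply (pf_mono _ HJ).
    - apply bdd_mult; [auto with bdd|apply wd_bdd; lra].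
    - apply bdd_minus; apply Bv; lra.
    - intros c s Hc. pose proof (den_pos y c s ltac:(lra) Hc) as D1. pose proof (den_pos (2 * y) c s ltac:(lra) Hc) as D2.
      assert (X : v (2 * y) c s - v y c s = 3 * (y * y) * (s * s / ((s * s + c * c * (y * y)) * (s * s + c * c * (2 * y * (2 * y)))))).
      { unfold v. field. split; lra. }
      rewrite X. apply Rmult_le_compat_l; [lra|]. unfold wd. apply Rmult_le_compat_l; [nra|].
      unfold circ in Hc. assert (C1 : c * c <= 1) by nra.
      apply Rinv_le_contravar; [apply Rmult_lt_0_compat; auto|].
      assert (c * c * (y * y) <= 1 * (y * y)) by (apply Rmult_le_compat_r; lra).
      apply Rmult_le_compat; nra. }
  apply Rabs_le_between in E1. apply Rabs_le_between in E2.
  pose proof (Rle_abs (A 2%nat)) as PA. pose proof (Rabs_pos (A 2%nat)).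
  apply (Rmult_le_reg_l (3 * (y * y))); [lra|]. unfold B. nra. }
exists B. intros e He.
set (y := Rmin (e / 2) (d / 4)). assert (Hy : 0 < y) by (apply Rmin_pos; lra).
assert (Hy1 : y <= e / 2) by apply Rmin_l. assert (Hy2 : y <= d / 4) by apply Rmin_r.
eapply Rle_trans; [|apply (W y); lra].
apply (pf_mono _ HJ); try (apply wd_bdd; lra). intros c s _. apply wd_anti. lra.
Qed.

Lemma good_of_iexp N : forall J g h A, posfun J -> Rep g J h ->
  iexp (fun z => z * h z)%C (2 * N) A -> Good N J.
Proof.
induction N; intros J g h A HJ HR H; [exact I|].
assert (H2 : iexp (fun z => z * h z)%C 2 A) by (revert H; apply iexp_trunc; lia).
pose proof (good1_of_iexp J g h A HJ HR H2) as G1. split; [exact G1|].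
pose proof (Jred_posfun HJ G1) as HJp.
(* The first two coefficients must agree with those of [reduce] before they can be stripped; the
   direct implication for N = 1 and uniqueness provide this. *)
destruct (expansion_of_good 1 J g h HJ HR (conj G1 I)) as [B [HB [B0 [B1 _]]]].
pose proof (iexp_unique _ _ _ _ H2 (pexp_iexp _ _ _ HB)) as Eq.
destruct (atom_ex J HJ) as [al [_ Hal]].
assert (A0 : A O = - al) by (rewrite (Eq O) by lia; auto).
assert (A1 : A 1%nat = g + mxy J) by (rewrite (Eq 1%nat) by lia; auto).
replace (2 * S N)%nat with (S (S (2 * N))) in H by lia.
apply (iexp_unstep (fun z => RtoC (g + mxy J) + z * (RtoC (mtot J) + z * red J z))%C) in H.
2:{ intros y Hy. rewrite A0. apply (reduce HJ G1); auto. }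
apply (iexp_unstep (fun z => RtoC (mtot J) + z * red J z)%C) in H.
2:{ intros y Hy. now rewrite A1. }
apply (IHN (Jred J) _ (red J) (addc (- mtot J) (fun j => A (S (S j)))) HJp red_rep).
intros eps He. destruct (H eps He) as [d [Hd K]]. exists d; split; auto. intros y Hy. specialize (K y Hy).
replace ((0, y) * red J (0, y) - hpoly (2 * N) (addc (- mtot J) (fun j => A (S (S j)))) (0, y))%C with
  (RtoC (mtot J) + (0, y) * red J (0, y) - hpoly (2 * N) (fun j => A (S (S j))) (0, y))%C; auto.
destruct (2 * N)%nat; simpl; rewrite RtoC_plus, RtoC_opp; ring.
Qed.

Lemma mk_even_pos k c s : 0 <= mk (2 * k) c s.
Proof.
assert (Q : forall x j, 0 <= powerRZ x (2 * j)).
{ intros x j. replace (2 * j)%Z with (j + j)%Z by lia.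
  (* A negative power of 0 is [/ 0], which evaluates to 0. *)
  destruct (Req_dec x 0) as [->|N].
  - destruct j; simpl; try lra.
    + apply pow_le; lra.
    + destruct (Rle_lt_or_eq_dec 0 (0 ^ Pos.to_nat (p + p))) as [L|L]; [apply pow_le; lra| |].
      * apply Rlt_le, Rinv_0_lt_compat; auto.
      * rewrite <- L, Rinv_0. lra.
  - rewrite powerRZ_add by auto. nra. }
unfold mk. replace (- (2 * k) - 2)%Z with (2 * (- k - 1))%Z by lia.
apply Rmult_le_pos; apply Q.
Qed.

Lemma mk_even_step k c s : (1 <= k)%Z -> circ c s -> 1 / 2 <= c * c -> s <> 0 ->
  mk (-2) c s <= 2 ^ (Z.to_nat k) * mk (- 2 * k) c s.
Proof.
intros Hk Hc Hcc Hs. unfold circ in Hc. assert (Hc0 : c <> 0) by nra.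
assert (E : forall n : nat, mk (-2) c s <= 2 ^ n * mk (-2 + - 2 * Z.of_nat n) c s).
{ induction n; [simpl; lra|]. eapply Rle_trans; [apply IHn|].
  replace (-2 + -2 * Z.of_nat n)%Z with ((-2 + -2 * Z.of_nat (S n)) + 2)%Z by lia.
  rewrite mk_shift by auto. simpl pow.
  assert (P : 0 <= mk (-2 + -2 * Z.of_nat (S n)) c s).
  { replace (-2 + -2 * Z.of_nat (S n))%Z with (2 * (-1 - Z.of_nat (S n)))%Z by lia. apply mk_even_pos. }
  assert (Q : s * s / (c * c) <= 2).
  { apply (Rmult_le_reg_r (c * c)); [nra|]. unfold Rdiv. rewrite Rmult_assoc, Rinv_l by nra. nra. }
  replace (2 ^ n * (mk (-2 + -2 * Z.of_nat (S n)) c s * (s * s) / (c * c))) with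
    ((2 ^ n * mk (-2 + -2 * Z.of_nat (S n)) c s) * (s * s / (c * c))) by (field; auto).
  assert (0 <= 2 ^ n * mk (-2 + -2 * Z.of_nat (S n)) c s) by (apply Rmult_le_pos; auto; apply pow_le; lra).
  nra. }
specialize (E (Z.to_nat (k - 1))). replace (-2 + -2 * Z.of_nat (Z.to_nat (k - 1)))%Z with (- 2 * k)%Z in E by lia.
eapply Rle_trans; [apply E|]. apply Rmult_le_compat_r.
- replace (- 2 * k)%Z with (2 * (- k))%Z by lia. apply mk_even_pos.
- apply Rle_pow; [lra|lia].
Qed.

Lemma mk_m2 c s : mk (-2) c s = / (s * s).
Proof. unfold mk. simpl. rewrite !Rmult_1_r. reflexivity. Qed.

(** The weight [wd d] does not vanish near s = 0 beyond the cutoff, so the cutoff is chosen in terms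
    of [d], while the resulting bound does not depend on [d]. *)
Lemma good1_of_bounded J k B e0 : posfun J -> (1 <= k)%Z -> 0 < e0 ->
  (forall e, 0 < e < e0 -> tmoment (- 2 * k) e J <= B) -> Good1 J.
Proof.
intros HJ Hk He0 HB.
set (T := J (fun _ _ => 1)). assert (HT : 0 <= T) by apply (pf_1 HJ).
exists (2 ^ Z.to_nat k * B + 4 * T). intros d Hd.
(* With e <= d^2 / 2, the part of |s c| < e near s = 0 has s^2 <= 2 e^2 and hence [wd d] <= s^2 /
   d^4 <= 1. *)
set (e := Rmin (e0 / 2) (d * d / 2)).
assert (Hdd : 0 < d * d) by nra.
assert (He : 0 < e) by (apply Rmin_pos; lra).
assert (E1 : e <= e0 / 2) by apply Rmin_l. assert (E2 : e <= d * d / 2) by apply Rmin_r.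
clearbody e.
apply Rle_trans with (2 ^ Z.to_nat k * tmoment (- 2 * k) e J + 4 * T).
- unfold tmoment, T. rewrite <- (pf_const HJ), <- (pf_scal _ HJ), <- (pf_add _ HJ) by auto with bdd.
  apply (pf_mono _ HJ); auto using wd_bdd with bdd.
  intros c s Hc. assert (Hc' := Hc). unfold circ in Hc'.
  assert (P2 : 0 < 2 ^ Z.to_nat k) by (apply pow_lt; lra).
  assert (PM : 0 <= mk (- 2 * k) c s) by (replace (- 2 * k)%Z with (2 * (- k))%Z by lia; apply mk_even_pos).
  assert (W : wd d c s <= / (s * s) \/ s = 0).
  { destruct (Req_dec s 0) as [|N]; [now right|left].
    unfold wd. assert (0 < s * s) by nra. apply (Rmult_le_reg_r (s * s)); auto. rewrite Rinv_l by lra.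
    destruct (wd_s2 d c s Hd) as [W0 _]. unfold wd in W0. lra. }
  destruct (Rle_dec (1/2) (s * s)) as [S|S].
  + destruct W as [W|W]; [|subst; lra].
    assert (/ (s * s) <= / (1/2)) by (apply Rinv_le_contravar; lra).
    pose proof (tau_01 e c s). assert (0 <= 2 ^ Z.to_nat k * (mk (-2 * k) c s * tau e c s)) by (apply Rmult_le_pos; nra). lra.
  + destruct (tau_cases e c s) as [[H ->]|[H ->]].
    * destruct (sc_ne e c s He H) as [N1 N2]. destruct W as [W|W]; [|lra].
      rewrite <- (mk_m2 c s) in W. pose proof (mk_even_step k c s Hk Hc ltac:(lra) N1). lra.
    * assert (Hsc : s * s * (c * c) <= e * e).
      { replace (s * s * (c * c)) with (Rabs (s * c) * Rabs (s * c)) by (rewrite Rabs_sq; ring).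
        pose proof (Rabs_pos (s * c)). nra. }
      assert (Hs : s * s <= 2 * (e * e)) by nra.
      assert (W4 : wd d c s <= s * s / (d * d * (d * d))).
      { unfold wd. apply Rmult_le_compat_l; [nra|]. apply Rinv_le_contravar; [nra|]. apply Rmult_le_compat; nra. }
      assert (s * s / (d * d * (d * d)) <= 1).
      { apply (Rmult_le_reg_r (d * d * (d * d))); [nra|]. unfold Rdiv. rewrite Rmult_assoc, Rinv_l by nra.
        assert (e * e <= d * d / 2 * (d * d / 2)) by (apply Rmult_le_compat; lra).
        assert (0 < d * d * (d * d)) by (apply Rmult_lt_0_compat; auto). lra. }
      lra.
- specialize (HB e ltac:(lra)). assert (0 < 2 ^ Z.to_nat k) by (apply pow_lt; lra). nra.
Qed.

Lemma good_of_bounded N : forall J B e0, posfun J -> 0 < e0 ->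
  (forall e, 0 < e < e0 -> tmoment (- 2 * Z.of_nat N) e J <= B) -> Good N J.
Proof.
induction N; intros J B e0 HJ He0 HB; [exact I|].
assert (G1 : Good1 J) by (apply (good1_of_bounded J (Z.of_nat (S N)) B e0); auto; lia).
split; auto. apply (IHN (Jred J) B e0); auto using (Jred_posfun HJ G1).
intros e He. replace (- 2 * Z.of_nat N)%Z with (- 2 * Z.of_nat (S N) + 2)%Z by lia.
rewrite tmoment_Jred by (auto; lra). auto.
Qed.

(** * Stieltjes inversion *)

(** The imaginary part of [hker] at x + i y. With t = s/c, the product c^2 [poi] is the Poisson
    kernel y / ((x - t)^2 + y^2). *)
Definition poi (y x c s : R) : R := y / ((s - c * x) * (s - c * x) + (c * y) * (c * y)).

(** Only t > 0 is kept: there t^k is nonnegative for odd k as well, so truncated moments are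
    monotone in the cutoff. The other half-line is reached through [Jrefl]. *)
Definition taup (e c s : R) : R := if Rle_dec e (s * c) then 1 else 0.

Definition tmoment_pos (k : Z) (e : R) (J : (R -> R -> R) -> R) : R := J (fun c s => mk k c s * taup e c s).

Lemma taup_cases e c s : (e <= s * c /\ taup e c s = 1) \/ (s * c < e /\ taup e c s = 0).
Proof. unfold taup; destruct (Rle_dec _ _); [left|right]; split; auto; lra. Qed.

Lemma taup_01 e c s : 0 <= taup e c s <= 1.
Proof. destruct (taup_cases e c s) as [[_ ->]|[_ ->]]; lra. Qed.

Lemma taup_bdd e : bdd (taup e).
Proof. exists 1. intros c s _. pose proof (taup_01 e c s). rewrite Rabs_pos_eq; lra. Qed.

Lemma mtp_bdd k e : 0 < e -> bdd (fun c s => mk k c s * taup e c s).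
Proof.
intros He. destruct (mt_bdd k e He) as [B HB]. exists B. intros c s Hc. specialize (HB c s Hc).
destruct (taup_cases e c s) as [[H ->]|[H ->]].
- unfold tau in HB. destruct (Rle_dec e (Rabs (s * c))) as [_|N]; [auto|].
  exfalso; apply N. eapply Rle_trans; [apply H|apply Rle_abs].
- rewrite Rmult_0_r, Rabs_R0. eapply Rle_trans; [apply Rabs_pos|apply HB].
Qed.

#[export] Hint Resolve taup_bdd mtp_bdd : bdd.

Lemma scp_ge e c s : circ c s -> 0 < e -> e <= s * c -> e <= Rabs c /\ e <= s / c <= / e.
Proof.
intros Hc He H. assert (Ha : e <= Rabs (s * c)) by (eapply Rle_trans; [apply H|apply Rle_abs]).
destruct (sc_ge e c s Hc Ha) as [S1 C1]. split; [lra|]. destruct (sc_ne e c s He Ha) as [Ns Nc].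
unfold circ in Hc. assert (P : 0 < c * c) by nra. assert (Q : 0 < s * s) by nra.
assert (E : s / c = s * c / (c * c)) by (field; auto). rewrite E. split.
- apply (Rmult_le_reg_r (c * c)); auto. replace (s * c / (c * c) * (c * c)) with (s * c) by (field; auto). nra.
- apply (Rmult_le_reg_r (c * c * e)); [nra|]. replace (s * c / (c * c) * (c * c * e)) with (s * c * e) by (field; auto).
  replace (/ e * (c * c * e)) with (c * c) by (field; lra).
  assert (s * c <= 1) by nra.
  assert (e <= Rabs c * Rabs s) by (rewrite <- Rabs_mult, Rmult_comm; auto).
  assert (A : c * c = Rabs c * Rabs c) by (rewrite Rabs_sq; ring).
  assert (B : s * c = Rabs s * Rabs c) by (rewrite <- Rabs_mult, Rabs_pos_eq; lra).
  rewrite A, B. nra.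
Qed.

Lemma mk_taup_pos k e c s : 0 < e -> 0 <= mk k c s * taup e c s.
Proof.
intros He. destruct (taup_cases e c s) as [[H ->]|[H ->]]; [|lra]. rewrite Rmult_1_r. unfold mk.
destruct (Rlt_le_dec 0 c) as [Pc|Pc].
- assert (0 < s) by nra. apply Rmult_le_pos; apply powerRZ_le; auto.
- assert (c <> 0) by (intros ->; lra). assert (c < 0) by lra. assert (s < 0) by nra.
  replace s with (-1 * - s) by ring. replace c with (-1 * - c) by ring. rewrite !powerRZ_mult.
  replace (powerRZ (-1) k * powerRZ (- s) k * (powerRZ (-1) (- k - 2) * powerRZ (- c) (- k - 2))) with
    ((powerRZ (-1) k * powerRZ (-1) (- k - 2)) * (powerRZ (- s) k * powerRZ (- c) (- k - 2))) by ring.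
  rewrite <- powerRZ_add by lra. replace (k + (- k - 2))%Z with (-2)%Z by lia.
  replace (powerRZ (-1) (-2)) with 1 by (simpl; field). rewrite Rmult_1_l.
  apply Rmult_le_pos; apply powerRZ_le; lra.
Qed.

Lemma atan_mvt a b : exists c, atan b - atan a = (b - a) / (1 + c * c) /\ Rabs (c - a) <= Rabs (b - a).
Proof.
destruct (MVT_gen atan a b (fun x => / (1 + x ^ 2))) as [c [Hc E]].
- intros x _. apply is_derive_Reals. exact (derivable_pt_lim_atan x).
- intros x _. apply derivable_continuous_pt. eexists. apply derivable_pt_lim_atan.
- exists c. split; [rewrite E; unfold Rdiv; rewrite Rmult_comm; do 2 f_equal; ring|].
  unfold Rmin, Rmax in Hc. destruct (Rle_dec a b); unfold Rabs; destruct (Rcase_abs (c - a)), (Rcase_abs (b - a)); lra.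
Qed.

(** The constant does not depend on [a], which gives the uniformity over the circle demanded by
    [J_RInt]. *)
Lemma atan_taylor a b : Rabs (atan b - atan a - (b - a) / (1 + a * a)) <= (b - a) * (b - a).
Proof.
destruct (atan_mvt a b) as [c [E H]]. rewrite E.
assert (P : 0 < 1 + c * c) by nra. assert (Q : 0 < 1 + a * a) by nra.
replace ((b - a) / (1 + c * c) - (b - a) / (1 + a * a)) with ((b - a) * ((a - c) * ((a + c) / ((1 + c * c) * (1 + a * a))))) by (field; lra).
rewrite !Rabs_mult.
assert (B : Rabs ((a + c) / ((1 + c * c) * (1 + a * a))) <= 1).
{ unfold Rdiv. rewrite Rabs_mult, (Rabs_pos_eq (/ _)) by (apply Rlt_le, Rinv_0_lt_compat; nra).
  apply (Rmult_le_reg_r ((1 + c * c) * (1 + a * a))); [nra|].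
  rewrite Rmult_assoc, Rinv_l, Rmult_1_r, Rmult_1_l by nra.
  pose proof (Rle_0_sqr (a - 1)). pose proof (Rle_0_sqr (a + 1)). pose proof (Rle_0_sqr (c - 1)). pose proof (Rle_0_sqr (c + 1)).
  pose proof (Rle_0_sqr (a * c)). pose proof (Rle_0_sqr a). pose proof (Rle_0_sqr c). unfold Rsqr in *. apply Rabs_le. split; lra. }
replace ((b - a) * (b - a)) with (Rabs (b - a) * Rabs (b - a)) by (rewrite Rabs_sq; ring).
apply Rmult_le_compat_l; [apply Rabs_pos|].
rewrite (Rabs_minus_sym a c). pose proof (Rabs_pos (c - a)). pose proof (Rabs_pos ((a + c) / ((1 + c * c) * (1 + a * a)))). nra.
Qed.

Lemma atan_le x : 0 <= x -> atan x <= x.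
Proof.
intros Hx. destruct (atan_mvt 0 x) as [c [E _]]. rewrite atan_0, !Rminus_0_r in E. rewrite E.
apply (Rmult_le_reg_r (1 + c * c)); [nra|]. unfold Rdiv. rewrite Rmult_assoc, Rinv_l by nra. nra.
Qed.

Lemma atan_ge x : 0 < x -> PI / 2 - / x <= atan x.
Proof.
intros Hx. pose proof (atan_inv x Hx) as E. assert (0 < / x) by (apply Rinv_0_lt_compat; auto).
pose proof (atan_le (/ x) ltac:(lra)). lra.
Qed.

Lemma atan_mono x y : x <= y -> atan x <= atan y.
Proof. intros [H|H]; [left; now apply atan_increasing|right; now rewrite H]. Qed.

(* Fubini for [J] reduces to the fundamental theorem of calculus: the Taylor bound is uniform on the
   circle, so [x |-> J (Phi x)] has derivative [J (phi x)]. *)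
Lemma J_RInt J (Phi phi : R -> R -> R -> R) K a b : posfun J ->
  (forall x, bdd (Phi x)) -> (forall x, bdd (phi x)) ->
  (forall x x' c s, circ c s -> Rabs (Phi x' c s - Phi x c s - (x' - x) * phi x c s) <= K * ((x' - x) * (x' - x))) ->
  is_RInt (fun x => J (phi x)) a b (J (Phi b) - J (Phi a)).
Proof.
intros HJ B1 B2 HT.
assert (K0 : 0 <= K).
{ assert (C : circ 0 1) by (unfold circ; ring). specialize (HT 0 1 0 1 C).
  eapply Rle_trans; [apply Rabs_pos|]. eapply Rle_trans; [apply HT|]. lra. }
set (T := J (fun _ _ => 1)). assert (HT0 : 0 <= T) by apply (pf_1 HJ).
assert (D : forall x x', Rabs (J (Phi x') - J (Phi x) - (x' - x) * J (phi x)) <= K * T * ((x' - x) * (x' - x))).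
{ intros x x'. rewrite <- (pf_scal _ HJ), <- !(pf_minus HJ) by auto with bdd.
  replace (K * T * ((x' - x) * (x' - x))) with ((K * ((x' - x) * (x' - x))) * T) by ring.
  apply (pf_bound HJ); auto with bdd. }
apply (is_RInt_derive (V := R_CompleteNormedModule) (fun x => J (Phi x)) (fun x => J (phi x))).
- intros x _. apply is_derive_eps. intros e He. exists (e / (K * T + 1)).
  assert (0 <= K * T) by (apply Rmult_le_pos; auto).
  split; [apply Rdiv_lt_0_compat; lra|]. intros v Hv. apply lt_div_mult in Hv; [|lra].
  eapply Rle_trans; [apply D|].
  replace ((v - x) * (v - x)) with (Rabs (v - x) * Rabs (v - x)) by (rewrite Rabs_sq; ring).
  pose proof (Rabs_pos (v - x)). nra.
- intros x _. apply (proj2 (filterlim_locally _ _)). intros e.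
  assert (L : forall v, Rabs (J (phi v) - J (phi x)) <= 2 * K * T * Rabs (v - x)).
  { intros v. destruct (Req_dec v x) as [->|N].
    - replace (J (phi x) - J (phi x)) with 0 by ring. rewrite Rabs_R0. apply Rmult_le_pos; [|apply Rabs_pos]. nra.
    - assert (N' : 0 < Rabs (v - x)) by (apply Rabs_pos_lt; lra).
      apply (Rmult_le_reg_l (Rabs (v - x))); auto. rewrite <- Rabs_mult.
      pose proof (D x v) as D1. pose proof (D v x) as D2.
      replace ((v - x) * (J (phi v) - J (phi x))) with
        ((J (Phi v) - J (Phi x) - (v - x) * J (phi x)) + (J (Phi x) - J (Phi v) - (x - v) * J (phi v))) by ring.
      eapply Rle_trans; [apply Rabs_triang|].
      replace (Rabs (v - x) * (2 * K * T * Rabs (v - x))) with (2 * (K * T * ((v - x) * (v - x)))).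
      + replace ((x - v) * (x - v)) with ((v - x) * (v - x)) in D2 by ring. lra.
      + replace ((v - x) * (v - x)) with (Rabs (v - x) * Rabs (v - x)) by (rewrite Rabs_sq; ring). ring. }
  assert (KT : 0 <= 2 * K * T) by nra.
  assert (P : 0 < e / (2 * K * T + 1)) by (apply Rdiv_lt_0_compat; [apply cond_pos|lra]).
  exists (mkposreal _ P). intros v Hv. change (Rabs (v - x) < e / (2 * K * T + 1)) in Hv.
  change (Rabs (J (phi v) - J (phi x)) < e). eapply Rle_lt_trans; [apply L|].
  apply lt_div_mult in Hv; [|lra]. pose proof (Rabs_pos (v - x)).
  destruct (Rle_lt_or_eq_dec 0 (Rabs (v - x)) H) as [Q|Q]; [nra|]. rewrite <- Q in *. pose proof (cond_pos e). lra.
Qed.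

Lemma is_RInt_close f g h a b F G H : a <= b -> is_RInt f a b F -> is_RInt g a b G -> is_RInt h a b H ->
  (forall x, a <= x <= b -> Rabs (f x - g x) <= h x) -> Rabs (F - G) <= H.
Proof.
intros Hab Hf Hg Hh Hb. pose proof (is_RInt_minus (V := R_NormedModule) f g a b F G Hf Hg) as Hd.
apply Rabs_le; split.
- pose proof (is_RInt_opp (V := R_NormedModule) h a b H Hh) as Ho.
  apply (is_RInt_le (fun x => opp (h x)) (fun x => minus (f x) (g x)) a b); auto.
  intros x Hx. specialize (Hb x ltac:(lra)). apply Rabs_le_between in Hb. apply Hb.
- apply (is_RInt_le (fun x => minus (f x) (g x)) h a b); auto.
  intros x Hx. specialize (Hb x ltac:(lra)). apply Rabs_le_between in Hb. apply Hb.
Qed.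

Lemma powerRZ_lip k r : 0 < r -> exists L, 0 <= L /\ forall x t, r <= x <= / r -> r <= t <= / r ->
  Rabs (powerRZ x k - powerRZ t k) <= L * Rabs (x - t).
Proof.
intros Hr. assert (Hi : 0 < / r) by (apply Rinv_0_lt_compat; auto).
assert (N : forall n, exists L, 0 <= L /\ forall x t, r <= x <= / r -> r <= t <= / r -> Rabs (x ^ n - t ^ n) <= L * Rabs (x - t)).
{ induction n as [|n [L [HL K]]].
  - exists 0; split; [lra|]. intros x t _ _. simpl. replace (1 - 1) with 0 by ring. rewrite Rabs_R0. lra.
  - exists (/ r * L + (/ r) ^ n). assert (0 <= (/ r) ^ n) by (apply pow_le; lra). split; [nra|].
    intros x t Hx Ht. simpl. replace (x * x ^ n - t * t ^ n) with (x * (x ^ n - t ^ n) + t ^ n * (x - t)) by ring.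
    eapply Rle_trans; [apply Rabs_triang|]. rewrite !Rabs_mult, (Rabs_pos_eq x), (Rabs_pos_eq (t ^ n)) by (try apply pow_le; lra).
    specialize (K x t Hx Ht). assert (t ^ n <= (/ r) ^ n) by (apply pow_incr; lra).
    pose proof (Rabs_pos (x - t)). pose proof (Rabs_pos (x ^ n - t ^ n)).
    assert (x * Rabs (x ^ n - t ^ n) <= / r * (L * Rabs (x - t))) by (apply Rmult_le_compat; lra). nra. }
destruct k as [|p|p].
- exists 0; split; [lra|]. intros x t _ _. simpl. replace (1 - 1) with 0 by ring. rewrite Rabs_R0. lra.
- destruct (N (Pos.to_nat p)) as [L H]. exists L. exact H.
- destruct (N (Pos.to_nat p)) as [L [HL H]]. exists (L * (/ r * / r)). split; [nra|].
  intros x t Hx Ht. simpl. rewrite <- !pow_inv.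
  assert (I : forall z, r <= z <= / r -> r <= / z <= / r).
  { intros z Hz. split; [|apply Rinv_le_contravar; lra]. rewrite <- (Rinv_inv r). apply Rinv_le_contravar; lra. }
  eapply Rle_trans; [apply H; auto|]. rewrite Rmult_assoc. apply Rmult_le_compat_l; auto.
  replace (/ x - / t) with (- ((x - t) * (/ x * / t))) by (field; lra).
  rewrite Rabs_Ropp, Rabs_mult, Rmult_comm. apply Rmult_le_compat_r; [apply Rabs_pos|].
  destruct (I x Hx), (I t Ht). rewrite Rabs_pos_eq; [|apply Rmult_le_pos; lra]. apply Rmult_le_compat; lra.
Qed.

Lemma sq_pos c y : c <> 0 -> 0 < y -> 0 < c * y * (c * y).
Proof. intros Hc Hy. apply (Rsqr_pos_lt (c * y)). apply Rmult_integral_contrapositive_currified; lra. Qed.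

Lemma poi_pos y x c s : 0 < y -> 0 <= poi y x c s.
Proof.
intros Hy. unfold poi. destruct (Req_dec ((s - c * x) * (s - c * x) + c * y * (c * y)) 0) as [E|N].
- rewrite E. unfold Rdiv. rewrite Rinv_0. lra.
- apply Rdiv_le_0_compat; [lra|]. assert (0 <= (s - c * x) * (s - c * x)) by exact (Rle_0_sqr _). assert (0 <= c * y * (c * y)) by exact (Rle_0_sqr _). lra.
Qed.

Lemma poi_far y x c s d : 0 < y -> 0 < d -> d <= Rabs (s - c * x) -> poi y x c s <= y / (d * d).
Proof.
intros Hy Hd H. unfold poi. apply Rmult_le_compat_l; [lra|]. apply Rinv_le_contravar; [nra|].
assert (d * d <= (s - c * x) * (s - c * x)); [|nra].
replace ((s - c * x) * (s - c * x)) with (Rabs (s - c * x) * Rabs (s - c * x)) by (rewrite Rabs_sq; ring). nra.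
Qed.

(** If s - c x = w were small, multiplying by c and by s would give s c >= c^2 e - d and s c >= s^2
    e - d / e with d = e^2 / 4. Their sum contradicts s c < e / 4. Hence [poi] is O(y) outside the
    enlarged cutoff. *)
Lemma far_of_sc e x c s : circ c s -> 0 < e < 1 -> e <= x <= / e -> s * c < e / 4 -> e * e / 4 <= Rabs (s - c * x).
Proof.
intros Hc He Hx H. apply Rnot_lt_le; intros Hlt. destruct (circ_le1 c s Hc) as [C1 S1]. unfold circ in Hc.
apply Rabs_def2 in Hlt. apply Rabs_le_between in C1. apply Rabs_le_between in S1.
set (w := s - c * x) in *. set (d := e * e / 4) in *. assert (Hd : 0 < d) by (unfold d; nra).
assert (A : c * c * e - d <= s * c).
{ replace (s * c) with (c * c * x + c * w) by (unfold w; ring). assert (c * c * e <= c * c * x) by (apply Rmult_le_compat_l; nra).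
  assert (- d <= c * w) by nra. lra. }
assert (B : s * s * e - d / e <= s * c).
{ assert (Hsx : s * c * x = s * s - s * w) by (unfold w; ring).
  assert (s * s - d <= s * c * x) by (rewrite Hsx; nra).
  assert (Hex : e * x <= 1) by (apply (Rmult_le_reg_r (/ e)); [apply Rinv_0_lt_compat; lra|]; rewrite Rmult_1_l; replace (e * x * / e) with x by (field; lra); lra).
  assert (D2 : d / e * x >= d).
  { assert (d / e * e = d) by (field; lra). assert (0 < d / e) by (apply Rdiv_lt_0_compat; lra). nra. }
  apply (Rmult_le_reg_r x); [lra|]. assert (s * s * (e * x) <= s * s * 1) by (apply Rmult_le_compat_l; nra). lra. }
assert (D3 : d / e = e / 4) by (unfold d; field; lra).
assert (c * c * e + s * s * e = e) by (rewrite <- Rmult_plus_distr_r, Hc; ring). unfold d in A. nra.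
Qed.

Lemma poi_sq y x c s : 0 < y -> (s - c * x) * (s - c * x) * poi y x c s <= y.
Proof.
intros Hy. unfold poi. set (w := (s - c * x) * (s - c * x)). assert (0 <= w) by exact (Rle_0_sqr _).
assert (0 <= c * y * (c * y)) by exact (Rle_0_sqr _).
destruct (Rle_lt_or_eq_dec 0 (w + c * y * (c * y)) ltac:(lra)) as [P|P].
- apply (Rmult_le_reg_r (w + c * y * (c * y))); auto. replace (w * (y / (w + c * y * (c * y))) * (w + c * y * (c * y))) with (w * y) by (field; lra). nra.
- rewrite <- P. unfold Rdiv. rewrite Rinv_0. lra.
Qed.

Section Inversion.
Context {J : (R -> R -> R) -> R} (HJ : posfun J)
  (Hc : forall y x, 0 < y -> continuous (fun x => J (poi y x)) x)
  (Hb : forall y x, 0 < y -> bdd (poi y x))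
  (e : R) (He : 0 < e < 1).

Let T := J (fun _ _ => 1).
(** A region strictly larger than e <= t <= 1/e, so that its complement falls under [far_of_sc]. *)
Let F := taup (e / 4).

(** The integral over e < x < 1/e of the Poisson kernel at t = s/c. As y tends to 0 it tends to pi
    inside the interval, pi/2 at the end points and 0 outside. *)
Definition arc (y c s : R) : R := atan ((/ e - s / c) / y) - atan ((e - s / c) / y).

Lemma arc_01 y c s : 0 < y -> 0 <= arc y c s <= PI.
Proof.
intros Hy. unfold arc. assert (1 < / e) by (rewrite <- Rinv_1; apply Rinv_lt_contravar; lra). split.
- assert (atan ((e - s / c) / y) <= atan ((/ e - s / c) / y)); [|lra]. apply atan_mono.
  apply Rmult_le_compat_r; [apply Rlt_le, Rinv_0_lt_compat; auto|lra].
- pose proof (atan_bound ((/ e - s / c) / y)). pose proof (atan_bound ((e - s / c) / y)). lra.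
Qed.

Lemma mF_bdd k : bdd (fun c s => mk k c s * F c s).
Proof. unfold F. apply mtp_bdd. lra. Qed.

Lemma mul_bdd01 f g K : bdd f -> (forall c s, circ c s -> Rabs (g c s) <= K) -> bdd (fun c s => f c s * g c s).
Proof. intros Hf Hg. apply bdd_mult; auto. now exists K. Qed.

Lemma arc_bdd y : 0 < y -> bdd (arc y).
Proof. intros Hy. exists PI. intros c s _. pose proof (arc_01 y c s Hy). rewrite Rabs_pos_eq; lra. Qed.

Lemma inner_integral k y : 0 < y ->
  is_RInt (fun x => J (fun c s => mk k c s * F c s * (c * c * poi y x c s))) e (/ e)
    (J (fun c s => mk k c s * F c s * arc y c s)).
Proof.
intros Hy. pose proof (mF_bdd k) as BF.
set (Phi := fun x c s => mk k c s * F c s * atan ((x - s / c) / y)).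
assert (BP : forall x, bdd (Phi x)).
{ intros x. unfold Phi. apply (mul_bdd01 _ _ (PI / 2)); auto. intros c s _. apply Rabs_le.
  pose proof (atan_bound ((x - s / c) / y)). lra. }
replace (J (fun c s => mk k c s * F c s * arc y c s)) with (J (Phi (/ e)) - J (Phi e)).
2:{ rewrite <- (pf_minus HJ) by auto. apply (pf_ext HJ); auto using arc_bdd with bdd.
    intros c s _. unfold Phi, arc. ring. }
destruct BF as [B HB].
assert (B0 : 0 <= B) by (specialize (HB 0 1 ltac:(unfold circ; ring)); eapply Rle_trans; [apply Rabs_pos|apply HB]).
apply (J_RInt J Phi _ (B / (y * y)) e (/ e) HJ BP).
- intros x. apply (mul_bdd01 _ _ (/ y)); [now exists B|]. intros c s _.
  rewrite Rabs_pos_eq by (apply Rmult_le_pos; [nra|apply poi_pos; auto]).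
  unfold poi. set (w := (s - c * x) * (s - c * x)). assert (0 <= w) by exact (Rle_0_sqr _).
  destruct (Req_dec c 0) as [->|N].
  + rewrite !Rmult_0_l. apply Rlt_le, Rinv_0_lt_compat; auto.
  + assert (0 < c * c) by nra. assert (P : 0 < w + c * y * (c * y)) by (pose proof (sq_pos c y N Hy); lra).
    apply (Rmult_le_reg_r (w + c * y * (c * y))); auto.
    replace (c * c * (y / (w + c * y * (c * y))) * (w + c * y * (c * y))) with (c * c * y) by (field; lra).
    replace (/ y * (w + c * y * (c * y))) with (/ y * w + c * c * y) by (field; lra).
    assert (0 <= / y * w) by (apply Rmult_le_pos; auto; apply Rlt_le, Rinv_0_lt_compat; auto). lra.
- intros x x' c s Hcs. unfold Phi. specialize (HB c s Hcs).
  destruct (taup_cases (e / 4) c s) as [[H E]|[H E]].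
  + destruct (scp_ge (e/4) c s Hcs ltac:(lra) H) as [C1 _].
    assert (N : c <> 0) by (intros ->; rewrite Rabs_R0 in C1; lra).
    replace (mk k c s * F c s * atan ((x' - s / c) / y) - mk k c s * F c s * atan ((x - s / c) / y) - (x' - x) * (mk k c s * F c s * (c * c * poi y x c s)))
      with (mk k c s * F c s * (atan ((x' - s / c) / y) - atan ((x - s / c) / y) - ((x' - s / c) / y - (x - s / c) / y) / (1 + (x - s / c) / y * ((x - s / c) / y)))).
    * rewrite Rabs_mult. replace (B / (y * y) * ((x' - x) * (x' - x))) with (B * (((x' - s / c) / y - (x - s / c) / y) * ((x' - s / c) / y - (x - s / c) / y))) by (field; lra).
      apply Rmult_le_compat; auto using Rabs_pos, atan_taylor.
    * unfold poi. assert (0 < c * c) by nra.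
      assert (P : 0 < (s - c * x) * (s - c * x) + c * y * (c * y)).
      { pose proof (sq_pos c y N Hy). assert (0 <= (s - c * x) * (s - c * x)) by exact (Rle_0_sqr _). lra. }
      assert (Q : 0 < 1 + (x - s / c) / y * ((x - s / c) / y)) by (pose proof (Rle_0_sqr ((x - s / c) / y)) as Z; unfold Rsqr in Z; lra).
      assert (R1 : ((x' - s / c) / y - (x - s / c) / y) / (1 + (x - s / c) / y * ((x - s / c) / y)) = (x' - x) * (c * c * (y / ((s - c * x) * (s - c * x) + c * y * (c * y))))).
      { replace (1 + (x - s / c) / y * ((x - s / c) / y)) with (((s - c * x) * (s - c * x) + c * y * (c * y)) / (c * c * (y * y))) by (field; lra).
        field. repeat split; lra. }
      rewrite R1. ring.
  + unfold F. rewrite E. rewrite !Rmult_0_r, !Rmult_0_l. replace (0 - 0 - (x' - x) * 0) with 0 by ring.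
    rewrite Rabs_R0. apply Rmult_le_pos; [|exact (Rle_0_sqr _)]. apply Rdiv_le_0_compat; [auto|nra].
Qed.

(** Inside [F] the power x^k is replaced by t^k, for which the integral over x is explicit, with an
    error Lipschitz in s - c x. Outside [F] the kernel itself is O(y). The rate sqrt(y) comes from
    the first error. *)
Lemma inversion_error k : exists K, 0 <= K /\ forall y, 0 < y < 1 ->
  Rabs (RInt (fun x => powerRZ x k * J (poi y x)) e (/ e) - J (fun c s => mk k c s * F c s * arc y c s)) <= K * sqrt y.
Proof.
assert (Hie : 1 < / e) by (rewrite <- Rinv_1; apply Rinv_lt_contravar; lra).
destruct (powerRZ_lip k (e / 4) ltac:(lra)) as [L [HL Lip]].
set (M := (/ e) ^ Z.abs_nat k + 1).
assert (M0 : 0 <= M) by (unfold M; assert (0 <= (/ e) ^ Z.abs_nat k) by (apply pow_le; lra); lra).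
set (d := e * e / 4). assert (Hd : 0 < d) by (unfold d; nra).
set (A0 := PI * J (fun c s => mk 0 c s * F c s)).
assert (T0 : 0 <= T) by apply (pf_1 HJ).
assert (PA0 : 0 <= A0).
{ apply Rmult_le_pos; [pose proof PI_RGT_0; lra|]. apply (pf_pos HJ); [apply mF_bdd|]. intros; apply mk_taup_pos; lra. }
set (C1 := M * / (d * d) * T). set (L1 := L * (4 / e)).
assert (PC1 : 0 <= C1) by (unfold C1; repeat apply Rmult_le_pos; auto; apply Rlt_le, Rinv_0_lt_compat; nra).
assert (PL1 : 0 <= L1) by (unfold L1; apply Rmult_le_pos; auto; apply Rdiv_le_0_compat; lra).
exists (C1 * (/ e - e) + L1 * (A0 + T * (/ e - e))). split.
{ apply Rplus_le_le_0_compat; apply Rmult_le_pos; auto; try lra. apply Rplus_le_le_0_compat; auto. apply Rmult_le_pos; auto; lra. }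
(* n = sqrt(y) balances |w| <= n + w^2 / n for w = s - c x: [poi_sq] bounds w^2 [poi] by y = n^2, so
   the second term contributes n, and n times the integral of [poi] is again of order n. *)
intros y Hy. pose proof (sqrt_lt_R0 y ltac:(lra)) as Sy. set (n := sqrt y) in *.
assert (Eny : n * n = y) by (unfold n; apply sqrt_sqrt; lra).
assert (Hyn : y <= n) by nra.
assert (BFp : forall x, bdd (fun c s => F c s * poi y x c s)) by (intros; apply bdd_mult; [apply taup_bdd|apply Hb; lra]).
assert (I1 : is_RInt (fun x => powerRZ x k * J (poi y x)) e (/ e) (RInt (fun x => powerRZ x k * J (poi y x)) e (/ e))).
{ apply (RInt_correct (V := R_CompleteNormedModule)), (ex_RInt_continuous (V := R_CompleteNormedModule)).
  intros x Hx. rewrite Rmin_left, Rmax_right in Hx by lra. apply (continuous_mult (K := R_AbsRing)); [|apply Hc; lra].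
  apply continuity_pt_filterlim. apply derivable_continuous_pt.
  destruct k as [|p|p]; simpl.
  - apply derivable_pt_const.
  - apply derivable_pt_pow.
  - apply (derivable_pt_inv (fun x => x ^ Pos.to_nat p)); [apply pow_nonzero; lra|]. apply derivable_pt_pow. }
pose proof (inner_integral k y ltac:(lra)) as I2.
pose proof (inner_integral 0 y ltac:(lra)) as I3.
assert (E3 : forall x, J (fun c s => mk 0 c s * F c s * (c * c * poi y x c s)) = J (fun c s => F c s * poi y x c s)).
{ intros x. apply (pf_ext HJ); auto.
  - apply (bdd_ext (fun c s => F c s * poi y x c s)); auto. intros c s Hcs.
    destruct (taup_cases (e / 4) c s) as [[H E]|[H E]]; unfold F; rewrite E; [|ring].
    destruct (scp_ge (e/4) c s Hcs ltac:(lra) H) as [Q _].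
    assert (N : c <> 0) by (intros ->; rewrite Rabs_R0 in Q; lra). unfold mk. simpl. field. auto.
  - intros c s Hcs.
    destruct (taup_cases (e / 4) c s) as [[H E]|[H E]]; unfold F; rewrite E; [|ring].
    destruct (scp_ge (e/4) c s Hcs ltac:(lra) H) as [Q _].
    assert (N : c <> 0) by (intros ->; rewrite Rabs_R0 in Q; lra). unfold mk. simpl. field. auto. }
set (V0 := J (fun c s => mk 0 c s * F c s * arc y c s)) in *.
assert (HV0 : V0 <= A0).
{ unfold V0, A0. rewrite <- (pf_scal _ HJ) by apply mF_bdd. pose proof (mF_bdd 0). apply (pf_mono _ HJ); auto using arc_bdd with bdd.
  - apply bdd_mult; auto. apply arc_bdd; lra.
  - intros c s _. pose proof (arc_01 y c s ltac:(lra)). pose proof (mk_taup_pos 0 (e/4) c s ltac:(lra)) as Q. fold F in Q.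
    rewrite (Rmult_comm PI). apply Rmult_le_compat_l; [exact Q|lra]. }
assert (I4 : is_RInt (fun x => plus (scal (L1 * n) (J (fun c s => mk 0 c s * F c s * (c * c * poi y x c s)))) (C1 * y + L1 * n * T)) e (/ e)
   (plus (scal (L1 * n) V0) (scal (/ e - e) (C1 * y + L1 * n * T)))).
{ apply (is_RInt_plus (V := R_NormedModule)).
  - apply (is_RInt_scal (V := R_NormedModule)). exact I3.
  - apply (is_RInt_const (V := R_NormedModule)). }
eapply Rle_trans; [apply (is_RInt_close _ _ _ e (/ e) _ _ _ ltac:(lra) I1 I2 I4)|].
- intros x Hx. rewrite E3.
  change (Rabs (powerRZ x k * J (poi y x) - J (fun c s => mk k c s * F c s * (c * c * poi y x c s))) <= (L1 * n) * J (fun c s => F c s * poi y x c s) + (C1 * y + L1 * n * T)).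
  assert (Bx : bdd (poi y x)) by (apply Hb; lra).
  assert (BG : bdd (fun c s => mk k c s * F c s * (c * c * poi y x c s))).
  { pose proof (mF_bdd k). auto 6 with bdd. }
  assert (BFd := BFp x).
  rewrite <- (pf_scal _ HJ), <- (pf_minus HJ) by auto with bdd.
  replace (L1 * n * J (fun c s => F c s * poi y x c s) + (C1 * y + L1 * n * T)) with
    (J (fun c s => (L1 * n) * (F c s * poi y x c s) + (M * (y / (d * d)) + L1 * n))).
  2:{ rewrite (pf_add _ HJ), (pf_scal _ HJ), (pf_const HJ) by auto with bdd. fold T. unfold C1. field. nra. }
  apply (pf_abs_le HJ); auto 6 with bdd. intros c s Hcs.
  pose proof (poi_pos y x c s ltac:(lra)) as PP.
  assert (Hx4 : e / 4 <= x <= / (e / 4)).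
  { split; [lra|]. apply Rle_trans with (/ e); [lra|]. apply Rinv_le_contravar; lra. }
  destruct (taup_cases (e / 4) c s) as [[H E]|[H E]]; unfold F; rewrite E.
  + destruct (scp_ge (e/4) c s Hcs ltac:(lra) H) as [Q Ht].
    assert (N : c <> 0) by (intros ->; rewrite Rabs_R0 in Q; lra).
    assert (Em : mk k c s * 1 * (c * c * poi y x c s) = powerRZ (s / c) k * poi y x c s).
    { unfold mk, Rdiv. rewrite powerRZ_mult, powerRZ_inv'. replace (- k - 2)%Z with (- k + (- (2)))%Z by lia.
      rewrite powerRZ_add, !powerRZ_neg' by auto. simpl. field. split; auto. apply powerRZ_NOR; auto. }
    rewrite Em, <- Rmult_minus_distr_r, Rabs_mult, (Rabs_pos_eq (poi y x c s)) by auto.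
    assert (Lx : Rabs (powerRZ x k - powerRZ (s / c) k) <= L1 * Rabs (s - c * x)).
    { eapply Rle_trans; [apply Lip; auto|]. unfold L1. rewrite Rmult_assoc. apply Rmult_le_compat_l; auto.
      replace (x - s / c) with (- ((s - c * x) * / c)) by (field; auto). rewrite Rabs_Ropp, Rabs_mult, Rabs_inv, Rmult_comm.
      apply Rmult_le_compat_r; [apply Rabs_pos|]. replace (4 / e) with (/ (e / 4)) by (field; lra). apply Rinv_le_contravar; lra. }
    assert (AG : Rabs (s - c * x) <= n + (s - c * x) * (s - c * x) / n).
    { replace ((s - c * x) * (s - c * x)) with (Rabs (s - c * x) * Rabs (s - c * x)) by (rewrite Rabs_sq; ring).
      set (w := Rabs (s - c * x)). apply (Rmult_le_reg_r n); auto. replace ((n + w * w / n) * n) with (n * n + w * w) by (field; lra).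
      pose proof (Rle_0_sqr (w - n)) as Z. unfold Rsqr in Z. assert (0 <= w) by (unfold w; apply Rabs_pos). nra. }
    assert (PQ : (s - c * x) * (s - c * x) / n * poi y x c s <= n).
    { pose proof (poi_sq y x c s ltac:(lra)) as Z. apply (Rmult_le_reg_r n); auto.
      replace ((s - c * x) * (s - c * x) / n * poi y x c s * n) with ((s - c * x) * (s - c * x) * poi y x c s) by (field; lra). lra. }
    assert (Z1 : Rabs (powerRZ x k - powerRZ (s / c) k) * poi y x c s <= L1 * (n + (s - c * x) * (s - c * x) / n) * poi y x c s).
    { apply Rmult_le_compat_r; auto. eapply Rle_trans; [apply Lx|]. apply Rmult_le_compat_l; auto. }
    assert (Z2 : L1 * ((s - c * x) * (s - c * x) / n * poi y x c s) <= L1 * n) by (apply Rmult_le_compat_l; auto).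
    assert (0 <= M * (y / (d * d))) by (apply Rmult_le_pos; auto; apply Rdiv_le_0_compat; nra). lra.
  + rewrite !Rmult_0_r, !Rmult_0_l, Rmult_0_r, Rminus_0_r, Rplus_0_l, Rabs_mult, (Rabs_pos_eq (poi y x c s)) by auto.
    assert (Z1 : poi y x c s <= y / (d * d)) by (apply poi_far; try lra; apply (far_of_sc e x c s); auto).
    assert (Z2 : Rabs (powerRZ x k) <= M).
    { unfold M. destruct (Rle_dec x 1) as [X1|X1].
      - apply powerRZ_bd; [lra|]. rewrite Rabs_pos_eq; lra.
      - replace x with (/ / x) by (apply Rinv_inv). rewrite powerRZ_inv', <- powerRZ_neg'.
        replace (Z.abs_nat k) with (Z.abs_nat (- k)) by lia. apply powerRZ_bd; [lra|].
        rewrite Rabs_pos_eq by (apply Rlt_le, Rinv_0_lt_compat; lra). split.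
        + rewrite <- (Rinv_inv e). apply Rinv_le_contravar; lra.
        + rewrite <- Rinv_1. apply Rinv_le_contravar; lra. }
    assert (Rabs (powerRZ x k) * poi y x c s <= M * (y / (d * d))) by (apply Rmult_le_compat; auto using Rabs_pos).
    assert (0 <= L1 * n) by (apply Rmult_le_pos; lra). lra.
- change (L1 * n * V0 + (/ e - e) * (C1 * y + L1 * n * T) <= (C1 * (/ e - e) + L1 * (A0 + T * (/ e - e))) * n).
  assert (L1 * n * V0 <= L1 * n * A0) by (apply Rmult_le_compat_l; auto; apply Rmult_le_pos; lra).
  assert ((/ e - e) * (C1 * y) <= (/ e - e) * (C1 * n)) by (apply Rmult_le_compat_l; [lra|]; apply Rmult_le_compat_l; auto). lra.
Qed.

(** The limit must come from monotonicity in y, and atan(w / y) is monotone in y in a direction that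
    depends on the sign of w; hence the positive part. *)
Lemma arc_part_limit k (w : R -> R -> R) : exists l,
  lim0 (fun y => J (fun c s => mk k c s * F c s * Rmax (atan (w c s / y)) 0)) l.
Proof.
pose proof (mF_bdd k) as BF.
assert (B : forall y, forall c s : R, circ c s -> Rabs (Rmax (atan (w c s / y)) 0) <= PI / 2).
{ intros y c s _. pose proof (atan_bound (w c s / y)). pose proof PI_RGT_0.
  unfold Rmax; destruct (Rle_dec _ _); apply Rabs_le; lra. }
assert (B' : forall y, bdd (fun c s => mk k c s * F c s * Rmax (atan (w c s / y)) 0)).
{ intros y. apply (mul_bdd01 _ _ (PI / 2)); auto. }
destruct (antimono_lim0 (fun y => J (fun c s => mk k c s * F c s * Rmax (atan (w c s / y)) 0)) (PI / 2 * J (fun c s => mk k c s * F c s))) as [l [_ [H _]]].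
- intros x y Hxy. apply (pf_mono _ HJ); auto. intros c s _.
  apply Rmult_le_compat_l; [apply mk_taup_pos; lra|].
  destruct (Rle_dec (w c s) 0) as [W|W].
  + rewrite (Rmax_right (atan (w c s / y))); [apply Rmax_r|]. rewrite <- atan_0. apply atan_mono.
    assert (0 < / y) by (apply Rinv_0_lt_compat; lra). unfold Rdiv. nra.
  + apply Rmax_lub; [|apply Rmax_r]. eapply Rle_trans; [|apply Rmax_l]. apply atan_mono.
    apply Rmult_le_compat_l; [lra|]. apply Rinv_le_contravar; lra.
- intros y _. rewrite <- (pf_scal _ HJ) by auto. apply (pf_mono _ HJ); auto with bdd. intros c s Hcs.
  rewrite (Rmult_comm (PI / 2)). apply Rmult_le_compat_l; [apply mk_taup_pos; lra|].
  eapply Rle_trans; [apply Rle_abs|apply B; auto].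
- exists l; auto.
Qed.

Lemma arc_limit k : exists l, lim0 (fun y => J (fun c s => mk k c s * F c s * arc y c s)) l.
Proof.
destruct (arc_part_limit k (fun c s => / e - s / c)) as [l1 H1].
destruct (arc_part_limit k (fun c s => - (/ e - s / c))) as [l2 H2].
destruct (arc_part_limit k (fun c s => e - s / c)) as [l3 H3].
destruct (arc_part_limit k (fun c s => - (e - s / c))) as [l4 H4].
exists ((l1 - l2) - (l3 - l4)).
apply (lim0_ext (fun y => (J (fun c s => mk k c s * F c s * Rmax (atan ((/ e - s / c) / y)) 0) - J (fun c s => mk k c s * F c s * Rmax (atan (- (/ e - s / c) / y)) 0))
  - (J (fun c s => mk k c s * F c s * Rmax (atan ((e - s / c) / y)) 0) - J (fun c s => mk k c s * F c s * Rmax (atan (- (e - s / c) / y)) 0)))).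
2:{ repeat apply lim0_minus; auto. }
intros y Hy. pose proof (mF_bdd k) as BF.
assert (B' : forall w : R -> R -> R, bdd (fun c s => mk k c s * F c s * Rmax (atan (w c s / y)) 0)).
{ intros w. apply (mul_bdd01 _ _ (PI / 2)); auto. intros c s _. pose proof (atan_bound (w c s / y)). pose proof PI_RGT_0.
  unfold Rmax; destruct (Rle_dec _ _); apply Rabs_le; lra. }
pose proof (B' (fun c s => / e - s / c)) as b1. pose proof (B' (fun c s => - (/ e - s / c))) as b2.
pose proof (B' (fun c s => e - s / c)) as b3. pose proof (B' (fun c s => - (e - s / c))) as b4.
rewrite <- !(pf_minus HJ) by auto with bdd. apply (pf_ext HJ); auto with bdd.
{ apply bdd_mult; auto. apply arc_bdd; auto. }
assert (S : forall v, Rmax (atan (v / y)) 0 - Rmax (atan (- v / y)) 0 = atan (v / y)).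
{ intros v. replace (- v / y) with (- (v / y)) by (field; lra). rewrite atan_opp.
  unfold Rmax; destruct (Rle_dec _ _), (Rle_dec _ _); lra. }
intros c s _. unfold arc.
transitivity (mk k c s * F c s * ((Rmax (atan ((/ e - s / c) / y)) 0 - Rmax (atan (- (/ e - s / c) / y)) 0)
  - (Rmax (atan ((e - s / c) / y)) 0 - Rmax (atan (- (e - s / c) / y)) 0))); [ring|].
rewrite !S. reflexivity.
Qed.

(** The limit of the arcs exists by monotonicity but involves half of any mass at e and 1/e. The
    two-sided bound avoids computing it: [arc] is at most pi, and at least pi - 2 y / e where
    [taup (2 * e)] is 1. *)
Lemma half_line_inversion k : exists D,
  lim0 (fun y => RInt (fun x => powerRZ x k * J (poi y x)) e (/ e)) D /\
  PI * tmoment_pos k (2 * e) J <= D <= PI * tmoment_pos k (e / 4) J.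
Proof.
destruct (arc_limit k) as [D HD]. destruct (inversion_error k) as [K [HK HE]].
pose proof (mF_bdd k) as BF.
exists D. split; [|split].
- intros eps Heps. destruct (HD (eps / 2) ltac:(lra)) as [d [Hd Hdd]].
  set (r := eps / (2 * (K + 1))). assert (Hr : 0 < r) by (apply Rdiv_lt_0_compat; lra).
  assert (Er : r * (2 * (K + 1)) = eps) by (unfold r; field; lra).
  exists (Rmin (Rmin d 1) (r * r)); split; [repeat apply Rmin_pos; nra|].
  intros y [Hy0 Hy]. pose proof (Rmin_l (Rmin d 1) (r * r)). pose proof (Rmin_r (Rmin d 1) (r * r)).
  pose proof (Rmin_l d 1). pose proof (Rmin_r d 1).
  specialize (HE y ltac:(lra)). specialize (Hdd y ltac:(lra)).
  assert (Sq : sqrt y <= r).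
  { rewrite <- (sqrt_square r) by lra. apply sqrt_le_1_alt. lra. }
  match goal with |- Rabs (?A - D) < eps => replace (A - D) with ((A - J (fun c s => mk k c s * F c s * arc y c s)) + (J (fun c s => mk k c s * F c s * arc y c s) - D)) by ring end.
  eapply Rle_lt_trans; [apply Rabs_triang|].
  assert (K * sqrt y <= K * r) by (apply Rmult_le_compat_l; auto). nra.
- unfold tmoment_pos.
  apply Rnot_lt_le; intros Hlt.
  set (A := J (fun c s => mk k c s * taup (2 * e) c s)) in *.
  assert (PA : 0 <= A) by (apply (pf_pos HJ); [apply mtp_bdd; lra|]; intros; apply mk_taup_pos; lra).
  assert (L : PI * A <= D); [|lra].

  assert (LL : lim0 (fun y => (PI - 2 * (y / e)) * A - J (fun c s => mk k c s * F c s * arc y c s)) (PI * A - D)).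
  { apply lim0_minus; auto. apply (lim0_bound _ _ (2 / e * A)); [apply Rmult_le_pos; auto; apply Rdiv_le_0_compat; lra|].
    intros y Hy. replace ((PI - 2 * (y / e)) * A - PI * A) with (- (2 / e * A * y)) by (field; lra).
    rewrite Rabs_Ropp, Rabs_pos_eq; [lra|]. apply Rmult_le_pos; [|lra]. apply Rmult_le_pos; auto; apply Rdiv_le_0_compat; lra. }
  assert (PI * A - D <= 0); [|lra]. apply (lim0_le _ _ 0) in LL; auto.
  intros y Hy. assert (B2 : bdd (fun c s => mk k c s * taup (2 * e) c s)) by (apply mtp_bdd; lra).
  pose proof (arc_bdd y Hy) as Ba.
  unfold A. rewrite <- (pf_scal _ HJ), <- (pf_minus HJ) by auto with bdd.
  rewrite <- (pf_0 HJ). apply (pf_mono _ HJ); auto with bdd. intros c s Hcs.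
  pose proof (arc_01 y c s Hy) as A01. pose proof (mk_taup_pos k (e/4) c s ltac:(lra)) as MP. fold F in MP.
  destruct (taup_cases (2 * e) c s) as [[H E]|[H E]]; rewrite E.
  + assert (EF : F c s = 1).
    { unfold F. destruct (taup_cases (e/4) c s) as [[_ X]|[X _]]; auto. lra. }
    rewrite EF in *. destruct (scp_ge (2 * e) c s Hcs ltac:(lra) H) as [_ Ht].
    (* This is 2 e^2 <= 1. It holds because 2 e <= s c <= 1/2 on the region considered. *)
    assert (Hi : / (2 * e) + e <= / e).
    { apply (Rmult_le_reg_r (2 * e)); [lra|]. rewrite Rmult_plus_distr_r, Rinv_l by lra.
      replace (/ e * (2 * e)) with 2 by (field; lra).
      assert (s * c <= 1 / 2) by (unfold circ in Hcs; pose proof (Rle_0_sqr (s - c)) as Z; unfold Rsqr in Z; lra). nra. }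
    assert (PIA : PI - 2 * (y / e) <= arc y c s).
    { unfold arc.
      assert (E0 : 0 < e / y) by (apply Rdiv_lt_0_compat; lra).
      assert (G : PI / 2 - y / e <= atan (e / y)).
      { pose proof (atan_ge (e / y) E0) as Z. replace (/ (e / y)) with (y / e) in Z by (field; lra). exact Z. }
      assert (G1 : atan (e / y) <= atan ((/ e - s / c) / y)) by (apply atan_mono; apply Rmult_le_compat_r; [apply Rlt_le, Rinv_0_lt_compat; auto|lra]).
      assert (G2 : atan ((e - s / c) / y) <= - atan (e / y)).
      { rewrite <- atan_opp. apply atan_mono. replace (- (e / y)) with (- e / y) by (field; lra). apply Rmult_le_compat_r; [apply Rlt_le, Rinv_0_lt_compat; auto|lra]. }
      lra. }
    nra.
  + assert (0 <= mk k c s * F c s * arc y c s) by (apply Rmult_le_pos; lra). lra.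
- apply (lim0_le (fun y => J (fun c s => mk k c s * F c s * arc y c s))); auto.
  intros y Hy. unfold tmoment_pos. fold F. rewrite <- (pf_scal _ HJ) by auto. pose proof (arc_bdd y Hy) as Ba.
  apply (pf_mono _ HJ); auto with bdd. intros c s _. pose proof (arc_01 y c s Hy).
  rewrite (Rmult_comm PI). apply Rmult_le_compat_l; [apply mk_taup_pos; lra|lra].
Qed.

End Inversion.

(** * The iterated limit *)

Lemma lim0_filterlim P l : lim0 P l <-> filterlim P (at_right 0) (locally l).
Proof.
split.
- intros H. apply filterlim_locally. intros eps. destruct (H eps (cond_pos eps)) as [d [Hd K]].
  exists (mkposreal d Hd). intros y Hy Hy0. apply K. split; [exact Hy0|].
  change (Rabs (y - 0) < d) in Hy. apply Rabs_def2 in Hy. lra.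
- intros H eps He. pose proof (proj1 (filterlim_locally _ _) H (mkposreal eps He)) as [d Hd].
  exists d; split; [apply cond_pos|]. intros y Hy. apply (Hd y); [|lra].
  change (Rabs (y - 0) < d). rewrite Rminus_0_r, Rabs_pos_eq; lra.
Qed.

Lemma lim0_ext_loc P Q l r : 0 < r -> (forall e, 0 < e < r -> P e = Q e) -> lim0 P l -> lim0 Q l.
Proof.
intros Hr E H eps He. destruct (H eps He) as [d [Hd K]]. exists (Rmin d r); split; [now apply Rmin_pos|].
intros e Hee. pose proof (Rmin_l d r). pose proof (Rmin_r d r). rewrite <- E by lra. apply K; lra.
Qed.

Definition inner (F : R -> R -> R) : Prop := forall e, 0 < e < 1 -> exists D, lim0 (F e) D.

Definition inner_lim (F : R -> R -> R) (e : R) : R :=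
  ClassicalEpsilon.epsilon (inhabits 0) (fun D => lim0 (F e) D).

Lemma inner_lim_spec F e : inner F -> 0 < e < 1 -> lim0 (F e) (inner_lim F e).
Proof. intros H He. unfold inner_lim. apply (ClassicalEpsilon.epsilon_spec (inhabits 0) (fun D => lim0 (F e) D)), H, He. Qed.

Lemma iter_lim_inner_lim F L : inner F -> (iter_lim F L <-> lim0 (inner_lim F) L).
Proof.
intros HF. split.
- intros [G [[d [Hd HG]] HL]]. apply lim0_filterlim in HL.
  apply (lim0_ext_loc G _ _ (Rmin d 1)); auto; [apply Rmin_pos; lra|].
  intros e He. pose proof (Rmin_l d 1). pose proof (Rmin_r d 1).
  apply (lim0_unique (F e)); [apply lim0_filterlim, HG; lra|apply inner_lim_spec; auto; lra].
- intros H. exists (inner_lim F). split; [|now apply lim0_filterlim].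
  exists 1; split; [lra|]. intros e He. apply lim0_filterlim, inner_lim_spec; auto.
Qed.

Lemma iter_lim_scal F a L : iter_lim F L -> iter_lim (fun e y => a * F e y) (a * L).
Proof.
intros [G [[d [Hd HG]] HL]]. exists (fun e => a * G e). split.
- exists d; split; auto. intros e He. apply lim0_filterlim, lim0_scal, lim0_filterlim. auto.
- apply lim0_filterlim, lim0_scal, lim0_filterlim. auto.
Qed.

Definition Jrefl (J : (R -> R -> R) -> R) (f : R -> R -> R) : R := J (fun c s => f c (- s)).

Lemma circ_refl c s : circ c s -> circ c (- s).
Proof. unfold circ; intros; lra. Qed.

Lemma Jrefl_posfun J : posfun J -> posfun (Jrefl J).
Proof. intros HJ. apply (pf_comp HJ (fun c s => c) (fun c s => - s)). intros c s; apply circ_refl. Qed.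

Lemma mk_refl k c s : mk k c (- s) = powerRZ (-1) k * mk k c s.
Proof. unfold mk. replace (- s) with (-1 * s) by ring. rewrite powerRZ_mult. ring. Qed.

Lemma sgn_sq k : powerRZ (-1) k * powerRZ (-1) k = 1.
Proof. rewrite <- powerRZ_mult. replace (-1 * -1) with 1 by ring. apply powerRZ_R1. Qed.

Lemma tau_split e c s : 0 < e -> tau e c s = taup e c s + taup e c (- s).
Proof.
intros He. unfold tau, taup. destruct (Rle_dec e (Rabs (s * c))), (Rle_dec e (s * c)), (Rle_dec e (- s * c));
  unfold Rabs in *; destruct (Rcase_abs (s * c)); lra.
Qed.

Lemma tmoment_split J k e : posfun J -> 0 < e -> tmoment k e J = tmoment_pos k e J + powerRZ (-1) k * tmoment_pos k e (Jrefl J).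
Proof.
intros HJ He. unfold tmoment, tmoment_pos, Jrefl.
assert (B : bdd (fun c s => mk k c (- s) * taup e c (- s))).
{ destruct (mtp_bdd k e He) as [B HB]. exists B. intros c s Hc. exact (HB c (- s) (circ_refl c s Hc)). }
rewrite <- (pf_scal _ HJ), <- (pf_add _ HJ) by auto with bdd. apply (pf_ext HJ); auto with bdd.
intros c s _. rewrite mk_refl, (tau_split e c s He).
replace (powerRZ (-1) k * (powerRZ (-1) k * mk k c s * taup e c (- s))) with ((powerRZ (-1) k * powerRZ (-1) k) * mk k c s * taup e c (- s)) by ring.
rewrite sgn_sq. ring.
Qed.

Lemma tmoment_pos_ge0 J k e : posfun J -> 0 < e -> 0 <= tmoment_pos k e J.
Proof. intros HJ He. apply (pf_pos HJ); auto with bdd. intros; now apply mk_taup_pos. Qed.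

Lemma tmoment_pos_anti J k e f : posfun J -> 0 < e <= f -> tmoment_pos k f J <= tmoment_pos k e J.
Proof.
intros HJ H. apply (pf_mono _ HJ); try (apply mtp_bdd; lra). intros c s _.
pose proof (mk_taup_pos k e c s ltac:(lra)) as P.
destruct (taup_cases f c s) as [[A ->]|[A ->]]; [|lra].
destruct (taup_cases e c s) as [[B E]|[B E]]; rewrite E; lra.
Qed.

(** Boundedness of the absolute moment: the half-lines are bounded separately, so that no
    cancellation enters for odd k. *)
Definition Bnd (k : Z) (J : (R -> R -> R) -> R) : Prop :=
  exists B, forall e, 0 < e -> tmoment_pos k e J <= B /\ tmoment_pos k e (Jrefl J) <= B.

Lemma powerRZ_m1_even j : powerRZ (-1) (2 * j) = 1.
Proof.
replace (2 * j)%Z with (j + j)%Z by lia. rewrite powerRZ_add by lra. apply sgn_sq.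
Qed.

(** For even order both half-line moments enter the sum with the same sign, so a limit of the sum
    bounds each of them near 0, and monotonicity extends the bound to all cutoffs. *)
Lemma Bnd_even J j l : posfun J -> lim0 (fun e => tmoment (2 * j) e J) l -> Bnd (2 * j) J.
Proof.
intros HJ H. destruct (H 1 Rlt_0_1) as [d [Hd K]]. exists (l + 1). intros e He.
set (f := Rmin e (d / 2)). assert (Hf : 0 < f) by (apply Rmin_pos; lra).
assert (F1 : f <= e) by apply Rmin_l. assert (F2 : f <= d / 2) by apply Rmin_r.
specialize (K f ltac:(lra)). rewrite tmoment_split, powerRZ_m1_even in K by auto. apply Rabs_def2 in K.
pose proof (Jrefl_posfun J HJ) as HM.
pose proof (tmoment_pos_ge0 J (2 * j) f HJ Hf). pose proof (tmoment_pos_ge0 (Jrefl J) (2 * j) f HM Hf).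
pose proof (tmoment_pos_anti J (2 * j) f e HJ ltac:(lra)). pose proof (tmoment_pos_anti (Jrefl J) (2 * j) f e HM ltac:(lra)). lra.
Qed.

(** For t > 0 one has t^(k-1) + t^(k+1) >= t^k, because 1/t + t >= 1. This transfers bounds from
    even orders to the odd order between them. *)
Lemma tmoment_pos_between J k e : posfun J -> 0 < e -> tmoment_pos k e J <= tmoment_pos (k - 1) e J + tmoment_pos (k + 1) e J.
Proof.
intros HJ He. unfold tmoment_pos. rewrite <- (pf_add _ HJ) by auto with bdd. apply (pf_mono _ HJ); auto with bdd.
intros c s Hc. pose proof (mk_taup_pos k e c s He) as P.
destruct (taup_cases e c s) as [[A E]|[A E]]; rewrite E in *; [|lra].
assert (N : s * c <> 0) by lra. assert (Ns : s <> 0) by (intros ->; lra). assert (Nc : c <> 0) by (intros ->; lra).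
assert (E1 : mk (k - 1) c s = mk k c s * (c / s)).
{ unfold mk. replace (- (k - 1) - 2)%Z with ((- k - 2) + 1)%Z by lia. replace (k - 1)%Z with (k + (-1))%Z by lia.
  rewrite !powerRZ_add by auto. simpl. field. auto. }
assert (E2 : mk (k + 1) c s = mk k c s * (s / c)).
{ unfold mk. replace (- (k + 1) - 2)%Z with ((- k - 2) + (-1))%Z by lia.
  rewrite !powerRZ_add by auto. simpl. field. auto. }
rewrite E1, E2.
assert (Q : 1 <= c / s + s / c).
{ apply (Rmult_le_reg_r (s * c)); [lra|]. replace ((c / s + s / c) * (s * c)) with (c * c + s * s) by (field; auto).
  unfold circ in Hc. pose proof (Rle_0_sqr (s - c)) as Z. unfold Rsqr in Z. lra. }
replace (mk k c s * (c / s) * 1 + mk k c s * (s / c) * 1) with ((mk k c s * 1) * (c / s + s / c)) by ring.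
rewrite <- (Rmult_1_r (mk k c s * 1)) at 1. apply Rmult_le_compat_l; auto.
Qed.

Lemma Bnd_between J k : posfun J -> Bnd (k - 1) J -> Bnd (k + 1) J -> Bnd k J.
Proof.
intros HJ [A HA] [B HB]. exists (A + B). intros e He. destruct (HA e He), (HB e He).
pose proof (tmoment_pos_between J k e HJ He). pose proof (tmoment_pos_between (Jrefl J) k e (Jrefl_posfun J HJ) He). lra.
Qed.

Section Herglotz.
Context {h : C -> C} {g : R} {J : (R -> R -> R) -> R} (Hh : Herglotz h) (HJ : posfun J) (HR : Rep g J h).

Lemma Im_rep x y : 0 < y -> Im (h (x, y)) = J (poi y x).
Proof.
intros Hy. assert (U : upper (x, y)) by (unfold upper; simpl; lra).
rewrite (HR _ U), Im_plus, im_RtoC, Rplus_0_l.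
change (Im (JC J (hker (x, y)))) with (J (fun c s => Im (hker (x, y) c s))).
assert (E : forall c s, circ c s -> Im (hker (x, y) c s) = poi y x c s) by (intros c s Hc; rewrite Im_hker by auto; reflexivity).
apply (pf_ext HJ); auto.
- apply cbdd_Im, hker_bdd; auto.
- apply (bdd_ext (fun c s => Im (hker (x, y) c s))); auto. apply cbdd_Im, hker_bdd; auto.
Qed.

Lemma poi_bdd y x : 0 < y -> bdd (poi y x).
Proof.
intros Hy. assert (U : upper (x, y)) by (unfold upper; simpl; lra).
apply (bdd_ext (fun c s => Im (hker (x, y) c s))).
- intros c s Hc; rewrite Im_hker by auto; reflexivity.
- apply cbdd_Im, hker_bdd; auto.
Qed.

Lemma Im_continuous y x : 0 < y -> continuous (fun x => Im (h (x, y))) x.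
Proof.
intros Hy. assert (U : upper (x, y)) by (unfold upper; simpl; lra).
destruct (ex_derive_Cd h _ (proj1 Hh _ U)) as [l Hl].
apply (Cc_pcont h (fun x => (x, y)) x); [|exact (Cd_cont _ _ _ Hl)].
split; [apply continuous_id|apply continuous_const].
Qed.

Lemma poi_continuous y x : 0 < y -> continuous (fun x => J (poi y x)) x.
Proof.
intros Hy. apply (continuous_ext (fun x => Im (h (x, y)))); [|now apply Im_continuous].
intros t. now apply Im_rep.
Qed.

Lemma Jrefl_poi y x : 0 < y -> Jrefl J (poi y x) = J (poi y (- x)).
Proof.
intros Hy. unfold Jrefl. apply (pf_ext HJ).
- destruct (poi_bdd y x Hy) as [B HB]. exists B. intros c s Hc. apply HB, circ_refl, Hc.
- now apply poi_bdd.
- intros c s _. unfold poi. f_equal. ring.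
Qed.

Lemma trunc_integrable k e y : 0 < e < 1 -> 0 < y ->
  ex_RInt (fun x => powerRZ x k * Im (h (x, y))) (- / e) (- e) /\
  ex_RInt (fun x => powerRZ x k * Im (h (x, y))) e (/ e).
Proof.
intros He Hy. assert (Hie : 1 < / e) by (rewrite <- Rinv_1; apply Rinv_lt_contravar; lra).
assert (K : forall x, x <> 0 -> continuous (fun x => powerRZ x k * Im (h (x, y))) x).
{ intros x Hx. apply (continuous_mult (K := R_AbsRing)); [|now apply Im_continuous].
  apply continuity_pt_filterlim. apply derivable_continuous_pt.
  destruct k as [|p|p]; simpl.
  - apply derivable_pt_const.
  - apply derivable_pt_pow.
  - apply (derivable_pt_inv (fun x => x ^ Pos.to_nat p)); [now apply pow_nonzero|]. apply derivable_pt_pow. }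
split; apply (ex_RInt_continuous (V := R_CompleteNormedModule)); intros x Hx; apply K;
  rewrite Rmin_left, Rmax_right in Hx by lra; lra.
Qed.

Lemma trunc_moment_xy q k e y : trunc_moment q k e y =
  RInt (fun x => powerRZ x k * Im (q (x, y))) (- / e) (- e) + RInt (fun x => powerRZ x k * Im (q (x, y))) e (/ e).
Proof.
unfold trunc_moment. f_equal; apply RInt_ext; intros x _; do 3 f_equal; apply C_ext; simpl; ring.
Qed.

Lemma trunc_moment_rep k e y : 0 < e < 1 -> 0 < y -> trunc_moment h k e y =
  RInt (fun x => powerRZ x k * J (poi y x)) e (/ e) +
  powerRZ (-1) k * RInt (fun x => powerRZ x k * Jrefl J (poi y x)) e (/ e).
Proof.
intros He Hy. rewrite trunc_moment_xy, Rplus_comm. f_equal.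
- apply RInt_ext. intros x _. now rewrite Im_rep.
- destruct (trunc_integrable k e y He Hy) as [EX _].
  pose proof (RInt_correct (V := R_CompleteNormedModule) _ _ _ EX) as I0.
  set (I := RInt (fun x => powerRZ x k * Im (h (x, y))) (- / e) (- e)) in *.
  change (is_RInt (V := R_NormedModule) (fun x => powerRZ x k * Im (h (x, y))) (- / e) (- e) I) in I0.
  pose proof (is_RInt_comp_opp (V := R_NormedModule) (fun x => powerRZ x k * Im (h (x, y))) (/ e) e I I0) as I1.
  apply (is_RInt_swap (V := R_NormedModule)) in I1.
  apply (is_RInt_scal (V := R_NormedModule) _ _ _ (- powerRZ (-1) k)) in I1.
  assert (E : RInt (fun x => powerRZ x k * Jrefl J (poi y x)) e (/ e) = powerRZ (-1) k * I).
  { apply is_RInt_unique.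
    replace (powerRZ (-1) k * I) with (scal (- powerRZ (-1) k) (opp I)) by (unfold scal, opp; simpl; unfold mult; simpl; ring).
    revert I1. apply is_RInt_ext. intros x _.
    change (- powerRZ (-1) k * (- (powerRZ (- x) k * Im (h (- x, y)))) = powerRZ x k * Jrefl J (poi y x)).
    rewrite Im_rep, Jrefl_poi by auto. replace (- x) with (-1 * x) at 1 by ring. rewrite powerRZ_mult.
    eq_in_R. transitivity ((powerRZ (-1) k * powerRZ (-1) k) * (powerRZ x k * J (poi y (- x)))); [ring|rewrite sgn_sq; ring]. }
  rewrite E, <- Rmult_assoc, sgn_sq, Rmult_1_l. reflexivity.
Qed.

Lemma inner_herglotz k e : 0 < e < 1 -> exists Dp Dm,
  lim0 (fun y => trunc_moment h k e y) (Dp + powerRZ (-1) k * Dm) /\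
  PI * tmoment_pos k (2 * e) J <= Dp <= PI * tmoment_pos k (e / 4) J /\
  PI * tmoment_pos k (2 * e) (Jrefl J) <= Dm <= PI * tmoment_pos k (e / 4) (Jrefl J).
Proof.
intros He.
destruct (half_line_inversion HJ poi_continuous poi_bdd e He k) as [Dp [L1 B1]].
assert (HcM : forall y x, 0 < y -> continuous (fun x => Jrefl J (poi y x)) x).
{ intros y x Hy. apply (continuous_ext (fun x => J (poi y (- x)))); [intros t; now rewrite Jrefl_poi|].
  apply (continuous_comp (fun x => - x) (fun x => J (poi y x))); [|now apply poi_continuous].
  apply (continuous_opp (V := R_NormedModule)), continuous_id. }
destruct (half_line_inversion (Jrefl_posfun J HJ) HcM poi_bdd e He k) as [Dm [L2 B2]].
exists Dp, Dm. split; [|split; auto].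
apply (lim0_ext (fun y => RInt (fun x => powerRZ x k * J (poi y x)) e (/ e) +
  powerRZ (-1) k * RInt (fun x => powerRZ x k * Jrefl J (poi y x)) e (/ e))).
- intros y Hy. now rewrite trunc_moment_rep.
- apply lim0_plus; auto. now apply lim0_scal.
Qed.

Lemma herglotz_inner k : inner (trunc_moment h k).
Proof. intros e He. destruct (inner_herglotz k e He) as [Dp [Dm [H _]]]. eexists; exact H. Qed.

Lemma inner_lim_herglotz k e : 0 < e < 1 -> exists Dp Dm,
  inner_lim (trunc_moment h k) e = Dp + powerRZ (-1) k * Dm /\
  PI * tmoment_pos k (2 * e) J <= Dp <= PI * tmoment_pos k (e / 4) J /\
  PI * tmoment_pos k (2 * e) (Jrefl J) <= Dm <= PI * tmoment_pos k (e / 4) (Jrefl J).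
Proof.
intros He. destruct (inner_herglotz k e He) as [Dp [Dm [H B]]]. exists Dp, Dm. split; auto.
apply (lim0_unique (trunc_moment h k e)); auto. apply inner_lim_spec; auto. apply herglotz_inner.
Qed.

Lemma squeeze (P D : R -> R) l : lim0 P l -> (forall e, 0 < e < 1 -> PI * P (2 * e) <= D e <= PI * P (e / 4)) ->
  lim0 D (PI * l).
Proof.
intros HP HD eps Heps. pose proof PI_RGT_0 as Pi.
destruct (HP (eps / (2 * PI)) ltac:(apply Rdiv_lt_0_compat; lra)) as [d [Hd K]].
exists (Rmin 1 (d / 2)); split; [apply Rmin_pos; lra|]. intros e [He He2].
pose proof (Rmin_l 1 (d/2)). pose proof (Rmin_r 1 (d/2)).
pose proof (K (2 * e) ltac:(lra)) as K1. pose proof (K (e / 4) ltac:(lra)) as K2.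
apply lt_div_mult in K1; [|lra]. apply lt_div_mult in K2; [|lra].
specialize (HD e ltac:(lra)).
pose proof (Rle_abs (P (e / 4) - l)). pose proof (Rle_abs (- (P (2 * e) - l))). rewrite Rabs_Ropp in H2.
apply Rabs_def1; nra.
Qed.

(** The enclosure is applied to each half-line, where truncated moments are monotone and [Bnd] makes
    them converge; for odd k the signed sum is not monotone. *)
Lemma inner_lim_cv k l : Bnd k J -> lim0 (fun e => tmoment k e J) l -> lim0 (inner_lim (trunc_moment h k)) (PI * l).
Proof.
intros [B HB] Hl. pose proof (Jrefl_posfun J HJ) as HM.
destruct (antimono_lim0 (fun e => tmoment_pos k e J) B) as [lp [_ [Lp _]]].
{ intros e f H; now apply tmoment_pos_anti. } { intros e He; apply HB; auto. }
destruct (antimono_lim0 (fun e => tmoment_pos k e (Jrefl J)) B) as [lm [_ [Lm _]]].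
{ intros e f H; now apply tmoment_pos_anti. } { intros e He; apply HB; auto. }
assert (E : l = lp + powerRZ (-1) k * lm).
{ apply (lim0_unique (fun e => tmoment k e J)); auto.
  apply (lim0_ext (fun e => tmoment_pos k e J + powerRZ (-1) k * tmoment_pos k e (Jrefl J))).
  - intros e He. now rewrite tmoment_split.
  - apply lim0_plus; auto. now apply lim0_scal. }
set (Q := fun e (D : R * R) => inner_lim (trunc_moment h k) e = fst D + powerRZ (-1) k * snd D /\
  PI * tmoment_pos k (2 * e) J <= fst D <= PI * tmoment_pos k (e / 4) J /\
  PI * tmoment_pos k (2 * e) (Jrefl J) <= snd D <= PI * tmoment_pos k (e / 4) (Jrefl J)).
set (D := fun e => ClassicalEpsilon.epsilon (inhabits (0, 0)) (Q e)).
assert (HD : forall e, 0 < e < 1 -> Q e (D e)).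
{ intros e He. apply (ClassicalEpsilon.epsilon_spec (inhabits (0, 0)) (Q e)).
  destruct (inner_lim_herglotz k e He) as [Dp [Dm H]]. exists (Dp, Dm). exact H. }
apply (lim0_ext_loc (fun e => fst (D e) + powerRZ (-1) k * snd (D e)) _ _ 1 Rlt_0_1).
- intros e He. symmetry. apply (HD e He).
- replace (PI * l) with (PI * lp + powerRZ (-1) k * (PI * lm)) by (rewrite E; ring).
  apply lim0_plus; [|apply lim0_scal].
  + apply (squeeze (fun e => tmoment_pos k e J)); auto. intros e He. apply (HD e He).
  + apply (squeeze (fun e => tmoment_pos k e (Jrefl J))); auto. intros e He. apply (HD e He).
Qed.

Lemma tmoment_bounded_of_inner_lim j L : lim0 (inner_lim (trunc_moment h (2 * j))) L ->
  exists B e0, 0 < e0 /\ forall e, 0 < e < e0 -> tmoment (2 * j) e J <= B.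
Proof.
intros H. pose proof PI_RGT_0 as Pi. destruct (H 1 Rlt_0_1) as [d [Hd K]].
exists (/ PI * (L + 1)), (Rmin d 1); split; [apply Rmin_pos; lra|].
intros e He. pose proof (Rmin_l d 1). pose proof (Rmin_r d 1).
(* The lower bound of the inversion has its cutoff doubled, so level e / 2 controls the moment with
   cutoff e. *)
specialize (K (e / 2) ltac:(lra)). apply Rabs_def2 in K.
destruct (inner_lim_herglotz (2 * j) (e / 2) ltac:(lra)) as [Dp [Dm [E [B1 B2]]]].
rewrite E, powerRZ_m1_even in K. replace (2 * (e / 2)) with e in * by field.
rewrite tmoment_split, powerRZ_m1_even by (auto; lra).
apply (Rmult_le_reg_l PI); auto. rewrite <- (Rmult_assoc PI (/ PI)), Rinv_r, Rmult_1_l by lra. lra.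
Qed.

End Herglotz.

(** * Stoltz expansions at the origin and at infinity *)

Lemma Cpowz_nat z n : Cpowz z (Z.of_nat n) = (z ^ n)%C.
Proof. destruct n; simpl; [reflexivity|]. rewrite SuccNat2Pos.id_succ. reflexivity. Qed.

Lemma Cmult_Cpowz z n : z <> RtoC 0 -> (z * Cpowz z (-1 + Z.of_nat n))%C = (z ^ n)%C.
Proof.
intros Hz. destruct n as [|n].
- simpl. field. auto.
- replace (-1 + Z.of_nat (S n))%Z with (Z.of_nat n) by lia. rewrite Cpowz_nat. reflexivity.
Qed.

Lemma laurent_hpoly a n z : z <> RtoC 0 ->
  (z * laurent_sum a (-1) (Z.of_nat n - 1) z)%C = hpoly n (fun j => a (Z.of_nat j - 1)%Z) z.
Proof.
intros Hz. unfold laurent_sum. replace (Z.to_nat (Z.of_nat n - 1 - -1)) with n by lia.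
induction n.
- rewrite sum_O. replace (-1 + Z.of_nat 0)%Z with (-1)%Z by lia. simpl. field. auto.
- rewrite hpoly_last, <- IHn, sum_Sn. unfold plus; simpl AbelianMonoid.plus.
  change (z * (sum_n (fun n0 => RtoC (a (-1 + Z.of_nat n0)%Z) * Cpowz z (-1 + Z.of_nat n0))%C n + RtoC (a (-1 + Z.of_nat (S n))%Z) * Cpowz z (-1 + Z.of_nat (S n))) =
    z * sum_n (fun n0 => RtoC (a (-1 + Z.of_nat n0)%Z) * Cpowz z (-1 + Z.of_nat n0))%C n + RtoC (a (Z.of_nat (S n) - 1)%Z) * z ^ S n)%C.
  rewrite <- (Cmult_Cpowz z (S n) Hz). replace (Z.of_nat (S n) - 1)%Z with (-1 + Z.of_nat (S n))%Z by lia. ring.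
Qed.

Lemma stoltz_Stz th z : 0 < th <= PI / 2 -> stoltz th z -> Stz (1 - cos th) z.
Proof.
intros Hth [Hz [H1 H2]]. split; auto. unfold Arg_upper in *. pose proof PI_RGT_0.
assert (P : 0 < Cmod z) by (apply Cmod_gt_0, upper_ne0; auto).
pose proof (re_le_Cmod z) as R. set (x := Re z / Cmod z) in *.
assert (E : Re z = x * Cmod z) by (unfold x; field; lra).
assert (X : -1 <= x <= 1).
{ apply Rabs_le_between in R. rewrite E in R. split; apply (Rmult_le_reg_r (Cmod z)); lra. }
pose proof (acos_bound x). pose proof (cos_acos x X) as CA.
assert (A1 : x < cos th) by (rewrite <- CA; apply cos_decreasing_1; lra).
assert (A2 : - x < cos th).
{ replace (- x) with (cos (PI - acos x)); [apply cos_decreasing_1; lra|].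
  rewrite Rtrigo_facts.cos_pi_minus, CA. reflexivity. }
replace (1 - (1 - cos th)) with (cos th) by ring. rewrite E, Rabs_mult, (Rabs_pos_eq (Cmod z)) by lra.
apply Rmult_le_compat_r; [lra|]. apply Rabs_le; lra.
Qed.

Lemma cos_range th : 0 < th <= PI / 2 -> 0 < 1 - cos th <= 1.
Proof.
intros H. pose proof PI_RGT_0. pose proof (cos_decreasing_1 0 th ltac:(lra) ltac:(lra) ltac:(lra) ltac:(lra) ltac:(lra)).
rewrite cos_0 in H1. pose proof (cos_ge_0 th ltac:(lra) ltac:(lra)). lra.
Qed.

Lemma stoltz_iy y : 0 < y -> stoltz (PI / 4) (0, y).
Proof.
intros Hy. pose proof PI_RGT_0. split; [unfold upper; simpl; lra|]. unfold Arg_upper. simpl Re.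
replace (0 / Cmod (0, y)) with 0 by (unfold Rdiv; ring). rewrite acos_0. lra.
Qed.

Lemma upper_inv z : upper z -> upper (- / z)%C.
Proof.
intros Hz. pose proof (upper_ne0 z Hz) as N. unfold upper in *.
replace (- / z)%C with ((-1) / z)%C by (field; auto).
rewrite Cmult_conj_div, im_scal_l by auto. apply Rmult_lt_0_compat.
- apply Rinv_0_lt_compat, pow_lt, Cmod_gt_0; auto.
- simpl. unfold Im in Hz. lra.
Qed.

Lemma Cmod_ninv z : z <> RtoC 0 -> Cmod (- / z) = / Cmod z.
Proof. intros N. rewrite Cmod_opp, Cmod_inv; auto. Qed.

Lemma stoltz_inv th z : stoltz th z -> stoltz th (- / z)%C.
Proof.
intros [Hz [H1 H2]]. pose proof (upper_ne0 z Hz) as N. split; [now apply upper_inv|].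
assert (P : 0 < Cmod z) by (apply Cmod_gt_0; auto).
assert (E : Arg_upper (- / z)%C = PI - Arg_upper z).
{ unfold Arg_upper. rewrite <- acos_opp. f_equal. rewrite Cmod_ninv by auto.
  replace (- / z)%C with ((-1) / z)%C by (field; auto). rewrite Cmult_conj_div, re_scal_l by auto.
  rewrite Re_mult, re_conj, im_conj. simpl. unfold Re, Im. field. lra. }
rewrite E. lra.
Qed.

Lemma asym0_iexp f n a : asym_exp_0 f (Z.of_nat n - 1) a ->
  iexp (fun z => z * f z)%C n (fun j => a (Z.of_nat j - 1)%Z).
Proof.
intros H eps He. pose proof PI_RGT_0. destruct (H (PI / 4) ltac:(lra) eps He) as [d [Hd K]]. exists d; split; auto.
intros y Hy. specialize (K (0, y) (stoltz_iy y ltac:(lra))). rewrite Cmod_iy in K by lra. specialize (K ltac:(lra)).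
assert (N : (0, y) <> RtoC 0) by (intros E; apply (f_equal snd) in E; simpl in E; lra).
rewrite <- laurent_hpoly by auto. rewrite <- (Cmod_iy y) at 5 by lra. rewrite <- Cmod_pow, <- Cmult_Cpowz, Cmod_mult by auto.
replace (-1 + Z.of_nat n)%Z with (Z.of_nat n - 1)%Z by lia.
match goal with |- Cmod (?a * ?b - ?a * ?c) <= _ => replace (a * b - a * c)%C with (a * (b - c))%C by ring end.
rewrite Cmod_mult. pose proof (Cmod_ge_0 (0, y)). nra.
Qed.

Lemma pexp_asym0 f n A a : (forall j, (j <= n)%nat -> a (Z.of_nat j - 1)%Z = A j) ->
  pexp (fun z => z * f z)%C n A -> asym_exp_0 f (Z.of_nat n - 1) a.
Proof.
intros HA H th Hth eps He. destruct (H (1 - cos th) (cos_range th Hth) eps He) as [d [Hd K]]. exists d; split; auto.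
intros z Hz Hzd. specialize (K z (stoltz_Stz th z Hth Hz) Hzd).
pose proof (upper_ne0 z (proj1 Hz)) as N. assert (P : 0 < Cmod z) by (apply Cmod_gt_0; auto).
rewrite <- (hpoly_ext n (fun j => a (Z.of_nat j - 1)%Z)) in K by auto.
rewrite <- laurent_hpoly in K by auto. rewrite <- Cmod_pow, <- Cmult_Cpowz, Cmod_mult in K by auto.
replace (-1 + Z.of_nat n)%Z with (Z.of_nat n - 1)%Z in K by lia.
match type of K with Cmod (?a * ?b - ?a * ?c) <= _ => replace (a * b - a * c)%C with (a * (b - c))%C in K by ring end.
rewrite Cmod_mult in K. apply (Rmult_le_reg_l (Cmod z)); auto. lra.
Qed.

(** The coefficients at 0 of f(-1/z) when [b] are those of f at infinity; the sign comes from
    (-1/z)^(-j) = (-1)^j z^j. *)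
Definition twist (b : Z -> R) (j : Z) : R := powerRZ (-1) j * b (- j)%Z.

Lemma Cpow_ninv z n : z <> RtoC 0 -> ((- / z) ^ n)%C = (RtoC ((-1) ^ n) * / (z ^ n))%C.
Proof.
intros N. replace (- / z)%C with (RtoC (-1) * / z)%C by ring. rewrite Cpow_mult_l, <- RtoC_pow, Cpow_inv; auto.
Qed.

Lemma Cpowz_ninv z j : z <> RtoC 0 -> Cpowz (- / z)%C (- j) = (RtoC (powerRZ (-1) j) * Cpowz z j)%C.
Proof.
intros N. assert (M : forall n, (z ^ n)%C <> RtoC 0) by (intros; now apply Cpow_nz).
assert (S : forall n, (-1) ^ n <> 0) by (intros; apply pow_nonzero; lra).
destruct j as [|p|p]; simpl.
- ring.
- rewrite Cpow_ninv by auto. set (n := Pos.to_nat p).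
  assert (E : RtoC ((-1) ^ n) = (/ RtoC ((-1) ^ n))%C).
  { rewrite <- RtoC_inv, <- pow_inv by auto. do 2 f_equal. field. }
  assert (Sn : RtoC ((-1) ^ n) <> RtoC 0) by (intros X; apply RtoC_inj in X; apply (S n); auto).
  rewrite E at 2. field. split; auto.
- rewrite Cpow_ninv by auto. rewrite <- pow_inv. replace (/ -1) with (-1) by field. reflexivity.
Qed.

Lemma Csum_head (f : nat -> C) n : sum_n f (S n) = (f O + sum_n (fun i => f (S i)) n)%C.
Proof.
induction n.
- rewrite sum_Sn, !sum_O. reflexivity.
- rewrite sum_Sn, IHn, sum_Sn. unfold plus; simpl. rewrite Cplus_assoc. reflexivity.
Qed.

Lemma Csum_rev (f : nat -> C) n : sum_n f n = sum_n (fun i => f (n - i)%nat) n.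
Proof.
revert f. induction n; intros f; [now rewrite !sum_O|].
rewrite Csum_head, (IHn (fun i => f (S i))), sum_Sn.
replace (S n - S n)%nat with O by lia.
rewrite (sum_n_ext_loc (fun i => f (S n - i)%nat) (fun i => f (S (n - i)))).
- unfold plus; simpl. ring.
- intros i Hi. f_equal. lia.
Qed.

Lemma laurent_inv b K z : (-1 <= K)%Z -> z <> RtoC 0 ->
  laurent_sum b (- K) 1 (- / z)%C = laurent_sum (twist b) (-1) K z.
Proof.
intros HK N. unfold laurent_sum. replace (Z.to_nat (1 - - K)) with (Z.to_nat (K - -1)) by lia.
rewrite Csum_rev. apply sum_n_ext_loc. intros i Hi.
replace (- K + Z.of_nat (Z.to_nat (K - -1) - i))%Z with (- (-1 + Z.of_nat i))%Z by lia.
rewrite Cpowz_ninv by auto. unfold twist. rewrite RtoC_mult.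
match goal with |- @eq _ ?x ?y => change (@eq C x y) end. ring.
Qed.

Lemma twist_twist b j : twist (twist b) j = b j.
Proof.
unfold twist. rewrite Z.opp_involutive, powerRZ_neg', <- Rmult_assoc, Rinv_r, Rmult_1_l; auto.
apply powerRZ_NOR. lra.
Qed.

Lemma Cmod_Cpowz_ninv z j : z <> RtoC 0 -> Cmod (Cpowz (- / z)%C (- j)) = Cmod (Cpowz z j).
Proof.
intros N. rewrite Cpowz_ninv, Cmod_mult, Cmod_R by auto.
assert (S : Rabs (powerRZ (-1) j) = 1).
{ pose proof (sgn_sq j) as S. rewrite <- Rabs_sq in S. pose proof (Rabs_pos (powerRZ (-1) j)). nra. }
rewrite S. ring.
Qed.

Lemma asym_inf_0 f K b : (-1 <= K)%Z -> asym_exp_inf f K b -> asym_exp_0 (fun z => f (- / z)%C) K (twist b).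
Proof.
intros HK H th Hth eps He. destruct (H th Hth eps He) as [r [Hr Q]].
exists (/ r); split; [now apply Rinv_0_lt_compat|]. intros z Hz Hzd.
pose proof (upper_ne0 z (proj1 Hz)) as N. assert (P : 0 < Cmod z) by (apply Cmod_gt_0; auto).
specialize (Q (- / z)%C (stoltz_inv th z Hz)). rewrite Cmod_ninv in Q by auto.
rewrite laurent_inv, Cmod_Cpowz_ninv in Q by auto. apply Q.
rewrite <- (Rinv_inv r). apply Rinv_lt_contravar; auto. apply Rmult_lt_0_compat; auto. now apply Rinv_0_lt_compat.
Qed.

Lemma laurent_ext a b lo hi z : (forall j, a j = b j) -> laurent_sum a lo hi z = laurent_sum b lo hi z.
Proof. intros E. unfold laurent_sum. apply sum_n_ext. intros n. now rewrite E. Qed.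

Lemma asym_0_inf f K a : (-1 <= K)%Z -> asym_exp_0 (fun z => f (- / z)%C) K a -> asym_exp_inf f K (twist a).
Proof.
intros HK H th Hth eps He. destruct (H th Hth eps He) as [d [Hd Q]].
exists (/ d); split; [now apply Rinv_0_lt_compat|]. intros w Hw Hwd.
pose proof (upper_ne0 w (proj1 Hw)) as N. assert (P : 0 < Cmod w) by (apply Cmod_gt_0; auto).
specialize (Q (- / w)%C (stoltz_inv th w Hw)). rewrite Cmod_ninv in Q by auto.
assert (Nw : (- / w)%C <> RtoC 0).
{ apply Cmod_gt_0. rewrite Cmod_ninv by auto. now apply Rinv_0_lt_compat. }
assert (E : (- / - / w)%C = w) by (field; auto).
rewrite E in Q.
rewrite (laurent_ext a (twist (twist a))), <- laurent_inv, E in Q by (auto; intros; now rewrite twist_twist).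
rewrite <- Cmod_Cpowz_ninv, E in Q by auto. apply Q.
rewrite <- (Rinv_inv d). apply Rinv_lt_contravar; auto. apply Rmult_lt_0_compat; auto. now apply Rinv_0_lt_compat.
Qed.

Lemma Rep_inv g J h : Rep g J h -> Rep g (Jinv J) (fun z => h (- / z)%C).
Proof.
intros HR z Hz. rewrite (HR _ (upper_inv z Hz)). apply f_equal.
pose proof (upper_ne0 z Hz) as N.
assert (E : forall c s, hker (- / z) c s = hker z (- s) c).
{ intros c s. unfold hker. rewrite RtoC_opp.
  (* Extensionality needs the identity for all real c and s, also off the circle. In this degenerate
     case both sides are 0, as the inverse of 0 is 0. *)
  destruct (Ceq_dec (RtoC c + RtoC s * z) 0) as [D|D].
  - replace (RtoC s - RtoC c * - / z)%C with ((RtoC c + RtoC s * z) / z)%C by (field; auto).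
    replace (RtoC c - - RtoC s * z)%C with (RtoC c + RtoC s * z)%C by ring. rewrite D. unfold Cdiv.
    rewrite Cmult_0_l.
    assert (I0 : (/ RtoC 0)%C = 0) by (apply C_ext; simpl; unfold Rdiv; ring). rewrite I0. ring.
  - field. repeat split; auto. intros X. apply D. rewrite <- X. ring. }
unfold JC, Jinv. f_equal; apply f_equal; do 2 (apply FunctionalExtensionality.functional_extensionality; intro);
  now rewrite E.
Qed.

(** * Differences of Herglotz functions *)

Definition Facts (N : nat) (g : R) (J : (R -> R -> R) -> R) (A : nat -> R) : Prop :=
  (forall al, atom J al -> A O = - al) /\
  ((1 <= N)%nat -> A 1%nat = g + mxy J) /\
  ((1 <= N)%nat -> forall al, atom (Jinv J) al -> lim0 (fun e => tmoment (-2) e J) (A 2%nat - al)) /\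
  (forall k : nat, (3 <= k <= 2 * N)%nat -> lim0 (fun e => tmoment (- Z.of_nat k) e J) (A k)).

Lemma tmoment_even_cv N J g h j : posfun J -> Rep g J h -> Good N J -> (- Z.of_nat N <= j <= -1)%Z ->
  exists l, lim0 (fun e => tmoment (2 * j) e J) l.
Proof.
intros HJ HR HG Hj. destruct (expansion_of_good N J g h HJ HR HG) as [A [_ [_ [_ [H2 H3]]]]].
destruct (Z.eq_dec j (-1)) as [->|Nj].
- destruct (atom_ex (Jinv J) (Jinv_posfun J HJ)) as [al [_ Hal]]. exists (A 2%nat - al). apply H2; auto. lia.
- exists (A (Z.to_nat (- 2 * j))). replace (2 * j)%Z with (- Z.of_nat (Z.to_nat (- 2 * j)))%Z by lia. apply H3. lia.
Qed.

Lemma Am_inv J k e : posfun J -> 0 < e -> tmoment k e J = powerRZ (-1) k * tmoment (- k - 2) e (Jinv J).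
Proof.
intros HJ He. rewrite tmoment_Jinv by auto. replace (- (- k - 2) - 2)%Z with k by lia.
replace (- k - 2)%Z with (- k + 2 * -1)%Z by lia.
rewrite powerRZ_add, powerRZ_neg', powerRZ_m1_even by lra. rewrite Rmult_1_r, <- Rmult_assoc, Rinv_r, Rmult_1_l; auto.
apply powerRZ_NOR; lra.
Qed.

Lemma tmoment_even_cv_inf N J g h j : posfun J -> Rep g J h -> Good N (Jinv J) -> (0 <= j <= Z.of_nat N - 1)%Z ->
  exists l, lim0 (fun e => tmoment (2 * j) e J) l.
Proof.
intros HJ HR HG Hj.
destruct (tmoment_even_cv N (Jinv J) g _ (- j - 1) (Jinv_posfun J HJ) (Rep_inv g J h HR) HG ltac:(lia)) as [l H].
exists l. revert H. apply lim0_ext. intros e He. rewrite (Am_inv J (2 * j)), powerRZ_m1_even, Rmult_1_l by auto.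
f_equal. lia.
Qed.

Lemma Bnd_of_even J (lo hi : Z) : posfun J ->
  (forall j, (lo <= j <= hi)%Z -> exists l, lim0 (fun e => tmoment (2 * j) e J) l) ->
  forall k, (2 * lo <= k <= 2 * hi)%Z -> Bnd k J.
Proof.
intros HJ H k Hk.
assert (E : forall j, (lo <= j <= hi)%Z -> Bnd (2 * j) J).
{ intros j Hj. destruct (H j Hj) as [l Hl]. exact (Bnd_even J j l HJ Hl). }
destruct (Z.Even_or_Odd k) as [[j ->]|[j ->]].
- apply E. lia.
- apply Bnd_between; auto.
  + replace (2 * j + 1 - 1)%Z with (2 * j)%Z by lia. apply E. lia.
  + replace (2 * j + 1 + 1)%Z with (2 * (j + 1))%Z by lia. apply E. lia.
Qed.

Lemma iexp_sub_swap f g q n A B : (forall z, upper z -> q z = (f z - g z)%C) ->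
  iexp (fun z => z * f z)%C n A -> iexp (fun z => z * q z)%C n B ->
  iexp (fun z => z * g z)%C n (fun j => A j - B j).
Proof.
intros Hq H K. pose proof (iexp_minus _ _ _ _ _ H K) as M. revert M. apply iexp_ext.
intros y Hy. rewrite Hq by (unfold upper; simpl; lra). ring.
Qed.

Lemma iexp_add f g q n A B : (forall z, upper z -> q z = (f z - g z)%C) ->
  iexp (fun z => z * g z)%C n A -> iexp (fun z => z * q z)%C n B ->
  iexp (fun z => z * f z)%C n (fun j => A j - (0 - B j)).
Proof.
intros Hq H K.
assert (Z : iexp (fun _ => RtoC 0) n (fun _ => 0)).
{ intros eps He. exists 1; split; [lra|]. intros y Hy.
  assert (E : forall m, hpoly m (fun _ => 0) (0, y) = 0) by (induction m; simpl; [reflexivity|rewrite IHm; ring]).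
  rewrite E. replace (RtoC 0 - RtoC 0)%C with (RtoC 0) by ring. rewrite Cmod_0. apply Rmult_le_pos; [lra|apply pow_le; lra]. }
pose proof (iexp_minus _ _ _ _ _ H (iexp_minus _ _ _ _ _ Z K)) as M. revert M. apply iexp_ext.
intros y Hy. rewrite Hq by (unfold upper; simpl; lra). ring.
Qed.

Lemma good_of_asym N J g h M a : posfun J -> Rep g J h -> asym_exp_0 h M a ->
  (2 * Z.of_nat N - 1 <= M)%Z -> Good N J.
Proof.
intros HJ HR H HM. replace M with (Z.of_nat (Z.to_nat (M + 1)) - 1)%Z in H by lia.
apply asym0_iexp in H. apply (good_of_iexp N J g h (fun j => a (Z.of_nat j - 1)%Z) HJ HR).
revert H. apply iexp_trunc. lia.
Qed.

Section Difference.
Context {ha hb q : C -> C} {ga gb : R} {Ja Jb : (R -> R -> R) -> R}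
  (PA : posfun Ja) (PB : posfun Jb) (RA : Rep ga Ja ha) (RB : Rep gb Jb hb)
  (Hq : forall z, upper z -> q z = (ha z - hb z)%C).

(** If one function has finite moments, it has an expansion, and along the imaginary axis the
    expansion of [q] passes to the other one. That is enough for [good_of_iexp], so both have finite
    moments, and uniqueness identifies the coefficients of [q]. *)
Lemma diff_coeffs N a : Good N Ja \/ Good N Jb -> asym_exp_0 q (2 * Z.of_nat N - 1) a ->
  exists A B, Good N Ja /\ Good N Jb /\ Facts N ga Ja A /\ Facts N gb Jb B /\
    forall j, (j <= 2 * N)%nat -> a (Z.of_nat j - 1)%Z = A j - B j.
Proof.
intros HG Ha. replace (2 * Z.of_nat N - 1)%Z with (Z.of_nat (2 * N) - 1)%Z in Ha by lia.
apply asym0_iexp in Ha.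
assert (GG : Good N Ja /\ Good N Jb).
{ destruct HG as [G|G].
  - destruct (expansion_of_good N Ja ga ha PA RA G) as [A [EA _]]. split; auto.
    apply (good_of_iexp N Jb gb hb _ PB RB (iexp_sub_swap _ _ _ _ _ _ Hq (pexp_iexp _ _ _ EA) Ha)).
  - destruct (expansion_of_good N Jb gb hb PB RB G) as [B [EB _]]. split; auto.
    apply (good_of_iexp N Ja ga ha _ PA RA (iexp_add _ _ _ _ _ _ Hq (pexp_iexp _ _ _ EB) Ha)). }
destruct GG as [GA GB].
destruct (expansion_of_good N Ja ga ha PA RA GA) as [A [EA FA]].
destruct (expansion_of_good N Jb gb hb PB RB GB) as [B [EB FB]].
exists A, B. repeat (split; [assumption|]).
pose proof (pexp_iexp _ _ _ (pexp_minus _ _ _ _ _ EA EB)) as E.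
intros j Hj. apply (iexp_unique _ (2 * N) (fun j => a (Z.of_nat j - 1)%Z) (fun j => A j - B j) Ha); auto.
revert E. apply iexp_ext. intros y Hy. rewrite Hq by (unfold upper; simpl; lra). ring.
Qed.

Lemma diff_residue al be a : atom Ja al -> atom Jb be -> asym_exp_0 q (-1) a -> a (-1)%Z = be - al.
Proof.
intros HA HB Ha. destruct (diff_coeffs 0 a (or_introl I) Ha) as [A [B [_ [_ [[FA _] [[FB _] E]]]]]].
specialize (E O ltac:(lia)). rewrite (FA al HA), (FB be HB) in E. simpl in E. lra.
Qed.

Lemma diff_expansion N : Good N Ja -> Good N Jb -> exists a, asym_exp_0 q (2 * Z.of_nat N - 1) a.
Proof.
intros GA GB.
destruct (expansion_of_good N Ja ga ha PA RA GA) as [A [EA _]].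
destruct (expansion_of_good N Jb gb hb PB RB GB) as [B [EB _]].
exists (fun j => A (Z.to_nat (j + 1)) - B (Z.to_nat (j + 1))).
replace (2 * Z.of_nat N - 1)%Z with (Z.of_nat (2 * N) - 1)%Z by lia.
apply (pexp_asym0 q (2 * N) (fun j => A j - B j)).
- intros j _. replace (Z.to_nat (Z.of_nat j - 1 + 1)) with j by lia. reflexivity.
- intros k Hk eps He. destruct (pexp_minus _ _ _ _ _ EA EB k Hk eps He) as [d [Hd K]]. exists d; split; auto.
  intros z Hz Hzd. specialize (K z Hz Hzd). rewrite Hq by apply Hz.
  replace (z * (ha z - hb z))%C with (z * ha z - z * hb z)%C by ring. exact K.
Qed.

Context (HA : Herglotz ha) (HB : Herglotz hb).

Lemma trunc_moment_diff k e y : 0 < e < 1 -> 0 < y ->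
  trunc_moment ha k e y - trunc_moment hb k e y = trunc_moment q k e y.
Proof.
intros He Hy. rewrite !trunc_moment_xy.
destruct (trunc_integrable HA k e y He Hy) as [A1 A2].
destruct (trunc_integrable HB k e y He Hy) as [B1 B2].
apply (RInt_correct (V := R_CompleteNormedModule)) in A1, A2, B1, B2.
assert (E : forall x, powerRZ x k * Im (q (x, y)) = powerRZ x k * Im (ha (x, y)) - powerRZ x k * Im (hb (x, y))).
{ intros x. rewrite Hq by (unfold upper; simpl; lra). rewrite Im_minus. ring. }
pose proof (is_RInt_minus (V := R_NormedModule) _ _ _ _ _ _ A1 B1) as D1.
pose proof (is_RInt_minus (V := R_NormedModule) _ _ _ _ _ _ A2 B2) as D2.
assert (F1 : RInt (fun x => powerRZ x k * Im (q (x, y))) (- / e) (- e) =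
  RInt (fun x => powerRZ x k * Im (ha (x, y))) (- / e) (- e) - RInt (fun x => powerRZ x k * Im (hb (x, y))) (- / e) (- e)).
{ apply is_RInt_unique. eapply is_RInt_ext; [|exact D1]. intros x _. symmetry. apply E. }
assert (F2 : RInt (fun x => powerRZ x k * Im (q (x, y))) e (/ e) =
  RInt (fun x => powerRZ x k * Im (ha (x, y))) e (/ e) - RInt (fun x => powerRZ x k * Im (hb (x, y))) e (/ e)).
{ apply is_RInt_unique. eapply is_RInt_ext; [|exact D2]. intros x _. symmetry. apply E. }
rewrite F1, F2. ring.
Qed.

Lemma inner_diff_lim k e : 0 < e < 1 ->
  lim0 (trunc_moment q k e) (inner_lim (trunc_moment ha k) e - inner_lim (trunc_moment hb k) e).
Proof.
intros He. apply (lim0_ext (fun y => trunc_moment ha k e y - trunc_moment hb k e y)).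
- intros y Hy. now apply trunc_moment_diff.
- apply lim0_minus; apply inner_lim_spec; auto; [apply (herglotz_inner HA PA RA)|apply (herglotz_inner HB PB RB)].
Qed.

Lemma inner_diff k : inner (trunc_moment q k).
Proof. intros e He. eexists. now apply inner_diff_lim. Qed.

Lemma inner_lim_diff k e : 0 < e < 1 ->
  inner_lim (trunc_moment ha k) e - inner_lim (trunc_moment hb k) e = inner_lim (trunc_moment q k) e.
Proof.
intros He. apply (lim0_unique (trunc_moment q k e)); [now apply inner_diff_lim|].
apply inner_lim_spec; auto. apply inner_diff.
Qed.

Lemma diff_limit k la lb : Bnd k Ja -> Bnd k Jb -> lim0 (fun e => tmoment k e Ja) la -> lim0 (fun e => tmoment k e Jb) lb ->
  iter_lim (trunc_moment q k) (PI * (la - lb)).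
Proof.
intros BA BB LA LB. apply iter_lim_inner_lim; [apply inner_diff|].
apply (lim0_ext_loc (fun e => inner_lim (trunc_moment ha k) e - inner_lim (trunc_moment hb k) e) _ _ 1 Rlt_0_1).
- intros e He. now apply inner_lim_diff.
- replace (PI * (la - lb)) with (PI * la - PI * lb) by ring.
  apply lim0_minus; [apply (inner_lim_cv HA PA RA)|apply (inner_lim_cv HB PB RB)]; auto.
Qed.

Lemma diff_limit_pi k la lb : Bnd k Ja -> Bnd k Jb -> lim0 (fun e => tmoment k e Ja) la -> lim0 (fun e => tmoment k e Jb) lb ->
  iter_lim (fun e y => / PI * trunc_moment q k e y) (la - lb).
Proof.
intros BA BB LA LB. pose proof PI_RGT_0.
replace (la - lb) with (/ PI * (PI * (la - lb))) by (field; lra).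
apply iter_lim_scal, diff_limit; auto.
Qed.

(** Adding or subtracting the known limit for one function gives a finite limit for the other, and
    since the order is even a finite limit bounds its moments. [E] is kept abstract to serve both
    ends: [Good] of [J] at 0 and [Good] of [Jinv J] at infinity. *)
Lemma both_of_limit (E : ((R -> R -> R) -> R) -> Prop) j L :
  (forall J, posfun J -> forall B e0, 0 < e0 -> (forall e, 0 < e < e0 -> tmoment (2 * j) e J <= B) -> E J) ->
  (E Ja -> exists l, lim0 (fun e => tmoment (2 * j) e Ja) l) ->
  (E Jb -> exists l, lim0 (fun e => tmoment (2 * j) e Jb) l) ->
  E Ja \/ E Jb -> iter_lim (trunc_moment q (2 * j)) L -> E Ja /\ E Jb.
Proof.
intros Hbd HcA HcB HE HL. apply iter_lim_inner_lim in HL; [|apply inner_diff].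
destruct HE as [G|G]; split; auto.
- destruct (HcA G) as [l Hl].
  pose proof (inner_lim_cv HA PA RA _ _ (Bnd_even Ja j l PA Hl) Hl) as DA.
  pose proof (lim0_minus _ _ _ _ DA HL) as D.
  assert (DB : lim0 (inner_lim (trunc_moment hb (2 * j))) (PI * l - L)).
  { revert D. apply (lim0_ext_loc _ _ _ 1 Rlt_0_1). intros e He. rewrite <- inner_lim_diff by auto. ring. }
  destruct (tmoment_bounded_of_inner_lim HB PB RB j _ DB) as [B [e0 [He0 K]]]. exact (Hbd Jb PB B e0 He0 K).
- destruct (HcB G) as [l Hl].
  pose proof (inner_lim_cv HB PB RB _ _ (Bnd_even Jb j l PB Hl) Hl) as DB.
  pose proof (lim0_plus _ _ _ _ DB HL) as D.
  assert (DA : lim0 (inner_lim (trunc_moment ha (2 * j))) (PI * l + L)).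
  { revert D. apply (lim0_ext_loc _ _ _ 1 Rlt_0_1). intros e He. rewrite <- inner_lim_diff by auto. ring. }
  destruct (tmoment_bounded_of_inner_lim HA PA RA j _ DA) as [B [e0 [He0 K]]]. exact (Hbd Ja PA B e0 He0 K).
Qed.

End Difference.

Theorem theorem3p1 (h1 h2 q : C -> C)
  (Hh1 : Herglotz h1) (Hh2 : Herglotz h2)
  (Hq : forall z : C, upper z -> q z = Cminus (h1 z) (h2 z)) :
  (* (i) *)
  (forall (M : Z) (a' : Z -> R), (-1 <= M)%Z ->
     (asym_exp_0 h1 M a' \/ asym_exp_0 h2 M a') ->
     forall N0 : Z, (1 <= N0)%Z -> (2 * N0 - 1 <= M)%Z ->
       ((exists L : R, iter_lim (trunc_moment q (- 2 * N0)) L) <->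
        (exists a : Z -> R, asym_exp_0 q (2 * N0 - 1) a)))
  /\
  (* (ii) *)
  (forall (K : Z) (b' : Z -> R), (-1 <= K)%Z ->
     (asym_exp_inf h1 K b' \/ asym_exp_inf h2 K b') ->
     forall Ninf : Z, (0 <= Ninf)%Z -> (2 * Ninf + 1 <= K)%Z ->
       ((exists L : R, iter_lim (trunc_moment q (2 * Ninf)) L) <->
        (exists b : Z -> R, asym_exp_inf q (2 * Ninf + 1) b)))
  /\
  (* identities for k = -2N0, ..., -3 and k = -2 *)
  (forall (M : Z) (a' : Z -> R), (-1 <= M)%Z ->
     (asym_exp_0 h1 M a' \/ asym_exp_0 h2 M a') ->
     forall N0 : Z, (1 <= N0)%Z -> (2 * N0 - 1 <= M)%Z ->
     forall a : Z -> R, asym_exp_0 q (2 * N0 - 1) a ->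
       (forall k : Z, (- 2 * N0 <= k <= -3)%Z ->
          iter_lim (fun eps y => / PI * trunc_moment q k eps y) (a (- k - 1)%Z))
       /\
       (forall b : Z -> R, asym_exp_inf q (-1) b ->
          iter_lim (fun eps y => / PI * trunc_moment q (-2) eps y) (a 1%Z - b 1%Z)))
  /\
  (* identities for k = 1, ..., 2Ninf and k = 0 *)
  (forall (K : Z) (b' : Z -> R), (-1 <= K)%Z ->
     (asym_exp_inf h1 K b' \/ asym_exp_inf h2 K b') ->
     forall Ninf : Z, (0 <= Ninf)%Z -> (2 * Ninf + 1 <= K)%Z ->
     forall b : Z -> R, asym_exp_inf q (2 * Ninf + 1) b ->
       (forall k : Z, (1 <= k <= 2 * Ninf)%Z ->
          iter_lim (fun eps y => / PI * trunc_moment q k eps y) (- b (- k - 1)%Z))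
       /\
       (forall a : Z -> R, asym_exp_0 q (-1) a ->
          iter_lim (fun eps y => / PI * trunc_moment q 0 eps y) (a (-1)%Z - b (-1)%Z)))
  /\
  (* identity for k = -1 *)
  (forall (M : Z) (a' : Z -> R) (K : Z) (b' : Z -> R), (-1 <= M)%Z -> (-1 <= K)%Z ->
     (asym_exp_0 h1 M a' \/ asym_exp_0 h2 M a') ->
     (asym_exp_inf h1 K b' \/ asym_exp_inf h2 K b') ->
     forall N0 Ninf : Z, (1 <= N0)%Z -> (2 * N0 - 1 <= M)%Z ->
       (0 <= Ninf)%Z -> (2 * Ninf + 1 <= K)%Z ->
     forall (a b : Z -> R), asym_exp_0 q (2 * N0 - 1) a ->
       asym_exp_inf q (2 * Ninf + 1) b ->
       iter_lim (fun eps y => / PI * trunc_moment q (-1) eps y) (a 0%Z - b 0%Z)).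
Proof.
destruct (herglotz_rep h1 Hh1) as [g1 [Ja [PA RA]]].
destruct (herglotz_rep h2 Hh2) as [g2 [Jb [PB RB]]].
pose proof (Jinv_posfun Ja PA) as PA'. pose proof (Jinv_posfun Jb PB) as PB'.
pose proof (Rep_inv g1 Ja h1 RA) as RA'. pose proof (Rep_inv g2 Jb h2 RB) as RB'.
assert (Hq' : forall z, upper z -> q (- / z)%C = (h1 (- / z) - h2 (- / z))%C) by (intros z Hz; apply Hq, upper_inv, Hz).
destruct (atom_ex Ja PA) as [ala [_ Ala]]. destruct (atom_ex Jb PB) as [alb [_ Alb]].
destruct (atom_ex (Jinv Ja) PA') as [bea [_ Bea]]. destruct (atom_ex (Jinv Jb) PB') as [beb [_ Beb]].
assert (G0 : forall M a' N0, asym_exp_0 h1 M a' \/ asym_exp_0 h2 M a' -> (1 <= N0)%Z -> (2 * N0 - 1 <= M)%Z ->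
  Good (Z.to_nat N0) Ja \/ Good (Z.to_nat N0) Jb).
{ intros M a' N0 [H|H] H1 H2; [left; apply (good_of_asym _ Ja g1 h1 M a' PA RA H)|right; apply (good_of_asym _ Jb g2 h2 M a' PB RB H)]; lia. }
(* Order 2N + 1 at infinity is order 2(N + 1) - 1 at 0 after z -> -1/z; hence N + 1. *)
assert (Gi : forall K b' N, asym_exp_inf h1 K b' \/ asym_exp_inf h2 K b' -> (0 <= N)%Z -> (2 * N + 1 <= K)%Z ->
  Good (Z.to_nat (N + 1)) (Jinv Ja) \/ Good (Z.to_nat (N + 1)) (Jinv Jb)).
{ intros K b' N [H|H] H1 H2; apply asym_inf_0 in H; try lia;
    [left; apply (good_of_asym _ (Jinv Ja) g1 _ K _ PA' RA' H)|right; apply (good_of_asym _ (Jinv Jb) g2 _ K _ PB' RB' H)]; lia. }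
assert (C0 : forall N0 a, (1 <= N0)%Z -> Good (Z.to_nat N0) Ja \/ Good (Z.to_nat N0) Jb -> asym_exp_0 q (2 * N0 - 1) a ->
  exists A B, Good (Z.to_nat N0) Ja /\ Good (Z.to_nat N0) Jb /\ Facts (Z.to_nat N0) g1 Ja A /\ Facts (Z.to_nat N0) g2 Jb B /\
    forall j, (j <= 2 * Z.to_nat N0)%nat -> a (Z.of_nat j - 1)%Z = A j - B j).
{ intros N0 a H1 HG Ha. apply (diff_coeffs PA PB RA RB Hq); auto. now rewrite Z2Nat.id by lia. }
assert (Ci' : forall N b, (0 <= N)%Z -> Good (Z.to_nat (N + 1)) (Jinv Ja) \/ Good (Z.to_nat (N + 1)) (Jinv Jb) -> asym_exp_inf q (2 * N + 1) b ->
  exists A B, Good (Z.to_nat (N + 1)) (Jinv Ja) /\ Good (Z.to_nat (N + 1)) (Jinv Jb) /\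
    Facts (Z.to_nat (N + 1)) g1 (Jinv Ja) A /\ Facts (Z.to_nat (N + 1)) g2 (Jinv Jb) B /\
    forall j, (j <= 2 * Z.to_nat (N + 1))%nat -> twist b (Z.of_nat j - 1)%Z = A j - B j).
{ intros N b H1 HG Hb. apply asym_inf_0 in Hb; [|lia]. apply (diff_coeffs PA' PB' RA' RB' Hq'); auto.
  rewrite Z2Nat.id by lia. now replace (2 * (N + 1) - 1)%Z with (2 * N + 1)%Z by lia. }
assert (B0 : forall N0 k, Good (Z.to_nat N0) Ja -> Good (Z.to_nat N0) Jb -> (1 <= N0)%Z -> (- 2 * N0 <= k <= -2)%Z -> Bnd k Ja /\ Bnd k Jb).
{ intros N0 k GA GB H1 Hk. split; [apply (Bnd_of_even Ja (- N0) (-1) PA)|apply (Bnd_of_even Jb (- N0) (-1) PB)]; try lia;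
    intros j Hj; [apply (tmoment_even_cv _ Ja g1 h1 j PA RA GA)|apply (tmoment_even_cv _ Jb g2 h2 j PB RB GB)]; lia. }
assert (Bi : forall N k, Good (Z.to_nat (N + 1)) (Jinv Ja) -> Good (Z.to_nat (N + 1)) (Jinv Jb) -> (0 <= N)%Z -> (0 <= k <= 2 * N)%Z -> Bnd k Ja /\ Bnd k Jb).
{ intros N k GA GB H1 Hk. split; [apply (Bnd_of_even Ja 0 N PA)|apply (Bnd_of_even Jb 0 N PB)]; try lia;
    intros j Hj; [apply (tmoment_even_cv_inf _ Ja g1 h1 j PA RA GA)|apply (tmoment_even_cv_inf _ Jb g2 h2 j PB RB GB)]; lia. }
split; [|split; [|split; [|split]]].
- intros M a' HM HE N0 HN HNM. specialize (G0 M a' N0 HE HN HNM). split.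
  + intros [L HL].
    replace (- 2 * N0)%Z with (2 * (- N0))%Z in HL by lia.
    destruct (both_of_limit PA PB RA RB Hq Hh1 Hh2 (Good (Z.to_nat N0)) (- N0) L) as [GA GB]; auto.
    * intros J HJ B e0 He0 HB. apply (good_of_bounded (Z.to_nat N0) J B e0 HJ He0).
      replace (- 2 * Z.of_nat (Z.to_nat N0))%Z with (2 * - N0)%Z by lia. exact HB.
    * intros G. apply (tmoment_even_cv _ Ja g1 h1 _ PA RA G). lia.
    * intros G. apply (tmoment_even_cv _ Jb g2 h2 _ PB RB G). lia.
    * destruct (diff_expansion PA PB RA RB Hq (Z.to_nat N0) GA GB) as [a Ha]. exists a. now rewrite Z2Nat.id in Ha by lia.
  + intros [a Ha]. destruct (C0 N0 a HN G0 Ha) as [A [B [GA [GB _]]]].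
    destruct (tmoment_even_cv _ Ja g1 h1 (- N0) PA RA GA ltac:(lia)) as [la La].
    destruct (tmoment_even_cv _ Jb g2 h2 (- N0) PB RB GB ltac:(lia)) as [lb Lb].
    replace (2 * - N0)%Z with (- 2 * N0)%Z in La, Lb by lia.
    destruct (B0 N0 (- 2 * N0)%Z GA GB HN ltac:(lia)) as [BA BB].
    exists (PI * (la - lb)). apply (diff_limit PA PB RA RB Hq Hh1 Hh2); auto.
- intros K b' HK HE N HN HNK. specialize (Gi K b' N HE HN HNK). split.
  + intros [L HL].
    destruct (both_of_limit PA PB RA RB Hq Hh1 Hh2 (fun J => Good (Z.to_nat (N + 1)) (Jinv J)) N L) as [GA GB]; auto.
    * intros J HJ B e0 He0 HB. apply (good_of_bounded (Z.to_nat (N + 1)) (Jinv J) B e0 (Jinv_posfun J HJ) He0).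
      intros e He. specialize (HB e He). rewrite Am_inv, powerRZ_m1_even, Rmult_1_l in HB by (auto; lra).
      replace (- 2 * Z.of_nat (Z.to_nat (N + 1)))%Z with (- (2 * N) - 2)%Z by lia. exact HB.
    * intros G. apply (tmoment_even_cv_inf _ Ja g1 h1 _ PA RA G). lia.
    * intros G. apply (tmoment_even_cv_inf _ Jb g2 h2 _ PB RB G). lia.
    * destruct (diff_expansion PA' PB' RA' RB' Hq' (Z.to_nat (N + 1)) GA GB) as [a Ha]. exists (twist a).
      apply asym_0_inf; [lia|]. replace (2 * N + 1)%Z with (2 * Z.of_nat (Z.to_nat (N + 1)) - 1)%Z by lia. exact Ha.
  + intros [b Hb]. destruct (Ci' N b HN Gi Hb) as [A [B [GA [GB _]]]].
    destruct (tmoment_even_cv_inf _ Ja g1 h1 N PA RA GA ltac:(lia)) as [la La].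
    destruct (tmoment_even_cv_inf _ Jb g2 h2 N PB RB GB ltac:(lia)) as [lb Lb].
    destruct (Bi N (2 * N)%Z GA GB HN ltac:(lia)) as [BA BB].
    exists (PI * (la - lb)). apply (diff_limit PA PB RA RB Hq Hh1 Hh2); auto.
- intros M a' HM HE N0 HN HNM a Ha. specialize (G0 M a' N0 HE HN HNM).
  destruct (C0 N0 a HN G0 Ha) as [A [B [GA [GB [[_ [_ [FA2 FA3]]] [[_ [_ [FB2 FB3]]] E]]]]]].
  split.
  + intros k Hk. destruct (B0 N0 k GA GB HN ltac:(lia)) as [BA BB].
    replace (- k - 1)%Z with (Z.of_nat (Z.to_nat (- k)) - 1)%Z by lia. rewrite E by lia.
    pose proof (FA3 (Z.to_nat (- k)) ltac:(lia)) as LA. pose proof (FB3 (Z.to_nat (- k)) ltac:(lia)) as LB.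
    replace (- Z.of_nat (Z.to_nat (- k)))%Z with k in LA, LB by lia.
    apply (diff_limit_pi PA PB RA RB Hq Hh1 Hh2); auto.
  + intros b Hb. destruct (B0 N0 (-2)%Z GA GB HN ltac:(lia)) as [BA BB].
    apply asym_inf_0 in Hb; [|lia]. pose proof (diff_residue PA' PB' RA' RB' Hq' bea beb _ Bea Beb Hb) as R.
    unfold twist in R. simpl in R.
    (* The point masses at infinity carried by the two limits combine to the coefficient b_1:
       [diff_residue] after inversion gives bea - beb = b 1. *)
    replace (a 1%Z - b 1%Z) with ((A 2%nat - bea) - (B 2%nat - beb)).
    * apply (diff_limit_pi PA PB RA RB Hq Hh1 Hh2); auto; [apply FA2; auto; lia|apply FB2; auto; lia].
    * specialize (E 2%nat ltac:(lia)). simpl in E. rewrite E.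
      replace (/ (-1 * 1) * b 1%Z) with (- b 1%Z) in R by field. lra.
- intros K b' HK HE N HN HNK b Hb. specialize (Gi K b' N HE HN HNK).
  destruct (Ci' N b HN Gi Hb) as [A [B [GA [GB [[_ [_ [FA2 FA3]]] [[_ [_ [FB2 FB3]]] E]]]]]].
  assert (LI : forall J k l, posfun J -> lim0 (fun e => tmoment (- k - 2) e (Jinv J)) l -> lim0 (fun e => tmoment k e J) (powerRZ (-1) k * l)).
  { intros J k l HJ HL. apply (lim0_ext (fun e => powerRZ (-1) k * tmoment (- k - 2) e (Jinv J))); [|now apply lim0_scal].
    intros e He. symmetry. now apply Am_inv. }
  split.
  + intros k Hk. destruct (Bi N k GA GB HN ltac:(lia)) as [BA BB].
    pose proof (FA3 (Z.to_nat (k + 2)) ltac:(lia)) as LA. pose proof (FB3 (Z.to_nat (k + 2)) ltac:(lia)) as LB.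
    replace (- Z.of_nat (Z.to_nat (k + 2)))%Z with (- k - 2)%Z in LA, LB by lia.
    specialize (E (Z.to_nat (k + 2)) ltac:(lia)).
    replace (Z.of_nat (Z.to_nat (k + 2)) - 1)%Z with (k + 1)%Z in E by lia.
    (* The inversion contributes (-1)^k through the moment and (-1)^(k+1) through [twist], so the
       product of the signs is always -1. *)
    replace (- b (- k - 1)%Z) with (powerRZ (-1) k * A (Z.to_nat (k + 2)) - powerRZ (-1) k * B (Z.to_nat (k + 2))).
    * apply (diff_limit_pi PA PB RA RB Hq Hh1 Hh2); auto.
    * rewrite <- Rmult_minus_distr_l, <- E. unfold twist. rewrite powerRZ_add by lra.
      replace (- (k + 1))%Z with (- k - 1)%Z by lia.
      replace (powerRZ (-1) 1) with (-1) by (simpl; ring). pose proof (sgn_sq k) as S.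
      transitivity ((powerRZ (-1) k * powerRZ (-1) k) * - b (- k - 1)%Z); [ring|rewrite S; ring].
  + intros a Ha. destruct (Bi N 0%Z GA GB HN ltac:(lia)) as [BA BB].
    pose proof (diff_residue PA PB RA RB Hq ala alb _ Ala Alb Ha) as R.
    (* Two quarter turns send (c, s) to (-c, -s), and [u] is even. *)
    assert (AT : forall J al, posfun J -> atom J al -> atom (Jinv (Jinv J)) al).
    { intros J al HJ HA. assert (Eu : forall e, Jinv (Jinv J) (u e) = J (u e)).
      { intros e. unfold Jinv. apply f_equal. do 2 (apply FunctionalExtensionality.functional_extensionality; intro).
        unfold u. rewrite !Rmult_opp_opp. reflexivity. }
      destruct HA as [H1 H2]. split.
      - apply (lim0_ext (fun e => J (u e))); auto.
      - intros e He. rewrite Eu. auto. }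
    pose proof (LI Ja 0%Z _ PA (FA2 ltac:(lia) ala (AT Ja ala PA Ala))) as LA.
    pose proof (LI Jb 0%Z _ PB (FB2 ltac:(lia) alb (AT Jb alb PB Alb))) as LB.
    simpl powerRZ in LA, LB. rewrite Rmult_1_l in LA, LB.
    replace (a (-1)%Z - b (-1)%Z) with ((A 2%nat - ala) - (B 2%nat - alb)).
    * apply (diff_limit_pi PA PB RA RB Hq Hh1 Hh2); auto.
    * specialize (E 2%nat ltac:(lia)). unfold twist in E. simpl in E. lra.
- intros M a' K b' HM HK HE HE' N0 N HN HNM HN' HNK a b Ha Hb.
  specialize (G0 M a' N0 HE HN HNM). specialize (Gi K b' N HE' HN' HNK).
  destruct (C0 N0 a HN G0 Ha) as [A [B [GA [GB [[_ [FA1 _]] [[_ [FB1 _]] E]]]]]].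
  destruct (Ci' N b HN' Gi Hb) as [A' [B' [GA' [GB' [[_ [FA1' _]] [[_ [FB1' _]] E']]]]]].
  destruct (B0 N0 (-2)%Z GA GB HN ltac:(lia)) as [BA2 BB2]. destruct (Bi N 0%Z GA' GB' HN' ltac:(lia)) as [BA0 BB0].
  assert (G1 : forall n J, (1 <= n)%nat -> Good n J -> Good1 J) by (intros [|n] J Hn HG; [lia|exact (proj1 HG)]).
  specialize (E 1%nat ltac:(lia)). specialize (E' 1%nat ltac:(lia)). unfold twist in E'. simpl in E, E'.
  rewrite FA1, FB1 in E by lia. rewrite FA1', FB1' in E' by lia.
  (* The constants [g1] and [g2] occur both in a_0 and in b_0 and cancel, which leaves exactly the
     limits of [tmoment_m1_lim]. *)
  replace (a 0%Z - b 0%Z) with ((mxy Ja - mxy (Jinv Ja)) - (mxy Jb - mxy (Jinv Jb))) by lra.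
  apply (diff_limit_pi PA PB RA RB Hq Hh1 Hh2).
  (* Order -1 lies between order -2, bounded by the hypothesis at 0, and order 0, bounded by the
     hypothesis at infinity. *)
  + apply Bnd_between; auto.
  + apply Bnd_between; auto.
  + apply tmoment_m1_lim; auto; [apply (G1 (Z.to_nat N0)); auto; lia|apply (G1 (Z.to_nat (N + 1))); auto; lia].
  + apply tmoment_m1_lim; auto; [apply (G1 (Z.to_nat N0)); auto; lia|apply (G1 (Z.to_nat (N + 1))); auto; lia].
Qed.
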